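(* For the analytic continuation of $\hat{N}_{W}(a,x)=W(a,x)\int_{x}^{\infty} W(a,-t)dt-W(a,-x) \int_{x}^{\infty} W(a,t)dt$ to complex argument $z$ (via the extension of $W(a,z)$ below) we have \[ \hat{N}_{W}(a,z)=W_{0}^{(0,3)}(a,z) =ie^{\pi a/2}\left[W_{3}(a,z) \int_{e^{\pi i/4}\infty}^z W_{0}(a,t)dt -W_{0}(a,z) \int_{e^{-\pi i/4}\infty}^z W_{3}(a,t)dt \right]. \]
   Context: Throughout, $a$ is real. $W(a,\pm x)$ are the Weber parabolic cylinder functions (DLMF Sect. 12.14), numerically satisfactory solutions for real $a,x$ of $y''+(\tfrac14 x^2-a)y=0$. $U(a,z)$ is the standard parabolic cylinder function, the solution of $y''-(\tfrac14 z^2+a)y=0$ with $U(a,z)\sim z^{-a-1/2}e^{-z^2/4}$ as $z\to\infty$, $|\arg z|\le \tfrac34\pi-\delta$. For $j=0,1,2,3$, $W_{j}(a,z)=U\left((-1)^{j}ia,(-i)^{j}ze^{-\pi i/4}\right)$; these solve $y''+(\tfrac14 z^2-a)y=0$. $W(a,z)$ is extended to complex $z$ by $W(a,z)=\sqrt{\tfrac{1}{2}k}\, e^{\pi a/4}\{ e^{i\rho}W_{0}(a,z)+e^{-i\rho }W_{3}(a,z)\}$, where $k=\sqrt{1+e^{2\pi a}}-e^{\pi a}$, $\rho=\tfrac12\phi_2+\tfrac18\pi$, $\phi_2=\arg\Gamma(\tfrac12+ia)$ (branch zero at $a=0$, continuous). The complementary Nield-Kuznetsov function is $\hat{N}_{W}(a,x)=W(a,x)\int_{x}^{\infty}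 W(a,-t)dt-W(a,-x) \int_{x}^{\infty} W(a,t)dt$ for real $x$; $-\hat N_W$ solves $y''+(\tfrac14 x^2-a)y=-1$. For nonnegative integers $R$, $W_{R}^{(0,3)}(a,z)=ie^{\pi a/2}[W_{3}(a,z)\int_{e^{\pi i/4}\infty}^z t^{R}W_{0}(a,t)dt-W_{0}(a,z)\int_{e^{-\pi i/4}\infty}^z t^{R}W_{3}(a,t)dt]$, a solution of $y''+(\tfrac14 z^2-a)y=z^R$. *)

(* Defs.v *)
From Stdlib Require Export Reals.
From Coquelicot Require Export Coquelicot.

Open Scope C_scope.

Definition Cexp (z : C) : C :=
  (exp (fst z) * cos (snd z), exp (fst z) * sin (snd z))%R.

(** Principal argument, with values in (-pi, pi] (0 at z = 0). *)
Definition Carg (z : C) : R :=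
  let x := fst z in let y := snd z in
  if Rlt_dec 0 x then atan (y / x)
  else if Rlt_dec x 0 then
    (if Rle_dec 0 y then atan (y / x) + PI else atan (y / x) - PI)%R
  else if Rlt_dec 0 y then (PI / 2)%R
  else if Rlt_dec y 0 then (- (PI / 2))%R
  else 0%R.

Definition Clog (z : C) : C := (ln (Cmod z), Carg z).
Definition Cpow (z s : C) : C := Cexp (s * Clog z).

Definition CRInt_gen (f : R -> C) (Fa Fb : (R -> Prop) -> Prop) : C :=
  (RInt_gen (fun t => fst (f t)) Fa Fb, RInt_gen (fun t => snd (f t)) Fa Fb).

Definition Cgamma (s : C) : C :=
  CRInt_gen (fun t => Cexp ((s - 1) * RtoC (ln t)) * RtoC (exp (- t)))
            (at_right 0) (Rbar_locally p_infty).

(** Contour integral from infinity in direction e^{i alpha} to z, along the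
    ray { z + s e^{i alpha} : s >= 0 }:
    int_{e^{i alpha} oo}^z f(t) dt = - int_0^oo f(z + s e^{i alpha}) e^{i alpha} ds. *)
Definition CInt_from_inf (alpha : R) (f : C -> C) (z : C) : C :=
  - CRInt_gen (fun s => f (z + RtoC s * Cexp (0, alpha)) * Cexp (0, alpha))
              (at_point 0) (Rbar_locally p_infty).

(** Characterization of the standard parabolic cylinder function U(b,z):
    for every complex b, z |-> U(b,z) is entire, solves y'' = (z^2/4 + b) y,
    and U(b,z) ~ z^{-b-1/2} e^{-z^2/4} as z -> oo, |arg z| <= 3pi/4 - delta. *)
Definition is_PCF_U (U : C -> C -> C) : Prop :=
  forall b : C,
    (exists U1 : C -> C, forall z : C,
        is_derive (U b) z (U1 z) /\
        is_derive U1 z ((z * z / 4 + b) * U b z)) /\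
    (forall delta : R, (0 < delta)%R -> forall eps : R, (0 < eps)%R ->
       exists M : R, forall z : C, (M < Cmod z)%R ->
         (Rabs (Carg z) <= 3 * PI / 4 - delta)%R ->
         (Cmod (U b z / (Cpow z (- b - / 2) * Cexp (- (z * z) / 4)) - 1) < eps)%R).

Definition is_phi2 (phi2 : R -> R) : Prop :=
  (forall a : R, continuity_pt phi2 a) /\ phi2 0%R = 0%R /\
  forall a : R, Cgamma (/ 2 + Ci * RtoC a) = RtoC (Cmod (Cgamma (/ 2 + Ci * RtoC a))) * Cexp (0, phi2 a).

Section PCF.
Variable U : C -> C -> C.

Definition Wj (j : nat) (a : R) (z : C) : C :=
  U (pow_n (-1) j * Ci * RtoC a) (pow_n (- Ci) j * z * Cexp (0%R, (- (PI / 4))%R)).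

Definition kW (a : R) : R := (sqrt (1 + exp (2 * PI * a)) - exp (PI * a))%R.

Definition W (phi2 : R -> R) (a : R) (z : C) : C :=
  let rho := (phi2 a / 2 + PI / 8)%R in
  RtoC (sqrt (kW a / 2) * exp (PI * a / 4)) *
  (Cexp (0, rho) * Wj 0 a z + Cexp (0%R, (- rho)%R) * Wj 3 a z).

Definition NhatW (phi2 : R -> R) (a x : R) : C :=
  W phi2 a (RtoC x) *
    CRInt_gen (fun t => W phi2 a (RtoC (- t))) (at_point x) (Rbar_locally p_infty)
  - W phi2 a (RtoC (- x)) *
    CRInt_gen (fun t => W phi2 a (RtoC t)) (at_point x) (Rbar_locally p_infty).

Definition W03 (Rn : nat) (a : R) (z : C) : C :=
  Ci * RtoC (exp (PI * a / 2)) *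
  (Wj 3 a z * CInt_from_inf (PI / 4) (fun t => pow_n t Rn * Wj 0 a t) z
   - Wj 0 a z * CInt_from_inf (- (PI / 4)) (fun t => pow_n t Rn * Wj 3 a t) z).

End PCF.

(* Main.v *)
Require Import Defs.
From Stdlib Require Import Lra Classical_Prop FunctionalExtensionality.

(** Put [A = e^{i rho} W_0], [B = e^{-i rho} W_3], so [W(x) = c (A + B)].  Both
    [x |-> W(-x)] and [A], [B] solve the same equation, hence [W(-x) = p A + q B],
    and bilinearity turns [N^_W] into [c (p - q) (B int_x^oo A - A int_x^oo B)].
    Rotating the contours (primitives of [W_0] and [W_3] exist because they are
    entire, and have the same limit along all rays between the real axis and the
    direction of decay) this is the claimed formula as soon as
    [c (p - q) = - i e^{pi a/2}], a statement about the Wronskian of [W(x)] and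
    [W(-x)], that is about [W(0) W'(0)].

    The values of [U(+-ia, .)] and their derivatives at 0 enter only through the
    products [u v'], [u' v], [u u'] and [v v'] (with [u = U(ia, .)],
    [v = U(-ia, .)]).  The first two come from the Wronskians of [U(ia, x)] with
    [U(-ia, +-ix)], read off the asymptotics at [+oo]; they also give the product
    of the last two.  For the phase of [u u'] one needs [Gamma (1/2 + ia)]: the
    Laplace integral [V] of [U(ia, .)] equals [Gamma (1/2 + ia) U(ia, .)], so
    [-2 Gamma (1/2 + ia) u u'] is the Wronskian of [U(ia, x)] and [V(-x)], which
    Laplace's method shows to be a positive number independent of [a]. *)

Local Open Scope R_scope.

(** * Complex-valued functions of a real variable *)

(** What shapes the proof is how little [is_PCF_U] provides: the differential equation and the
    leading behaviour of U itself in a sector. Nothing is given on U', on connection formulas or on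
    values at 0, so every constant has to appear as a limit at infinity.

    The Wronskians fix the product (u u')(v v') but not its two factors. Laplace's method is
    therefore asked for only two facts about the number w = -Gamma(1/2 + ia) u u': it is positive,
    and it is the same at a and at -a. Since Gamma(1/2 - ia) is the conjugate of Gamma(1/2 + ia),
    both factors are then -r up to opposite phases, with r > 0 and r^2 known. The sign of r selects
    the square root in (2 r p)^2 = 1 + e^{2 pi a}, where p = e^{pi a/2}; thus k = 2 r p - p^2, the
    reciprocal of 2 r p + p^2, and this normalizes the Wronskian of W(x) and W(-x) to 1.

    A second obstacle is convergence: on the real axis W_0 and W_3 only oscillate with slow decay,
    so their integrals converge conditionally and are handled through limits of primitives, never
    through absolute bounds. *)

Lemma C_derive_eps (f : C -> C) (z l : C) :
  is_derive (K := C_AbsRing) (V := C_NormedModule) f z l <->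
  (forall eps : R, 0 < eps -> exists delta : R, 0 < delta /\
     forall h : C, Cmod h < delta ->
       Cmod (f (z + h) - f z - h * l)%C <= eps * Cmod h).
Proof.
split.
- intros [_ D] eps He.
  destruct (D z (fun P H => H) (mkposreal eps He)) as [d Hd].
  exists d; split; [apply cond_pos|]. intros h Hh.
  assert (B : ball (M := AbsRing_UniformSpace C_AbsRing) z d (z + h)%C).
  { change (Cmod ((z + h) + - z)%C < d).
    now replace ((z + h) + - z)%C with h by ring. }
  specialize (Hd _ B).
  change (Cmod (f (z + h) + - f z + - (((z + h) + - z) * l))%C
            <= eps * Cmod ((z + h) + - z)%C) in Hd.
  replace ((z + h) + - z)%C with h in Hd by ring. exact Hd.
- intros H. split.
  + apply (is_linear_scal_l (K := C_AbsRing) (V := C_NormedModule)).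
  + intros y Hy.
    assert (E : z = y).
    { exact (is_filter_lim_locally_unique (V := AbsRing_NormedModule C_AbsRing) z y Hy). }
    subst y. intros eps. destruct (H eps (cond_pos eps)) as (d & Hd & K).
    exists (mkposreal d Hd). intros w Hw.
    change (Cmod (w + - z)%C < d) in Hw.
    specialize (K _ Hw).
    change (Cmod (f w + - f z + - ((w + - z) * l))%C <= eps * Cmod (w + - z)%C).
    assert (R1 : forall u v : C, (u + (v + - u))%C = v) by (intros; ring).
    rewrite R1 in K. exact K.
Qed.

Lemma Rabs_fst_le_Cmod (z : C) : Rabs (fst z) <= Cmod z.
Proof. apply Rle_trans with (2 := Rmax_Cmod z), Rmax_l. Qed.

Lemma Rabs_snd_le_Cmod (z : C) : Rabs (snd z) <= Cmod z.
Proof. apply Rle_trans with (2 := Rmax_Cmod z), Rmax_r. Qed.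

Lemma Cmod_le_Rabs (z : C) : Cmod z <= Rabs (fst z) + Rabs (snd z).
Proof.
destruct z as [x y]; simpl.
replace (x, y) with (RtoC x + Ci * RtoC y)%C
  by (apply injective_projections; simpl; ring).
eapply Rle_trans; [apply Cmod_triangle|].
rewrite Cmod_mult, !Cmod_R.
replace (Cmod Ci) with 1; [lra|].
unfold Cmod; simpl. replace (0 * (0 * 1) + 1 * (1 * 1)) with 1 by ring.
now rewrite sqrt_1.
Qed.

Lemma Cexp_add (z w : C) : Cexp (z + w) = (Cexp z * Cexp w)%C.
Proof.
apply injective_projections; simpl; rewrite exp_plus, ?cos_plus, ?sin_plus; ring.
Qed.

Lemma Cmod_Cexp (z : C) : Cmod (Cexp z) = exp (fst z).
Proof.
unfold Cmod, Cexp; simpl.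
replace (_ + _) with (exp (fst z) ^ 2 * ((sin (snd z))² + (cos (snd z))²))
  by (unfold Rsqr; ring).
rewrite sin2_cos2, Rmult_1_r. apply sqrt_pow2, Rlt_le, exp_pos.
Qed.

Lemma Cexp_neq_0 (z : C) : Cexp z <> 0%C.
Proof. apply Cmod_gt_0. rewrite Cmod_Cexp. apply exp_pos. Qed.

Lemma Cexp_0 : Cexp 0 = 1%C.
Proof. apply injective_projections; simpl; rewrite exp_0, ?cos_0, ?sin_0; ring. Qed.

Lemma Cexp_RtoC (x : R) : Cexp (RtoC x) = RtoC (exp x).
Proof. apply injective_projections; simpl; rewrite ?cos_0, ?sin_0; ring. Qed.

Lemma exp_le_compat (x y : R) : x <= y -> exp x <= exp y.
Proof.
intros [H| ->]; [left; now apply exp_increasing | right; reflexivity].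
Qed.

(** Componentwise, to match [CRInt_gen], which integrates real and imaginary parts separately: the
    mean value theorem and the fundamental theorem then apply to each part. *)
Definition is_derive_RC (g : R -> C) (t : R) (l : C) :=
  is_derive (fun s => fst (g s)) t (fst l) /\
  is_derive (fun s => snd (g s)) t (snd l).

Lemma is_derive_RC_eq (g : R -> C) (t : R) (l l' : C) :
  is_derive_RC g t l -> l = l' -> is_derive_RC g t l'.
Proof. now intros H <-. Qed.

Lemma is_derive_RC_ext (f g : R -> C) (t : R) (l : C) :
  (forall s, f s = g s) -> is_derive_RC f t l -> is_derive_RC g t l.
Proof.
intros E [H1 H2]; split; eapply is_derive_ext; eauto; intros s; simpl; now rewrite E.
Qed.

Lemma is_derive_RC_const (c : C) (t : R) : is_derive_RC (fun _ => c) t 0.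
Proof. split; apply (is_derive_const (V := R_NormedModule)). Qed.

Lemma is_derive_RC_plus (f g : R -> C) (t : R) (l m : C) :
  is_derive_RC f t l -> is_derive_RC g t m ->
  is_derive_RC (fun s => f s + g s)%C t (l + m)%C.
Proof.
intros [H1 H2] [H3 H4]; split.
- exact (is_derive_plus _ _ _ _ _ H1 H3).
- exact (is_derive_plus _ _ _ _ _ H2 H4).
Qed.

Lemma is_derive_RC_opp (f : R -> C) (t : R) (l : C) :
  is_derive_RC f t l -> is_derive_RC (fun s => - f s)%C t (- l)%C.
Proof.
intros [H1 H2]; split.
- exact (is_derive_opp _ _ _ H1).
- exact (is_derive_opp _ _ _ H2).
Qed.

Lemma is_derive_RC_minus (f g : R -> C) (t : R) (l m : C) :
  is_derive_RC f t l -> is_derive_RC g t m ->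
  is_derive_RC (fun s => f s - g s)%C t (l - m)%C.
Proof. intros H1 H2; apply is_derive_RC_plus, is_derive_RC_opp; assumption. Qed.

Lemma is_derive_RC_mult (f g : R -> C) (t : R) (l m : C) :
  is_derive_RC f t l -> is_derive_RC g t m ->
  is_derive_RC (fun s => f s * g s)%C t (l * g t + f t * m)%C.
Proof.
intros [H1 H2] [H3 H4].
assert (M : forall u v (x y : R), is_derive u t x -> is_derive v t y ->
   is_derive (fun s => u s * v s) t (x * v t + u t * y)).
{ intros u v x y Hx Hy. apply (is_derive_mult u v t x y Hx Hy Rmult_comm). }
split; simpl.
- eapply (fun H => eq_ind _ (is_derive _ t) H).
  + apply (is_derive_minus (V := R_NormedModule));
      apply M; eassumption.
  + unfold minus, plus, opp; simpl; ring.
- eapply (fun H => eq_ind _ (is_derive _ t) H).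
  + apply (is_derive_plus (V := R_NormedModule));
      apply M; eassumption.
  + unfold plus; simpl; ring.
Qed.

Lemma is_derive_RC_RtoC (f : R -> R) (t l : R) :
  is_derive f t l -> is_derive_RC (fun s => RtoC (f s)) t (RtoC l).
Proof. intros H; split; [exact H | exact (is_derive_const (V := R_NormedModule) 0 t)]. Qed.

Lemma is_derive_RC_id (t : R) : is_derive_RC (fun s => RtoC s) t 1.
Proof. apply (is_derive_RC_RtoC (fun s => s) t 1), (is_derive_id (K := R_AbsRing)). Qed.

Lemma is_derive_RC_inv (f : R -> C) (t : R) (l : C) :
  f t <> 0%C -> is_derive_RC f t l ->
  is_derive_RC (fun s => / f s)%C t (- l / (f t * f t))%C.
Proof.
intros N [H1 H2].
assert (P : fst (f t) ^ 2 + snd (f t) ^ 2 <> 0).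
{ intros E; apply N, injective_projections; simpl; nra. }
destruct l as [l1 l2]; simpl in H1, H2.
set (p := fun s => fst (f s)) in H1; set (q := fun s => snd (f s)) in H2.
change (p t ^ 2 + q t ^ 2 <> 0) in P.
split.
- change (is_derive (fun s => p s / (p s ^ 2 + q s ^ 2)) t
    (fst (- (l1, l2) / ((p t, q t) * (p t, q t)))%C)).
  auto_derive; [repeat split; try (eexists; eassumption); exact P|].
  replace (Derive (fun x => p x) t) with l1 by (symmetry; apply (is_derive_unique _ _ _ H1)).
  replace (Derive (fun x => q x) t) with l2 by (symmetry; apply (is_derive_unique _ _ _ H2)).
  assert (P1 : p t * p t + q t * q t <> 0) by (intros E; apply P; rewrite <- E; ring).
  simpl; field; split; [|exact P1].
  replace (_ + _) with ((p t * p t + q t * q t) * (p t * p t + q t * q t)) by ring.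
  now apply Rmult_integral_contrapositive_currified.
- change (is_derive (fun s => - q s / (p s ^ 2 + q s ^ 2)) t
    (snd (- (l1, l2) / ((p t, q t) * (p t, q t)))%C)).
  auto_derive; [repeat split; try (eexists; eassumption); exact P|].
  replace (Derive (fun x => p x) t) with l1 by (symmetry; apply (is_derive_unique _ _ _ H1)).
  replace (Derive (fun x => q x) t) with l2 by (symmetry; apply (is_derive_unique _ _ _ H2)).
  assert (P1 : p t * p t + q t * q t <> 0) by (intros E; apply P; rewrite <- E; ring).
  simpl; field; split; [|exact P1].
  replace (_ + _) with ((p t * p t + q t * q t) * (p t * p t + q t * q t)) by ring.
  now apply Rmult_integral_contrapositive_currified.
Qed.

Lemma is_derive_RC_Cexp (f : R -> C) (t : R) (l : C) :
  is_derive_RC f t l -> is_derive_RC (fun s => Cexp (f s)) t (l * Cexp (f t))%C.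
Proof.
intros [H1 H2]. destruct l as [l1 l2]; simpl in H1, H2.
set (p := fun s => fst (f s)) in H1; set (q := fun s => snd (f s)) in H2.
split.
- change (is_derive (fun s => exp (p s) * cos (q s)) t
    (fst ((l1, l2) * Cexp (p t, q t))%C)).
  auto_derive; [repeat split; try (eexists; eassumption)|].
  replace (Derive (fun x => p x) t) with l1 by (symmetry; apply (is_derive_unique _ _ _ H1)).
  replace (Derive (fun x => q x) t) with l2 by (symmetry; apply (is_derive_unique _ _ _ H2)).
  simpl; ring.
- change (is_derive (fun s => exp (p s) * sin (q s)) t
    (snd ((l1, l2) * Cexp (p t, q t))%C)).
  auto_derive; [repeat split; try (eexists; eassumption)|].
  replace (Derive (fun x => p x) t) with l1 by (symmetry; apply (is_derive_unique _ _ _ H1)).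
  replace (Derive (fun x => q x) t) with l2 by (symmetry; apply (is_derive_unique _ _ _ H2)).
  simpl; ring.
Qed.

Lemma is_derive_RC_line (f : C -> C) (z h l : C) (t : R) :
  is_derive (K := C_AbsRing) (V := C_NormedModule) f (z + RtoC t * h)%C l ->
  is_derive_RC (fun s => f (z + RtoC s * h)%C) t (h * l)%C.
Proof.
intros H; generalize (proj1 (C_derive_eps f (z + RtoC t * h)%C l) H); clear H; intros H.
assert (K : forall eps : R, 0 < eps -> exists delta : R, 0 < delta /\
  forall s : R, Rabs s < delta ->
    Cmod (f (z + RtoC (t + s) * h) - f (z + RtoC t * h) - RtoC s * (h * l))%C
      <= eps * Rabs s).
{ intros eps He.
  assert (Hp := Cmod_ge_0 h).
  (* The + 1 keeps the quotient meaningful when h = 0. *)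
  destruct (H (eps / (Cmod h + 1))) as (d & Hd & K).
  { apply Rdiv_lt_0_compat; lra. }
  exists (d / (Cmod h + 1)); split; [apply Rdiv_lt_0_compat; lra|].
  intros s Hs.
  assert (Hs' : Rabs s * (Cmod h + 1) < d).
  { apply Rmult_lt_reg_r with (/ (Cmod h + 1)); [apply Rinv_0_lt_compat; lra|].
    replace (Rabs s * (Cmod h + 1) * / (Cmod h + 1)) with (Rabs s) by (field; lra).
    exact Hs. }
  specialize (K (RtoC s * h)%C).
  rewrite Cmod_mult, Cmod_R in K.
  assert (Hs0 := Rabs_pos s).
  replace (z + RtoC (t + s) * h)%C with (z + RtoC t * h + RtoC s * h)%C
    by (rewrite RtoC_plus; ring).
  rewrite Cmult_assoc.
  eapply Rle_trans; [apply K; nra|].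
  replace (eps / (Cmod h + 1) * (Rabs s * Cmod h))
    with (eps * Rabs s * (Cmod h / (Cmod h + 1))) by (field; lra).
  rewrite <- (Rmult_1_r (eps * Rabs s)) at 2.
  apply Rmult_le_compat_l; [nra|].
  apply Rmult_le_reg_r with (Cmod h + 1); [lra|].
  unfold Rdiv; rewrite Rmult_assoc, Rinv_l; lra. }
assert (Q : forall (p : C -> R), (forall u v, p (u - v)%C = p u - p v) ->
   (forall u, Rabs (p u) <= Cmod u) -> (forall (s : R) u, p (RtoC s * u)%C = s * p u) ->
   is_derive (fun s => p (f (z + RtoC s * h)%C)) t (p (h * l)%C)).
{ intros p p1 p2 p3. apply is_derive_Reals. intros eps He.
  destruct (K (eps / 2)) as (d & Hd & K'); [lra|].
  exists (mkposreal d Hd). intros s Hs Hd'. specialize (K' s Hd').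
  assert (Hs0 := Rabs_pos_lt s Hs).
  apply Rmult_lt_reg_r with (Rabs s); [assumption|].
  rewrite <- Rabs_mult.
  replace ((_ - _) * s) with
    (p (f (z + RtoC (t + s) * h) - f (z + RtoC t * h) - RtoC s * (h * l))%C)
    by (rewrite !p1, p3; field; assumption).
  eapply Rle_lt_trans; [apply p2|]. nra. }
split; apply Q.
- intros u v; simpl; ring.
- apply Rabs_fst_le_Cmod.
- intros s u; simpl; ring.
- intros u v; simpl; ring.
- apply Rabs_snd_le_Cmod.
- intros s u; simpl; ring.
Qed.

(** The mean value theorem makes g - f and g + f nondecreasing. Estimates by a majorant with known
    primitive thus need no integral of f'. *)
Lemma is_derive_abs_le (f g f' g' : R -> R) (a b : R) :
  a <= b ->
  (forall t, a <= t <= b -> is_derive f t (f' t)) ->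
  (forall t, a <= t <= b -> is_derive g t (g' t)) ->
  (forall t, a <= t <= b -> Rabs (f' t) <= g' t) ->
  Rabs (f b - f a) <= g b - g a.
Proof.
intros ab Hf Hg Hl.
assert (M : forall s : R, s = 1 \/ s = -1 -> 0 <= (g b - s * f b) - (g a - s * f a)).
{ intros s Hs.
  assert (D : forall x, a <= x <= b ->
     is_derive (fun t => g t - s * f t) x (g' x - s * f' x)).
  { intros x Hx. apply (is_derive_minus (V := R_NormedModule)); [now apply Hg|].
    now apply is_derive_scal, Hf. }
  destruct (MVT_gen (fun t => g t - s * f t) a b (fun t => g' t - s * f' t))
    as (c & Hc & E).
  - intros x Hx. rewrite Rmin_left, Rmax_right in Hx by assumption. apply D; lra.
  - intros x Hx. rewrite Rmin_left, Rmax_right in Hx by assumption.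
    apply continuity_pt_filterlim.
    apply (ex_derive_continuous (V := R_NormedModule) (fun t => g t - s * f t)).
    eexists; now apply D.
  - rewrite Rmin_left, Rmax_right in Hc by assumption. rewrite E.
    apply Rmult_le_pos; [|lra]. specialize (Hl c Hc).
    apply Rabs_le_between in Hl. destruct Hs; subst s; lra. }
generalize (M 1 (or_introl eq_refl)) (M (-1) (or_intror eq_refl)); intros.
apply Rabs_le_between; lra.
Qed.

(** The factor 2 comes from |z| <= |Re z| + |Im z|. It is harmless, since the bound only serves to
    show that something tends to 0. *)
Lemma is_derive_RC_bound (f f' : R -> C) (g g' : R -> R) (a b : R) :
  a <= b ->
  (forall t, a <= t <= b -> is_derive_RC f t (f' t)) ->
  (forall t, a <= t <= b -> is_derive g t (g' t)) ->
  (forall t, a <= t <= b -> Cmod (f' t) <= g' t) ->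
  Cmod (f b - f a)%C <= 2 * (g b - g a).
Proof.
intros ab Hf Hg Hl.
assert (H1 : Rabs (fst (f b) - fst (f a)) <= g b - g a).
{ apply (is_derive_abs_le (fun t => fst (f t)) g (fun t => fst (f' t)) g'); auto.
  - intros t Ht; apply Hf, Ht.
  - intros t Ht. eapply Rle_trans; [apply Rabs_fst_le_Cmod | auto]. }
assert (H2 : Rabs (snd (f b) - snd (f a)) <= g b - g a).
{ apply (is_derive_abs_le (fun t => snd (f t)) g (fun t => snd (f' t)) g'); auto.
  - intros t Ht; apply Hf, Ht.
  - intros t Ht. eapply Rle_trans; [apply Rabs_snd_le_Cmod | auto]. }
eapply Rle_trans; [apply Cmod_le_Rabs|]. simpl. unfold Rminus in *; lra.
Qed.

Lemma is_derive_RC_0_const (f : R -> C) :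
  (forall t, is_derive_RC f t 0) -> forall s t, f s = f t.
Proof.
assert (M : forall f, (forall t, is_derive_RC f t 0) -> forall s t, s <= t -> f s = f t).
{ intros g H s t st.
  assert (B := is_derive_RC_bound g (fun _ => 0%C) (fun _ => 0) (fun _ => 0) s t st).
  assert (E : Cmod (g t - g s)%C <= 0).
  { replace 0 with (2 * (0 - 0)) by ring. apply B; intros.
    - apply H. - apply (is_derive_const (V := R_NormedModule)). - rewrite Cmod_0; lra. }
  assert (E' : (g t - g s)%C = 0%C).
  { apply Cmod_eq_0. generalize (Cmod_ge_0 (g t - g s)%C); lra. }
  replace (g t) with ((g t - g s) + g s)%C by ring. rewrite E'. ring. }
intros H s t. destruct (Rle_dec s t) as [st|st]; [|symmetry]; apply M; auto; lra.
Qed.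

(** * Primitives of entire functions *)

Notation is_C_derive := (is_derive (K := C_AbsRing) (V := C_NormedModule)).

Lemma is_C_derive_continuous (f : C -> C) (z l : C) :
  is_C_derive f z l -> forall eps : R, 0 < eps ->
  exists delta : R, 0 < delta /\
    forall h : C, Cmod h < delta -> Cmod (f (z + h) - f z)%C < eps.
Proof.
intros D eps He.
destruct (proj1 (C_derive_eps f z l) D 1 Rlt_0_1) as (d & Hd & K).
assert (Hl := Cmod_ge_0 l).
exists (Rmin d (eps / (2 + Cmod l))); split.
{ apply Rmin_pos; [assumption | apply Rdiv_lt_0_compat; lra]. }
intros h Hh.
assert (h1 : Cmod h < d) by (eapply Rlt_le_trans; [exact Hh | apply Rmin_l]).
assert (h2 : Cmod h * (2 + Cmod l) < eps).
{ apply Rmult_lt_reg_r with (/ (2 + Cmod l)); [apply Rinv_0_lt_compat; lra|].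
  rewrite Rmult_assoc, Rinv_r, Rmult_1_r by lra.
  eapply Rlt_le_trans; [exact Hh | apply Rmin_r]. }
replace (f (z + h) - f z)%C with ((f (z + h) - f z - h * l) + h * l)%C by ring.
eapply Rle_lt_trans; [apply Cmod_triangle|]. rewrite Cmod_mult.
specialize (K h h1). assert (Hp := Cmod_ge_0 h). nra.
Qed.

Lemma is_derive_RC_fst_continuous (g : R -> C) (t : R) (l : C) :
  is_derive_RC g t l -> continuous (fun s => fst (g s)) t.
Proof.
intros [H _]. apply (ex_derive_continuous (V := R_NormedModule)). exists (fst l); exact H.
Qed.

Lemma is_derive_RC_snd_continuous (g : R -> C) (t : R) (l : C) :
  is_derive_RC g t l -> continuous (fun s => snd (g s)) t.
Proof.
intros [_ H]. apply (ex_derive_continuous (V := R_NormedModule)). exists (snd l); exact H.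
Qed.

(** The second derivative is there to make g' continuous, as the fundamental theorem requires. *)
Lemma is_RInt_derive_RC (g g' g'' : R -> C) (a b : R) :
  (forall t, is_derive_RC g t (g' t)) -> (forall t, is_derive_RC g' t (g'' t)) ->
  is_RInt (fun t => fst (g' t)) a b (fst (g b - g a)%C) /\
  is_RInt (fun t => snd (g' t)) a b (snd (g b - g a)%C).
Proof.
intros H1 H2; split.
- apply (is_RInt_derive (V := R_CompleteNormedModule) (fun t => fst (g t))); intros.
  + apply H1. + eapply is_derive_RC_fst_continuous, H2.
- apply (is_RInt_derive (V := R_CompleteNormedModule) (fun t => snd (g t))); intros.
  + apply H1. + eapply is_derive_RC_snd_continuous, H2.
Qed.

(** Joint continuity is what differentiation under the integral sign asks of the partial derivative
    in [C_primitive]. *)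
Definition continuity_2d_C (k : R -> R -> C) (s t : R) :=
  continuity_2d_pt (fun u v => fst (k u v)) s t /\
  continuity_2d_pt (fun u v => snd (k u v)) s t.

Lemma continuity_2d_C_plus (k l : R -> R -> C) (s t : R) :
  continuity_2d_C k s t -> continuity_2d_C l s t ->
  continuity_2d_C (fun u v => k u v + l u v)%C s t.
Proof.
intros [A1 A2] [B1 B2]; split; simpl.
- exact (continuity_2d_pt_plus _ _ _ _ A1 B1).
- exact (continuity_2d_pt_plus _ _ _ _ A2 B2).
Qed.

Lemma continuity_2d_C_mult (k l : R -> R -> C) (s t : R) :
  continuity_2d_C k s t -> continuity_2d_C l s t ->
  continuity_2d_C (fun u v => k u v * l u v)%C s t.
Proof.
intros [A1 A2] [B1 B2]; split; simpl.
- apply continuity_2d_pt_minus; apply continuity_2d_pt_mult; assumption.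
- apply continuity_2d_pt_plus; apply continuity_2d_pt_mult; assumption.
Qed.

Lemma continuity_2d_C_const (c : C) (s t : R) : continuity_2d_C (fun _ _ => c) s t.
Proof. split; apply continuity_2d_pt_const. Qed.

Lemma continuity_2d_C_fst (s t : R) : continuity_2d_C (fun u _ => RtoC u) s t.
Proof. split; simpl; [apply continuity_2d_pt_id1 | apply continuity_2d_pt_const]. Qed.

Lemma continuity_2d_C_snd (s t : R) : continuity_2d_C (fun _ v => RtoC v) s t.
Proof. split; simpl; [apply continuity_2d_pt_id2 | apply continuity_2d_pt_const]. Qed.

Lemma continuity_2d_C_comp (f : C -> C) (k : R -> R -> C) (s t : R) (l : C) :
  is_C_derive f (k s t) l -> continuity_2d_C k s t ->
  continuity_2d_C (fun u v => f (k u v)) s t.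
Proof.
intros D [A1 A2].
assert (Q : forall eps : R, 0 < eps -> exists delta : R, 0 < delta /\
  forall u v, Rabs (u - s) < delta -> Rabs (v - t) < delta ->
  Cmod (f (k u v) - f (k s t))%C < eps).
{ intros eps He. destruct (is_C_derive_continuous _ _ _ D eps He) as (d & Hd & K).
  assert (Hd2 : 0 < d / 2) by lra.
  destruct (A1 (mkposreal _ Hd2)) as [d1 K1]. destruct (A2 (mkposreal _ Hd2)) as [d2 K2].
  simpl in K1, K2.
  exists (Rmin d1 d2); split; [apply Rmin_pos; apply cond_pos|].
  intros u v Hu Hv.
  replace (k u v) with (k s t + (k u v - k s t))%C by ring.
  apply K. eapply Rle_lt_trans; [apply Cmod_le_Rabs|].
  assert (h1 : Rabs (fst (k u v) - fst (k s t)) < d / 2).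
  { apply K1; eapply Rlt_le_trans; try eassumption; apply Rmin_l. }
  assert (h2 : Rabs (snd (k u v) - snd (k s t)) < d / 2).
  { apply K2; eapply Rlt_le_trans; try eassumption; apply Rmin_r. }
  simpl. unfold Rminus in *. lra. }
split; intros eps; destruct (Q eps (cond_pos eps)) as (d & Hd & K);
  exists (mkposreal d Hd); intros u v Hu Hv.
- eapply Rle_lt_trans; [|exact (K u v Hu Hv)].
  exact (Rabs_fst_le_Cmod (f (k u v) - f (k s t))%C).
- eapply Rle_lt_trans; [|exact (K u v Hu Hv)].
  exact (Rabs_snd_le_Cmod (f (k u v) - f (k s t))%C).
Qed.

Lemma is_derive_RInt_param_R (k k' : R -> R -> R) (a b s : R) :
  (forall u v, is_derive (fun x => k x v) u (k' u v)) ->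
  (forall v, continuity_2d_pt k' s v) ->
  (forall u, ex_RInt (fun v => k u v) a b) ->
  is_derive (fun u => RInt (fun v => k u v) a b) s (RInt (fun v => k' s v) a b).
Proof.
intros D Ck I.
rewrite (RInt_ext (fun v => k' s v) (fun v => Derive (fun u => k u v) s)).
2: { intros v _. symmetry. apply is_derive_unique, D. }
apply is_derive_RInt_param.
- exists (mkposreal _ Rlt_0_1). intros u _ v _. eexists; apply D.
- intros v _. eapply continuity_2d_pt_ext; [|apply (Ck v)].
  intros u w. symmetry. apply is_derive_unique, D.
- exists (mkposreal _ Rlt_0_1). intros u _. apply I.
Qed.

(* The radial integral [P z = int_0^1 z f (t z) dt].  Its derivative in the
   direction [h] is [int_0^1 h d/dt (t f (t z)) dt = h f z]. *)
Lemma C_primitive (f f' f'' : C -> C) :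
  (forall z, is_C_derive f z (f' z)) -> (forall z, is_C_derive f' z (f'' z)) ->
  exists P : C -> C, forall z, is_C_derive P z (f z).
Proof.
intros D1 D2.
set (P := fun z : C => (RInt (fun t => fst (z * f (RtoC t * z))%C) 0 1,
                        RInt (fun t => snd (z * f (RtoC t * z))%C) 0 1)).
exists P.
assert (Dray : forall (F F' : C -> C), (forall z, is_C_derive F z (F' z)) ->
   forall w t, is_derive_RC (fun t => F (RtoC t * w)%C) t (w * F' (RtoC t * w))%C).
{ intros F F' DF w t. apply is_derive_RC_ext with (fun s => F (0 + RtoC s * w)%C).
  - intros s; now rewrite Cplus_0_l.
  - apply is_derive_RC_line. rewrite Cplus_0_l. apply DF. }
assert (Dt : forall w t, is_derive_RC (fun t => RtoC t * f (RtoC t * w))%C t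
   (f (RtoC t * w) + RtoC t * (w * f' (RtoC t * w)))%C).
{ intros w t. eapply is_derive_RC_eq.
  - apply is_derive_RC_mult; [|now apply Dray].
    apply is_derive_RC_id.
  - cbv beta; ring. }
assert (Dt2 : forall w t, exists l, is_derive_RC (fun t =>
   (f (RtoC t * w) + RtoC t * (w * f' (RtoC t * w))))%C t l).
{ intros w t. eexists. apply is_derive_RC_plus; [now apply Dray|].
  apply is_derive_RC_mult.
  { apply is_derive_RC_id. }
  apply is_derive_RC_mult; [apply is_derive_RC_const | now apply (Dray _ f'')]. }
(* The integrand of P along the line s -> z + s h; t is the radial variable. Its s-derivative [k']
   is also the t-derivative of h t f(t w) with w = z + s h, hence integrates to h f(w). *)
set (k := fun (z h : C) (s t : R) =>
   ((z + RtoC s * h) * f (RtoC t * (z + RtoC s * h)))%C).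
set (k' := fun (z h : C) (s t : R) =>
   (h * (f (RtoC t * (z + RtoC s * h)) +
      RtoC t * ((z + RtoC s * h) * f' (RtoC t * (z + RtoC s * h)))))%C).
assert (Dk : forall z h s t, is_derive_RC (fun s => k z h s t) s (k' z h s t)).
{ intros z h s t. unfold k, k'. eapply is_derive_RC_eq.
  - apply is_derive_RC_mult.
    + apply is_derive_RC_plus; [apply is_derive_RC_const|].
      apply is_derive_RC_mult; [|apply is_derive_RC_const].
      apply is_derive_RC_id.
    + apply is_derive_RC_ext with (fun s => f (RtoC t * z + RtoC s * (RtoC t * h))%C).
      { intros u. f_equal. ring. }
      apply is_derive_RC_line. apply D1.
  -     replace (RtoC t * z + RtoC s * (RtoC t * h))%C with (RtoC t * (z + RtoC s * h))%C by ring.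
    ring. }
assert (Ck : forall z h s t, continuity_2d_C (k' z h) s t).
{ intros z h s t. unfold k'.
  assert (C0 : continuity_2d_C (fun u v => z + RtoC u * h)%C s t).
  { apply continuity_2d_C_plus; [apply continuity_2d_C_const|].
    apply continuity_2d_C_mult; [apply continuity_2d_C_fst | apply continuity_2d_C_const]. }
  assert (C1 : continuity_2d_C (fun u v => RtoC v * (z + RtoC u * h))%C s t).
  { apply continuity_2d_C_mult; [apply continuity_2d_C_snd | apply C0]. }
  apply continuity_2d_C_mult; [apply continuity_2d_C_const|].
  apply continuity_2d_C_plus.
  - eapply (continuity_2d_C_comp f (fun u v => RtoC v * (z + RtoC u * h))%C); [apply D1 | exact C1].
  - apply continuity_2d_C_mult; [apply continuity_2d_C_snd|].
    apply continuity_2d_C_mult; [exact C0|].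
    eapply (continuity_2d_C_comp f' (fun u v => RtoC v * (z + RtoC u * h))%C); [apply D2 | exact C1]. }
assert (Ik : forall z h s, ex_RInt (fun t => fst (k z h s t)) 0 1 /\
                         ex_RInt (fun t => snd (k z h s t)) 0 1).
{ intros z h s.
  assert (Q : forall t, is_derive_RC (fun t => k z h s t) t
     ((z + RtoC s * h) * ((z + RtoC s * h) * f' (RtoC t * (z + RtoC s * h))))%C).
  { intros t. eapply is_derive_RC_eq.
    - apply is_derive_RC_mult; [apply is_derive_RC_const | now apply (Dray f f')].
    - cbv beta; ring. }
  split; apply (ex_RInt_continuous (V := R_CompleteNormedModule)); intros t _.
  - eapply is_derive_RC_fst_continuous, Q.
  - eapply is_derive_RC_snd_continuous, Q. }
assert (Ik' : forall z h s, RInt (fun t => fst (k' z h s t)) 0 1 = fst (h * f (z + RtoC s * h))%C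
   /\ RInt (fun t => snd (k' z h s t)) 0 1 = snd (h * f (z + RtoC s * h))%C).
{ intros z h s. set (w := (z + RtoC s * h)%C).
  assert (Q : forall t, is_derive_RC (fun t => h * (RtoC t * f (RtoC t * w)))%C t (k' z h s t)).
  { intros t. eapply is_derive_RC_eq.
    - apply is_derive_RC_mult; [apply is_derive_RC_const | apply Dt].
    - unfold k'. fold w. ring. }
  assert (Q2 : forall t, exists l, is_derive_RC (fun t => k' z h s t) t l).
  { intros t. destruct (Dt2 w t) as [l Hl]. eexists. unfold k'. fold w.
    apply is_derive_RC_mult; [apply is_derive_RC_const | apply Hl]. }
  assert (E : (h * (RtoC 1 * f (RtoC 1 * w)) - h * (RtoC 0 * f (RtoC 0 * w)) = h * f w)%C).
  { replace (RtoC 1 * w)%C with w by ring. ring. }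
  split; apply is_RInt_unique.
  - rewrite <- E. apply (is_RInt_derive (V := R_CompleteNormedModule)
      (fun t => fst (h * (RtoC t * f (RtoC t * w)))%C)); intros t _.
    + apply Q. + destruct (Q2 t) as [l Hl]. exact (is_derive_RC_fst_continuous _ _ _ Hl).
  - rewrite <- E. apply (is_RInt_derive (V := R_CompleteNormedModule)
      (fun t => snd (h * (RtoC t * f (RtoC t * w)))%C)); intros t _.
    + apply Q. + destruct (Q2 t) as [l Hl]. exact (is_derive_RC_snd_continuous _ _ _ Hl). }
assert (DP : forall z h s, is_derive_RC (fun s => P (z + RtoC s * h)%C) s (h * f (z + RtoC s * h))%C).
{ intros z h s. destruct (Ik' z h s) as [E1 E2]. split.
  - rewrite <- E1.
    apply (is_derive_RInt_param_R (fun s t => fst (k z h s t)) (fun s t => fst (k' z h s t))).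
    + intros; apply Dk. + exact (fun v => proj1 (Ck z h s v)). + exact (fun u => proj1 (Ik z h u)).
  - rewrite <- E2.
    apply (is_derive_RInt_param_R (fun s t => snd (k z h s t)) (fun s t => snd (k' z h s t))).
    + intros; apply Dk. + exact (fun v => proj2 (Ck z h s v)). + exact (fun u => proj2 (Ik z h u)). }
intros z. apply C_derive_eps. intros eps He.
(* Derivatives along lines do not yet give complex differentiability. Continuity of f bounds the
   remainder over the segment from z to z + h uniformly in the direction of h; eps / 2 absorbs the
   factor 2 of [is_derive_RC_bound]. *)
destruct (is_C_derive_continuous _ _ _ (D1 z) (eps / 2)) as (d & Hd & K); [lra|].
exists d; split; [assumption|]. intros h Hh.
assert (B := is_derive_RC_bound
  (fun s => P (z + RtoC s * h) - RtoC s * (h * f z))%C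
  (fun s => h * f (z + RtoC s * h) - h * f z)%C
  (fun s => s * (Cmod h * (eps / 2))) (fun _ => Cmod h * (eps / 2)) 0 1).
replace (P (z + h) - P z - h * f z)%C with
  ((P (z + RtoC 1 * h) - RtoC 1 * (h * f z)) - (P (z + RtoC 0 * h) - RtoC 0 * (h * f z)))%C.
2: { assert (E1 : forall w : C, (w + RtoC 1 * h)%C = (w + h)%C) by (intros; ring).
     assert (E0 : forall w : C, (w + RtoC 0 * h)%C = w) by (intros; ring).
     rewrite E1, E0. ring. }
eapply Rle_trans; [apply B|].
- lra.
- intros t _. apply is_derive_RC_minus; [apply DP|]. eapply is_derive_RC_eq.
  + apply is_derive_RC_mult; [|apply is_derive_RC_const].
    apply is_derive_RC_id.
  + cbv beta; ring.
- intros t _. auto_derive; [trivial | ring].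
- intros t Ht.
  replace (h * f (z + RtoC t * h) - h * f z)%C with (h * (f (z + RtoC t * h) - f z))%C by ring.
  rewrite Cmod_mult. apply Rmult_le_compat_l; [apply Cmod_ge_0|].
  apply Rlt_le, K. rewrite Cmod_mult, Cmod_R, Rabs_pos_eq by lra.
  assert (Hp := Cmod_ge_0 h). nra.
- lra.
Qed.

(** * Limits at infinity *)

Definition tends_to (f : R -> C) (l : C) :=
  forall eps : R, 0 < eps -> exists X : R, forall x : R, X < x -> Cmod (f x - l)%C < eps.

(* One-sided: used for upper bounds only. *)
Definition tends_to_0 (r : R -> R) :=
  forall eps : R, 0 < eps -> exists X : R, forall x : R, X < x -> r x < eps.

Lemma tends_to_close (f g : R -> C) (r : R -> R) (l : C) (X : R) :
  tends_to f l -> tends_to_0 r -> (forall x, X < x -> Cmod (g x - f x)%C <= r x) ->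
  tends_to g l.
Proof.
intros Hf Hr Hg eps He.
destruct (Hf (eps / 2)) as [X1 H1]; [lra|]. destruct (Hr (eps / 2)) as [X2 H2]; [lra|].
exists (Rmax X (Rmax X1 X2)). intros x Hx.
assert (X < x) by (eapply Rle_lt_trans; [apply Rmax_l | exact Hx]).
assert (Rmax X1 X2 < x) by (eapply Rle_lt_trans; [apply Rmax_r | exact Hx]).
assert (X1 < x) by (eapply Rle_lt_trans; [apply Rmax_l | eassumption]).
assert (X2 < x) by (eapply Rle_lt_trans; [apply Rmax_r | eassumption]).
replace (g x - l)%C with ((g x - f x) + (f x - l))%C by ring.
eapply Rle_lt_trans; [apply Cmod_triangle|].
specialize (H1 x); specialize (H2 x); specialize (Hg x). lra.
Qed.

Lemma tends_to_0_0 : tends_to_0 (fun _ => 0).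
Proof. intros eps He. now exists 0. Qed.

Lemma tends_to_ext (f g : R -> C) (l : C) (X : R) :
  tends_to f l -> (forall x, X < x -> g x = f x) -> tends_to g l.
Proof.
intros H E. apply tends_to_close with (1 := H) (2 := tends_to_0_0) (X := X).
intros x Hx. rewrite (E x Hx). replace (f x - f x)%C with (RtoC 0) by ring.
rewrite Cmod_0; lra.
Qed.

Lemma tends_to_unique (f : R -> C) (l m : C) : tends_to f l -> tends_to f m -> l = m.
Proof.
intros Hl Hm. destruct (Ceq_dec l m) as [E|N]; [assumption|exfalso].
assert (P : 0 < Cmod (l - m)%C).
{ apply Cmod_gt_0. intros E. apply N. replace l with ((l - m) + m)%C by ring.
  rewrite E. ring. }
destruct (Hl (Cmod (l - m)%C / 2)) as [X1 H1]; [lra|].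
destruct (Hm (Cmod (l - m)%C / 2)) as [X2 H2]; [lra|].
set (x := Rmax X1 X2 + 1).
assert (B1 := Rmax_l X1 X2). assert (B2 := Rmax_r X1 X2).
specialize (H1 x ltac:(unfold x; lra)). specialize (H2 x ltac:(unfold x; lra)).
assert (T := Cmod_triangle (f x - m)%C (- (f x - l))%C).
rewrite Cmod_opp in T.
replace (f x - m + - (f x - l))%C with (l - m)%C in T by ring. lra.
Qed.

Lemma tends_to_const (c : C) : tends_to (fun _ => c) c.
Proof.
intros eps He. exists 0. intros x _. replace (c - c)%C with (RtoC 0) by ring.
now rewrite Cmod_0.
Qed.

Lemma tends_to_plus (f g : R -> C) (l m : C) :
  tends_to f l -> tends_to g m -> tends_to (fun x => f x + g x)%C (l + m)%C.
Proof.
intros Hf Hg eps He.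
destruct (Hf (eps / 2)) as [X1 H1]; [lra|]. destruct (Hg (eps / 2)) as [X2 H2]; [lra|].
exists (Rmax X1 X2). intros x Hx.
assert (B1 := Rmax_l X1 X2). assert (B2 := Rmax_r X1 X2).
replace (f x + g x - (l + m))%C with ((f x - l) + (g x - m))%C by ring.
eapply Rle_lt_trans; [apply Cmod_triangle|].
specialize (H1 x); specialize (H2 x). lra.
Qed.

Lemma tends_to_mult (f g : R -> C) (l m : C) :
  tends_to f l -> tends_to g m -> tends_to (fun x => f x * g x)%C (l * m)%C.
Proof.
intros Hf Hg eps He.
assert (Pl := Cmod_ge_0 l). assert (Pm := Cmod_ge_0 m).
set (D := 2 + Cmod l + Cmod m).
assert (HD : 0 < eps / D).
{ apply Rdiv_lt_0_compat; unfold D; lra. }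
assert (HD' : 0 < Rmin 1 (eps / D)) by (apply Rmin_pos; lra).
destruct (Hf _ HD') as [X1 H1]. destruct (Hg _ HD') as [X2 H2].
exists (Rmax X1 X2). intros x Hx.
assert (B1 := Rmax_l X1 X2). assert (B2 := Rmax_r X1 X2).
specialize (H1 x ltac:(lra)). specialize (H2 x ltac:(lra)).
assert (C1 := Rmin_l 1 (eps / D)). assert (C2 := Rmin_r 1 (eps / D)).
replace (f x * g x - l * m)%C with ((f x - l) * (g x - m) + l * (g x - m) + (f x - l) * m)%C by ring.
eapply Rle_lt_trans; [apply Cmod_triangle|].
eapply Rle_lt_trans; [apply Rplus_le_compat_r, Cmod_triangle|].
rewrite !Cmod_mult.
assert (E : eps = eps / D * D) by (field; unfold D; lra).
assert (P1 := Cmod_ge_0 (f x - l)%C). assert (P2 := Cmod_ge_0 (g x - m)%C).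
rewrite E. unfold D at 2. nra.
Qed.

(** No absolute convergence is required, which is essential for the integrals of W over the real
    axis. *)
Lemma tends_to_RInt_gen (F F' F'' : R -> C) (L : C) (x : R) :
  (forall t, is_derive_RC F t (F' t)) -> (forall t, is_derive_RC F' t (F'' t)) ->
  tends_to F L ->
  CRInt_gen F' (at_point x) (Rbar_locally p_infty) = (L - F x)%C.
Proof.
intros D1 D2 H. unfold CRInt_gen.
assert (Q : forall p : C -> R, (forall u v, p (u - v)%C = p u - p v) ->
   (forall u, Rabs (p u) <= Cmod u) ->
   (forall b, is_RInt (fun t => p (F' t)) x b (p (F b - F x)%C)) ->
   RInt_gen (fun t => p (F' t)) (at_point x) (Rbar_locally p_infty) = p (L - F x)%C).
{ intros p p1 p2 p3. apply is_RInt_gen_unique.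
  intros P [d Hd].
  destruct (H d (cond_pos d)) as [X HX].
  exists (fun y => y = x) (fun y => X < y); [reflexivity | now exists X |].
  intros u y -> Hy. simpl. eexists; split; [apply p3|].
  apply Hd. apply Rle_lt_trans with (2 := HX y Hy).
  change (Rabs (p (F y - F x)%C - p (L - F x)%C) <= Cmod (F y - L)%C).
  rewrite <- p1. replace (F y - F x - (L - F x))%C with (F y - L)%C by ring. apply p2. }
assert (I := fun b => is_RInt_derive_RC F F' F'' x b D1 D2).
apply injective_projections; simpl.
- apply (Q fst); [intros; simpl; ring | apply Rabs_fst_le_Cmod | intros b; apply I].
- apply (Q snd); [intros; simpl; ring | apply Rabs_snd_le_Cmod | intros b; apply I].
Qed.

Lemma CInt_from_inf_primitive (alpha : R) (P f f' : C -> C) (z L : C) :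
  (forall w, is_C_derive P w (f w)) -> (forall w, is_C_derive f w (f' w)) ->
  tends_to (fun s => P (z + RtoC s * Cexp (0, alpha))%C) L ->
  CInt_from_inf alpha f z = (P z - L)%C.
Proof.
intros D1 D2 H. unfold CInt_from_inf. set (w := Cexp (0, alpha)) in *.
assert (D3 : forall s, is_derive_RC (fun s => P (z + RtoC s * w)%C) s (f (z + RtoC s * w) * w)%C).
{ intros s. eapply is_derive_RC_eq; [apply is_derive_RC_line, D1 | ring]. }
assert (D4 : forall s, is_derive_RC (fun s => f (z + RtoC s * w) * w)%C s
   (w * f' (z + RtoC s * w) * w)%C).
{ intros s. eapply is_derive_RC_eq.
  - apply is_derive_RC_mult; [apply is_derive_RC_line, D2 | apply is_derive_RC_const].
  - cbv beta; ring. }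
rewrite (tends_to_RInt_gen _ _ _ L 0 D3 D4 H).
replace (z + RtoC 0 * w)%C with z by ring. ring.
Qed.

Lemma tends_to_cauchy (f : R -> C) :
  (forall eps : R, 0 < eps -> exists X : R, forall x y : R, X < x -> x <= y ->
     Cmod (f y - f x)%C < eps) -> exists l, tends_to f l.
Proof.
intros H.
assert (Q : forall p : C -> R, (forall u v, p (u - v)%C = p u - p v) ->
   (forall u, Rabs (p u) <= Cmod u) ->
   exists l : R, filterlim (fun x => p (f x)) (Rbar_locally p_infty) (locally l)).
{ intros p p1 p2.
  apply (filterlim_locally_cauchy (U := R_CompleteSpace)).
  intros eps. destruct (H eps (cond_pos eps)) as [X HX].
  exists (fun x => X < x); split; [now exists X|].
  assert (W : forall u v, X < u -> u <= v -> Rabs (p (f v) - p (f u)) < eps).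
  { intros u v Hu Huv. rewrite <- p1. eapply Rle_lt_trans; [apply p2 | now apply HX]. }
  intros u v Hu Hv. change (Rabs (p (f v) - p (f u)) < eps).
  destruct (Rle_dec u v) as [uv|uv]; [now apply W|].
  rewrite Rabs_minus_sym. apply W; lra. }
destruct (Q fst) as [l1 H1]; [intros; simpl; ring | apply Rabs_fst_le_Cmod |].
destruct (Q snd) as [l2 H2]; [intros; simpl; ring | apply Rabs_snd_le_Cmod |].
exists (l1, l2). intros eps He.
assert (He2 : 0 < eps / 2) by lra.
destruct (H1 _ (locally_ball l1 (mkposreal _ He2))) as [X1 K1].
destruct (H2 _ (locally_ball l2 (mkposreal _ He2))) as [X2 K2].
exists (Rmax X1 X2). intros x Hx.
assert (B1 := Rmax_l X1 X2). assert (B2 := Rmax_r X1 X2).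
specialize (K1 x ltac:(lra)). specialize (K2 x ltac:(lra)).
change (Rabs (fst (f x) - l1) < eps / 2) in K1.
change (Rabs (snd (f x) - l2) < eps / 2) in K2.
eapply Rle_lt_trans; [apply Cmod_le_Rabs|]. simpl. unfold Rminus in *; lra.
Qed.

(** * Decay of U and primitives of U *)

Lemma Carg_re_nonneg (z : C) : 0 <= fst z -> Rabs (Carg z) <= PI / 2.
Proof.
intros H. assert (PP := PI_RGT_0). unfold Carg.
destruct (Rlt_dec 0 (fst z)).
{ assert (B := atan_bound (snd z / fst z)). apply Rabs_le_between; lra. }
destruct (Rlt_dec (fst z) 0); [lra|].
destruct (Rlt_dec 0 (snd z)); [apply Rabs_le_between; lra|].
destruct (Rlt_dec (snd z) 0); apply Rabs_le_between; lra.
Qed.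

(** With delta = pi/4 the sector covers the right half-plane, and eps = 1 makes |U| at most twice
    its leading term. For |z| >= 1 the power has modulus |z|^{-1/2} e^{a arg z} <= e^{|a| pi}. *)
Lemma PCF_U_bound (U : C -> C -> C) (a : R) : is_PCF_U U ->
  exists K X : R, 0 < K /\ 0 < X /\ forall z : C, 0 < fst z -> X < Cmod z ->
    Cmod (U (Ci * RtoC a)%C z) <= K * exp (- (fst z ^ 2 - snd z ^ 2) / 4).
Proof.
intros HU. destruct (HU (Ci * RtoC a)%C) as [_ A].
assert (PP := PI_RGT_0).
destruct (A (PI / 4) ltac:(lra) 1 Rlt_0_1) as [M HM].
exists (2 * exp (Rabs a * PI)), (Rmax 1 M).
assert (B1 := Rmax_l 1 M). assert (B2 := Rmax_r 1 M).
split; [generalize (exp_pos (Rabs a * PI)); lra|]. split; [lra|].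
intros z Hz Hm.
assert (Hc := Carg_re_nonneg z ltac:(lra)).
specialize (HM z ltac:(lra) ltac:(lra)).
set (D := (Cpow z (- (Ci * RtoC a) - / 2) * Cexp (- (z * z) / 4))%C) in HM.
set (u := U (Ci * RtoC a)%C z) in *.
assert (ND : D <> 0%C).
{ unfold D, Cpow. rewrite <- Cexp_add. apply Cexp_neq_0. }
replace u with ((u / D - 1 + 1) * D)%C by (field; exact ND).
rewrite Cmod_mult.
assert (T := Cmod_triangle (u / D - 1)%C 1). rewrite Cmod_1 in T.
assert (BD : Cmod D <= exp (Rabs a * PI) * exp (- (fst z ^ 2 - snd z ^ 2) / 4)).
{ unfold D, Cpow. rewrite Cmod_mult, !Cmod_Cexp.
  apply Rmult_le_compat; try (apply Rlt_le, exp_pos).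
  - apply exp_le_compat. unfold Clog. simpl.
    assert (L : 0 <= ln (Cmod z)) by (rewrite <- ln_1; apply ln_le; lra).
    assert (W : a * Carg z <= Rabs a * PI).
    { eapply Rle_trans; [apply Rle_abs|]. rewrite Rabs_mult.
      apply Rmult_le_compat_l; [apply Rabs_pos | lra]. }
    field_simplify; nra.
  - right. f_equal. simpl. field. }
assert (P1 := Cmod_ge_0 D). assert (P2 := Cmod_ge_0 (u / D - 1 + 1)%C).
rewrite Rmult_assoc.
apply Rmult_le_compat; lra.
Qed.

Lemma tends_to_0_exp (c k : R) : 0 < c -> tends_to_0 (fun s => c * exp (k - s)).
Proof.
intros Hc eps He. exists (k - ln (eps / c)). intros s Hs.
assert (P : 0 < eps / c) by now apply Rdiv_lt_0_compat.
apply Rlt_le_trans with (c * exp (ln (eps / c))).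
- apply Rmult_lt_compat_l; [assumption|]. apply exp_increasing; lra.
- rewrite exp_ln by assumption. right; field; lra.
Qed.

Lemma tends_to_0_inv (c : R) : 0 < c -> tends_to_0 (fun s => c / s).
Proof.
intros Hc eps He. exists (c / eps). intros s Hs.
assert (P : 0 < c / eps) by now apply Rdiv_lt_0_compat.
apply Rmult_lt_reg_r with s; [lra|].
apply Rmult_lt_compat_r with (r := eps) in Hs; [|assumption].
replace (c / eps * eps) with c in Hs by (field; lra).
replace (c / s * s) with c; [lra | field].
intros E; subst s; lra.
Qed.

(** The horizontal rays are the directions of decay. The diagonals y + iy and y - iy, where
    e^{-z^2/4} has modulus 1, are the images of the real axis under the rotations in W_0 and W_3.
    Both limits agree because the vertical segment joining y to the diagonal contributes O(1/y). *)
Lemma PCF_U_primitive (U : C -> C -> C) (a : R) : is_PCF_U U ->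
  exists (P : C -> C) (L : C),
    (forall z, is_C_derive P z (U (Ci * RtoC a)%C z)) /\
    (forall z, tends_to (fun s => P (z + RtoC s)%C) L) /\
    (forall sigma : R, sigma = 1 \/ sigma = -1 -> tends_to (fun y => P (y, sigma * y)) L).
Proof.
intros HU. destruct (PCF_U_bound U a HU) as (K & X & HK & HX & B).
destruct (HU (Ci * RtoC a)%C) as [(U1 & D) _].
destruct (C_primitive _ _ _ (fun z => proj1 (D z)) (fun z => proj2 (D z))) as [P DP].
set (u := U (Ci * RtoC a)%C) in *.
assert (Dl : forall z h t, is_derive_RC (fun s => P (z + RtoC s * h)%C) t (h * u (z + RtoC t * h))%C).
{ intros. apply is_derive_RC_line, DP. }
assert (Cge : forall z : C, fst z <= Cmod z).
{ intros z. eapply Rle_trans; [apply Rle_abs | apply Rabs_fst_le_Cmod]. }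
assert (HL : exists L, tends_to (fun s => P (RtoC s)) L).
{ apply tends_to_cauchy. intros eps He.
  (* From (t/2 - 1)^2 >= 0 follows e^{-t^2/4} <= e^{1-t}, a majorant with explicit primitive. *)
  destruct (tends_to_0_exp (2 * K) 1 ltac:(lra) eps He) as [Y HY].
  exists (Rmax X Y). intros x y Hx Hxy.
  assert (B1 := Rmax_l X Y). assert (B2 := Rmax_r X Y).
  eapply Rle_lt_trans; [|apply (HY x); lra].
  assert (Ex : forall s, (0 + RtoC s * 1)%C = RtoC s) by (intros; ring).
  assert (W := is_derive_RC_bound (fun s => P (0 + RtoC s * 1)%C)
    (fun s => 1 * u (0 + RtoC s * 1))%C (fun s => - (K * exp (1 - s)))
    (fun s => K * exp (1 - s)) x y Hxy).
  cbv beta in W. rewrite !Ex in W.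
  apply Rle_trans with (2 * (- (K * exp (1 - y)) - - (K * exp (1 - x)))).
  - apply W.
    + intros t _; apply Dl.
    + intros t _; auto_derive; [trivial | unfold Rminus; ring].
    + intros t Ht. rewrite Cmult_1_l, Ex.
      assert (Hm := Cge (RtoC t)). simpl in Hm.
      eapply Rle_trans; [apply B; simpl; lra|]. simpl.
      apply Rmult_le_compat_l; [lra|]. apply exp_le_compat.
      assert (0 <= (t / 2 - 1) ^ 2) by apply pow2_ge_0. nra.
  - assert (E := exp_pos (1 - y)). nra. }
destruct HL as [L HL]. exists P, L. split; [exact DP|]. split.
- intros z. destruct z as [p q].
  (* On the segment from s to s + p + iq the exponent is at most 1 - (s + t p) + (t q)^2/4 with 0 <=
     t <= 1, hence at most k - s. *)
  set (k := 1 + Rabs p + q ^ 2 / 4). set (c := Cmod (p, q)).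
  assert (Hc : 0 <= c) by apply Cmod_ge_0.
  apply tends_to_close with (1 := HL) (r := fun s => (2 * K * (c + 1)) * exp (k - s))
    (X := X + Rabs p).
  + apply tends_to_0_exp. nra.
  + intros s Hs.
    assert (W := is_derive_RC_bound (fun t => P (RtoC s + RtoC t * (p, q))%C)
      (fun t => (p, q) * u (RtoC s + RtoC t * (p, q)))%C
      (fun t => t * (c * (K * exp (k - s)))) (fun t => c * (K * exp (k - s))) 0 1 ltac:(lra)).
    cbv beta in W.
    replace (RtoC s + RtoC 1 * (p, q))%C with ((p, q) + RtoC s)%C in W by ring.
    replace (RtoC s + RtoC 0 * (p, q))%C with (RtoC s) in W by ring.
    assert (E := exp_pos (k - s)).
    eapply Rle_trans; [apply W|].
    * intros t _; apply Dl.
    * intros t _; auto_derive; [trivial | ring].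
    * intros t Ht. rewrite Cmod_mult. fold c. apply Rmult_le_compat_l; [assumption|].
      set (z := (RtoC s + RtoC t * (p, q))%C).
      assert (F1 : fst z = s + t * p) by (unfold z; simpl; ring).
      assert (F2 : snd z = t * q) by (unfold z; simpl; ring).
      assert (T : - Rabs p <= t * p).
      { assert (H := Rle_abs p). assert (H' := Rle_abs (- p)). rewrite Rabs_Ropp in H'.
        assert (0 <= Rabs p) by apply Rabs_pos. nra. }
      assert (Hm := Cge z). rewrite F1 in Hm.
      eapply Rle_trans; [apply B; lra|]. rewrite F1, F2.
      apply Rmult_le_compat_l; [lra|]. apply exp_le_compat. unfold k.
      assert (0 <= ((s + t * p) / 2 - 1) ^ 2) by apply pow2_ge_0.
      assert (0 <= q ^ 2) by apply pow2_ge_0.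
      assert (t * t <= 1) by nra.
      assert ((t * q) ^ 2 <= q ^ 2) by (replace ((t * q) ^ 2) with ((t * t) * q ^ 2) by ring; nra).
      lra.
    * assert (0 <= K * exp (k - s)) by nra. nra.
- intros sigma Hs.
  apply tends_to_close with (1 := HL) (r := fun y => (8 * K) / y) (X := X).
  + apply tends_to_0_inv. lra.
  + intros y Hy.
    (* Since y^2 - t^2 >= y (y - t) for 0 <= t <= y, U is at most K e^{-y(y-t)/4} on the vertical
       segment. The primitive of this bound stays below 4K/y. *)
    assert (W := is_derive_RC_bound (fun t => P (RtoC y + RtoC t * (0, sigma))%C)
      (fun t => (0, sigma) * u (RtoC y + RtoC t * (0, sigma)))%C
      (fun t => K * (4 / y) * exp (- (y * (y - t) / 4)))
      (fun t => K * exp (- (y * (y - t) / 4))) 0 y ltac:(lra)).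
    cbv beta in W.
    replace (RtoC y + RtoC y * (0, sigma))%C with (y, sigma * y) in W
      by (apply injective_projections; simpl; ring).
    replace (RtoC y + RtoC 0 * (0, sigma))%C with (RtoC y) in W by ring.
    eapply Rle_trans; [apply W|].
    * intros t _; apply Dl.
    * intros t _; auto_derive; [trivial | unfold Rminus, Rdiv; field; lra].
    * intros t Ht. rewrite Cmod_mult.
      replace (Cmod (0, sigma)) with 1.
      2: { unfold Cmod; simpl. destruct Hs; subst sigma;
           replace (0 * (0 * 1) + _) with 1 by ring; now rewrite sqrt_1. }
      rewrite Rmult_1_l.
      set (z := (RtoC y + RtoC t * (0, sigma))%C).
      assert (F1 : fst z = y) by (unfold z; simpl; ring).
      assert (F2 : snd z = t * sigma) by (unfold z; simpl; ring).
      assert (Hm := Cge z). rewrite F1 in Hm.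
      eapply Rle_trans; [apply B; lra|]. rewrite F1, F2.
      apply Rmult_le_compat_l; [lra|]. apply exp_le_compat.
      assert ((t * sigma) ^ 2 = t * t) by (destruct Hs; subst sigma; ring). nra.
    * replace (y * (y - y) / 4) with 0 by (field; lra).
      rewrite Ropp_0, exp_0.
      assert (E := exp_pos (- (y * (y - 0) / 4))).
      assert (0 < 4 / y) by (apply Rdiv_lt_0_compat; lra).
      assert (0 < K * (4 / y)) by now apply Rmult_lt_0_compat.
      replace (8 * K / y) with (2 * (K * (4 / y))) by (field; lra). nra.
Qed.

(* [x^{-b-1/2} e^{-x^2/4}] with [b = ia]: the leading behaviour of [U(ia, x)]. *)
Definition recessive (a x : R) : C :=
  Cexp ((- (Ci * RtoC a) - / 2) * RtoC (ln x) - RtoC (x * x / 4))%C.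

Definition wronskian (f f' g g' : R -> C) (x : R) : C := (f x * g' x - f' x * g x)%C.

Lemma wronskian_const (q f f' g g' : R -> C) :
  (forall x, is_derive_RC f x (f' x)) -> (forall x, is_derive_RC f' x (q x * f x)%C) ->
  (forall x, is_derive_RC g x (g' x)) -> (forall x, is_derive_RC g' x (q x * g x)%C) ->
  forall x y, wronskian f f' g g' x = wronskian f f' g g' y.
Proof.
intros F F' G G'. apply is_derive_RC_0_const. intros t. eapply is_derive_RC_eq.
- apply is_derive_RC_minus; apply is_derive_RC_mult; [apply F | apply G' | apply F' | apply G].
- cbv beta; ring.
Qed.

(** * Wronskians from asymptotics *)

Lemma recessive_neq_0 (a x : R) : recessive a x <> 0%C.
Proof. apply Cexp_neq_0. Qed.

Lemma tends_to_inv_1 (f : R -> C) : tends_to f 1 -> tends_to (fun x => / f x)%C 1.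
Proof.
intros H eps He.
destruct (H (Rmin (1 / 2) (eps / 2))) as [X HX].
{ apply Rmin_pos; lra. }
exists X. intros x Hx. specialize (HX x Hx).
assert (B1 := Rmin_l (1 / 2) (eps / 2)). assert (B2 := Rmin_r (1 / 2) (eps / 2)).
assert (T := Cmod_triangle (f x) (- (f x - 1))%C). rewrite Cmod_opp in T.
replace (f x + - (f x - 1))%C with (RtoC 1) in T by ring. rewrite Cmod_1 in T.
assert (N : f x <> 0%C) by (apply Cmod_gt_0; lra).
replace (/ f x - 1)%C with (- (f x - 1) / f x)%C by (field; exact N).
rewrite Cmod_div, Cmod_opp by exact N.
apply Rmult_lt_reg_r with (Cmod (f x)); [lra|].
unfold Rdiv; rewrite Rmult_assoc, Rinv_l by lra. nra.
Qed.

(* With [m = u / E] (where [E = recessive a]), the quotient rule gives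
   [(v / u)' = w / u^2 = w x Phi / m^2] for the Wronskian [w] and
   [Phi = 1 / (x E^2) = x^{2ia} e^{x^2/2}], while [Phi' = (x + 2ia/x) Phi].
   Integrating the difference shows [v / u - w Phi = o(Phi)], with no
   information on the derivatives of [u] and [v]. *)
Lemma wronskian_limit (a : R) (q u u' v v' : R -> C) :
  (forall x, is_derive_RC u x (u' x)) -> (forall x, is_derive_RC u' x (q x * u x)%C) ->
  (forall x, is_derive_RC v x (v' x)) -> (forall x, is_derive_RC v' x (q x * v x)%C) ->
  tends_to (fun x => u x / recessive a x)%C 1 ->
  tends_to (fun x => v x * (RtoC x * recessive a x))%C (wronskian u u' v v' 0).
Proof.
intros Du Du' Dv Dv' Hm.
set (w := wronskian u u' v v' 0).
assert (Hw : forall x, wronskian u u' v v' x = w).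
{ intros x. now apply (wronskian_const q). }
set (E := recessive a) in *.
set (m := fun x => (u x / E x)%C) in *.
set (Phi := fun x => Cexp (2 * (Ci * RtoC a) * RtoC (ln x) + RtoC (x * x / 2))%C).
assert (NE : forall x, E x <> 0%C) by (intros; apply recessive_neq_0).
assert (NPhi : forall x, Phi x <> 0%C) by (intros; apply Cexp_neq_0).
assert (MPhi : forall x, Cmod (Phi x) = exp (x * x / 2)).
{ intros x. unfold Phi. rewrite Cmod_Cexp. f_equal. simpl. ring. }
assert (PE : forall x, 0 < x -> (Phi x * (RtoC x * (E x * E x)))%C = 1%C).
{ intros x Hx. replace (RtoC x) with (Cexp (RtoC (ln x))) by (now rewrite Cexp_RtoC, exp_ln).
  unfold Phi, E, recessive.
  rewrite <- !Cexp_add. transitivity (Cexp 0); [f_equal | apply Cexp_0].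
  apply injective_projections; simpl; field. }
destruct (Hm (1 / 2)) as [X0 HX0]; [lra|].
assert (Nm : forall x, X0 < x -> m x <> 0%C).
{ intros x Hx Em. specialize (HX0 x Hx). rewrite Em in HX0.
  replace (0 - 1)%C with (- (1))%C in HX0 by ring. rewrite Cmod_opp, Cmod_1 in HX0. lra. }
assert (Nu : forall x, X0 < x -> u x <> 0%C).
{ intros x Hx Eu. apply (Nm x Hx). unfold m. rewrite Eu. field. apply NE. }
(* The relative error: F' = w x Phi r, where r tends to 0 because m tends to 1. *)
set (r := fun x => (/ m x * / m x + - (1) + - (2 * (Ci * RtoC a)) * RtoC (/ (x * x)))%C).
set (F := fun x => (v x / u x - w * Phi x)%C).
assert (Hr : tends_to r 0).
{ replace (RtoC 0) with (1 * 1 + - (1) + - (2 * (Ci * RtoC a)) * 0)%C by ring.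
  unfold r. apply tends_to_plus; [apply tends_to_plus|apply tends_to_mult].
  - apply tends_to_mult; now apply tends_to_inv_1.
  - apply tends_to_const.
  - apply tends_to_const.
  - intros eps He. exists (Rmax 1 (/ eps)). intros x Hx.
    assert (B1 := Rmax_l 1 (/ eps)). assert (B2 := Rmax_r 1 (/ eps)).
    replace (RtoC (/ (x * x)) - 0)%C with (RtoC (/ (x * x))) by ring.
    rewrite Cmod_R, Rabs_pos_eq by (apply Rlt_le, Rinv_0_lt_compat; nra).
    apply Rmult_lt_reg_r with (x * x); [nra|]. rewrite Rinv_l by nra.
    assert (1 < eps * x).
    { apply Rmult_lt_reg_l with (/ eps); [now apply Rinv_0_lt_compat|].
      rewrite <- Rmult_assoc, Rinv_l by lra. lra. }
    nra. }
assert (DF : forall x, X0 < x -> 0 < x -> is_derive_RC F x (w * RtoC x * Phi x * r x)%C).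
{ intros x Hx Hx0. unfold F. eapply is_derive_RC_eq.
  - apply is_derive_RC_minus.
    + apply is_derive_RC_mult; [apply Dv | apply is_derive_RC_inv; [now apply Nu | apply Du]].
    + apply is_derive_RC_mult; [apply is_derive_RC_const | apply is_derive_RC_Cexp].
      apply is_derive_RC_plus.
      * apply is_derive_RC_mult; [apply is_derive_RC_const | apply is_derive_RC_RtoC].
        apply is_derive_Reals, derivable_pt_lim_ln, Hx0.
      * apply (is_derive_RC_RtoC (fun x => x * x / 2) x x). auto_derive; [trivial | field].
  - cbv beta.
    change (Cexp (2 * (Ci * RtoC a) * RtoC (ln x) + RtoC (x * x / 2)))%C with (Phi x).
    assert (Nx : RtoC x <> 0%C) by (intros Ex; apply RtoC_inj in Ex; lra).
    transitivity (wronskian u u' v v' x / (u x * u x) -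
       w * (2 * (Ci * RtoC a) * RtoC (/ x) + RtoC x) * Phi x)%C.
    { unfold wronskian. field. now apply Nu. }
    rewrite (Hw x). unfold r.
    replace (u x) with (m x * E x)%C by (unfold m; field; apply NE).
    assert (PE' : (RtoC x * Phi x = / (E x * E x))%C).
    { replace (RtoC x * Phi x)%C with ((Phi x * (RtoC x * (E x * E x))) / (E x * E x))%C
        by (field; apply NE).
      rewrite PE by assumption. field; apply NE. }
    replace (w / (m x * E x * (m x * E x)))%C with (w * (RtoC x * Phi x) * (/ m x * / m x))%C
      by (rewrite PE'; field; split; [apply NE | now apply Nm]).
    rewrite !RtoC_inv, RtoC_mult by nra. field. split; [exact Nx | now apply Nm]. }
(* L'Hospital in disguise: |Phi| = e^{x^2/2} has derivative x |Phi|, so |F'| is at most a small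
   multiple of that derivative beyond X2. Integrating leaves the constant F(X2), which Phi
   swamps. *)
assert (HF : tends_to (fun x => F x / Phi x)%C 0).
{ intros eps He.
  set (M := Cmod w + 1). assert (HM : 0 < M) by (generalize (Cmod_ge_0 w); unfold M; lra).
  assert (He1 : 0 < eps / (4 * M)) by (apply Rdiv_lt_0_compat; lra).
  destruct (Hr _ He1) as [X1 HX1].
  set (X2 := Rmax 1 (Rmax X0 X1) + 1).
  assert (B1 := Rmax_l 1 (Rmax X0 X1)). assert (B2 := Rmax_r 1 (Rmax X0 X1)).
  assert (B3 := Rmax_l X0 X1). assert (B4 := Rmax_r X0 X1).
  assert (HX2 : 1 < X2 /\ X0 < X2 /\ X1 < X2) by (unfold X2; lra).
  clearbody X2. destruct HX2 as (G1 & G2 & G3).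
  assert (HC : 0 < Cmod (F X2) + 1) by (generalize (Cmod_ge_0 (F X2)); lra).
  assert (He2 : 0 < eps / 2) by lra.
  destruct (tends_to_0_exp _ 1 HC _ He2) as [X3 HX3].
  exists (Rmax X2 X3). intros x Hx.
  assert (B5 := Rmax_l X2 X3). assert (B6 := Rmax_r X2 X3).
  replace (F x / Phi x - 0)%C with ((F x - F X2) / Phi x + F X2 / Phi x)%C
    by (field; apply NPhi).
  eapply Rle_lt_trans; [apply Cmod_triangle|].
  rewrite !Cmod_div, MPhi by apply NPhi.
  assert (EP := exp_pos (x * x / 2)).
  assert (W := is_derive_RC_bound F (fun t => w * RtoC t * Phi t * r t)%C
     (fun t => eps / 4 * exp (t * t / 2)) (fun t => eps / 4 * (t * exp (t * t / 2))) X2 x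
     ltac:(lra)).
  assert (W' : Cmod (F x - F X2)%C <= eps / 2 * exp (x * x / 2)).
  { eapply Rle_trans; [apply W|].
    - intros t Ht. apply DF; lra.
    - intros t _. auto_derive; [trivial | unfold Rdiv; field].
    - intros t Ht. rewrite !Cmod_mult, MPhi, Cmod_R, Rabs_pos_eq by lra.
      specialize (HX1 t ltac:(lra)). replace (r t - 0)%C with (r t) in HX1 by ring.
      replace (Cmod w * t * exp (t * t / 2) * Cmod (r t))
        with ((Cmod w * Cmod (r t)) * (t * exp (t * t / 2))) by ring.
      apply Rmult_le_compat_r.
      { apply Rmult_le_pos; [lra | apply Rlt_le, exp_pos]. }
      replace (eps / 4) with (M * (eps / (4 * M))) by (field; lra).
      apply Rmult_le_compat; try apply Cmod_ge_0; unfold M in *; lra.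
    - assert (P2 := exp_pos (X2 * X2 / 2)). nra. }
  specialize (HX3 x ltac:(lra)).
  assert (I1 : Cmod (F x - F X2)%C / exp (x * x / 2) <= eps / 2).
  { apply Rmult_le_reg_r with (exp (x * x / 2)); [assumption|].
    unfold Rdiv at 1; rewrite Rmult_assoc, Rinv_l by lra. lra. }
  assert (I2 : Cmod (F X2) / exp (x * x / 2) <= (Cmod (F X2) + 1) * exp (1 - x)).
  { unfold Rdiv at 1. rewrite <- exp_Ropp.
    apply Rmult_le_compat; [apply Cmod_ge_0 | apply Rlt_le, exp_pos | lra|].
    apply exp_le_compat. assert (0 <= (x - 1) ^ 2) by apply pow2_ge_0. nra. }
  lra. }
(* As x E = 1 / (Phi E), the product v x E equals (v / u / Phi) m, and v / u / Phi = F / Phi + w. *)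
apply (tends_to_ext (fun x => (F x / Phi x + w) * m x)%C _ _ (Rmax 0 X0)).
- assert (K : tends_to (fun x => (F x / Phi x + w) * m x)%C ((0 + w) * 1)%C).
  { apply tends_to_mult; [|exact Hm]. apply tends_to_plus; [exact HF | apply tends_to_const]. }
  replace ((0 + w) * 1)%C with w in K by ring. exact K.
- intros x Hx. assert (B1 := Rmax_l 0 X0). assert (B2 := Rmax_r 0 X0).
  unfold F.
  replace ((v x / u x - w * Phi x) / Phi x + w)%C with (v x / u x / Phi x)%C
    by (field; split; first [apply NPhi | apply Nu; lra]).
  unfold m.
  transitivity (v x / Phi x / E x)%C.
  + replace (v x / Phi x / E x)%C with
      (v x / Phi x / E x * (Phi x * (RtoC x * (E x * E x))))%C
      by (rewrite PE by lra; ring).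
    field. repeat split; first [apply NE | apply NPhi | apply Nu; lra].
  + field. repeat split; first [apply NE | apply NPhi | apply Nu; lra].
Qed.

(** The reciprocal of the leading term is written as a single exponential, with theta fixing the
    branch of the power, so that it merges with other exponentials by [Cexp_add]. *)
Lemma PCF_U_ray (U : C -> C -> C) (a theta : R) (h : C) :
  is_PCF_U U -> Rabs theta <= PI / 2 -> Cmod h = 1 ->
  (forall x, 0 < x -> Carg (RtoC x * h) = theta) ->
  tends_to (fun x => U (Ci * RtoC a) (RtoC x * h) *
    Cexp ((Ci * RtoC a + / 2) * (ln x, theta) + RtoC (x * x) * (h * h) / 4))%C 1.
Proof.
intros HU Ht Hh Harg. destruct (HU (Ci * RtoC a)%C) as [_ A].
assert (PP := PI_RGT_0).
intros eps He. destruct (A (PI / 4) ltac:(lra) eps He) as [M HM].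
exists (Rmax 0 M). intros x Hx.
assert (B1 := Rmax_l 0 M). assert (B2 := Rmax_r 0 M).
assert (Hm : Cmod (RtoC x * h)%C = x) by (rewrite Cmod_mult, Hh, Cmod_R, Rabs_pos_eq; lra).
specialize (HM (RtoC x * h)%C).
rewrite Hm, Harg in HM by lra. specialize (HM ltac:(lra) ltac:(lra)).
unfold Cpow, Clog in HM. rewrite Hm, Harg in HM by lra.
rewrite <- Cexp_add in HM.
set (D := Cexp _) in HM.
replace (Cexp _) with (/ D)%C; [exact HM|].
assert (ND : D <> 0%C) by apply Cexp_neq_0.
replace (/ D)%C with (/ D * Cexp 0)%C by (rewrite Cexp_0; ring).
match goal with |- _ = Cexp ?w => set (W := w) end.
replace (Cexp 0) with (D * Cexp W)%C; [field; exact ND|].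
unfold D. rewrite <- Cexp_add. f_equal. unfold W. rewrite RtoC_mult. field.
Qed.

Definition PCF_derivative (U : C -> C -> C) (b : C) (U' : C -> C) :=
  forall z, is_C_derive (U b) z (U' z) /\ is_C_derive U' z ((z * z / 4 + b) * U b z)%C.

Lemma PCF_ray_derive (U : C -> C -> C) (b h : C) (U' : C -> C) (x : R) :
  PCF_derivative U b U' ->
  is_derive_RC (fun t => U b (RtoC t * h))%C x (h * U' (RtoC x * h))%C /\
  is_derive_RC (fun t => h * U' (RtoC t * h))%C x
    (h * h * (RtoC x * h * (RtoC x * h) / 4 + b) * U b (RtoC x * h))%C.
Proof.
intros D. split.
- apply is_derive_RC_ext with (fun t => U b (0 + RtoC t * h)%C).
  { intros t. now rewrite Cplus_0_l. }
  apply is_derive_RC_line. rewrite Cplus_0_l. apply D.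
- apply is_derive_RC_ext with (fun t => h * U' (0 + RtoC t * h))%C.
  { intros t. now rewrite Cplus_0_l. }
  eapply is_derive_RC_eq.
  + apply is_derive_RC_mult; [apply is_derive_RC_const|].
    apply is_derive_RC_line. apply D.
  + cbv beta. rewrite !Cplus_0_l. ring.
Qed.

Lemma Carg_pos (x : R) : 0 < x -> Carg (RtoC x * 1) = 0.
Proof.
intros Hx. rewrite Cmult_1_r. unfold Carg; simpl.
destruct (Rlt_dec 0 x); [|lra].
replace (0 / x) with 0 by (field; lra). apply atan_0.
Qed.

Lemma Carg_imag (x sigma : R) : sigma = 1 \/ sigma = -1 -> 0 < x ->
  Carg (RtoC x * (0, sigma)) = sigma * (PI / 2).
Proof.
intros Hs Hx. unfold Carg.
replace (fst _) with 0 by (simpl; ring).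
replace (snd _) with (sigma * x) by (simpl; ring).
destruct (Rlt_dec 0 0); [lra|].
destruct Hs; subst sigma.
- destruct (Rlt_dec 0 (1 * x)); lra.
- destruct (Rlt_dec 0 (-1 * x)); [lra|]. destruct (Rlt_dec (-1 * x) 0); lra.
Qed.

Lemma PCF_recessive (U : C -> C -> C) (a : R) : is_PCF_U U ->
  tends_to (fun x => U (Ci * RtoC a) (RtoC x * 1) / recessive a x)%C 1.
Proof.
intros HU.
assert (PP := PI_RGT_0).
assert (H := PCF_U_ray U a 0 1 HU ltac:(rewrite Rabs_R0; lra) Cmod_1 Carg_pos).
apply tends_to_ext with (1 := H) (X := 0). intros x Hx. unfold Cdiv at 1. f_equal.
assert (N := recessive_neq_0 a x).
replace (/ recessive a x)%C with (/ recessive a x * Cexp 0)%C by (rewrite Cexp_0; ring).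
match goal with |- _ = Cexp ?w => set (W := w) end.
replace (Cexp 0) with (recessive a x * Cexp W)%C; [field; exact N|].
unfold recessive. rewrite <- Cexp_add. f_equal. unfold W.
apply injective_projections; simpl; field.
Qed.

(** Because (sigma i)^2 = -1, the function U(-ia, sigma i x) solves the equation of U(ia, x). Its
    growth is reciprocal to x [recessive a x], so the limit in [wronskian_limit] is the constant
    left by arg(sigma i) = sigma pi/2 in the power. *)
Lemma PCF_wronskian (U : C -> C -> C) (a sigma : R) (U' V' : C -> C) :
  is_PCF_U U -> sigma = 1 \/ sigma = -1 ->
  PCF_derivative U (Ci * RtoC a) U' -> PCF_derivative U (Ci * RtoC (- a)) V' ->
  (U (Ci * RtoC a) 0 * ((0, sigma) * V' 0) - U' 0 * U (Ci * RtoC (- a)) 0)%C =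
  Cexp ((Ci * RtoC a - / 2) * (0, sigma * (PI / 2))%R)%C.
Proof.
intros HU Hs DU DV.
assert (PP := PI_RGT_0).
set (h := (0, sigma) : C).
assert (Hh : (h * h = - (1))%C).
{ unfold h; destruct Hs; subst sigma; apply injective_projections; simpl; ring. }
assert (Hm : Cmod h = 1).
{ unfold h, Cmod; simpl. destruct Hs; subst sigma;
    replace (0 * (0 * 1) + _) with 1 by ring; apply sqrt_1. }
assert (L := wronskian_limit a (fun x => RtoC x * RtoC x / 4 + Ci * RtoC a)%C
  (fun x => U (Ci * RtoC a) (RtoC x * 1))%C (fun x => 1 * U' (RtoC x * 1))%C
  (fun x => U (Ci * RtoC (- a)) (RtoC x * h))%C (fun x => h * V' (RtoC x * h))%C).
assert (L' : tends_to (fun x => U (Ci * RtoC (- a)) (RtoC x * h) * (RtoC x * recessive a x))%C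
   (U (Ci * RtoC a) 0 * (h * V' 0) - U' 0 * U (Ci * RtoC (- a)) 0)%C).
{ replace (U (Ci * RtoC a) 0 * (h * V' 0) - U' 0 * U (Ci * RtoC (- a)) 0)%C
    with (wronskian (fun x => U (Ci * RtoC a) (RtoC x * 1))%C (fun x => 1 * U' (RtoC x * 1))%C
  (fun x => U (Ci * RtoC (- a)) (RtoC x * h))%C (fun x => h * V' (RtoC x * h))%C 0).
  2: { unfold wronskian. rewrite !Cmult_0_l, Cmult_1_l. reflexivity. }
  apply L.
  - intros x. apply (PCF_ray_derive U _ 1 U' x DU).
  - intros x. eapply is_derive_RC_eq; [apply (PCF_ray_derive U _ 1 U' x DU) | field].
  - intros x. apply (PCF_ray_derive U _ h V' x DV).
  - intros x. eapply is_derive_RC_eq; [apply (PCF_ray_derive U _ h V' x DV)|].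
    rewrite Hh. f_equal.
    replace (RtoC x * h * (RtoC x * h))%C with (RtoC x * RtoC x * (h * h))%C by ring.
    rewrite Hh, RtoC_opp. field.
  - now apply PCF_recessive. }
apply (tends_to_unique _ _ _ L').
assert (R := PCF_U_ray U (- a) (sigma * (PI / 2)) h HU
  ltac:(destruct Hs; subst sigma; apply Rabs_le_between; lra) Hm
  (fun x => Carg_imag x sigma Hs)).
set (k := Cexp ((Ci * RtoC a - / 2) * (0, sigma * (PI / 2))%R)%C).
assert (R' := tends_to_mult _ _ _ _ R (tends_to_const k)).
rewrite Cmult_1_l in R'. cbv beta in R'.
apply tends_to_ext with (1 := R') (X := 0). intros x Hx.
rewrite <- !Cmult_assoc. f_equal.
replace (RtoC x) with (Cexp (RtoC (ln x))) at 1 by (now rewrite Cexp_RtoC, exp_ln).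
unfold recessive, k. rewrite <- !Cexp_add. f_equal. rewrite Hh.
apply injective_projections; simpl; field.
Qed.

(** * Absolutely convergent integrals on the half-line *)

Notation is_RInt_0_infty f l := (is_RInt_gen f (at_right 0) (Rbar_locally p_infty) l).

Lemma at_right_0_interval (P : R -> Prop) : at_right 0 P <->
  exists d : R, 0 < d /\ forall t, 0 < t < d -> P t.
Proof.
split.
- intros [d H]. exists d; split; [apply cond_pos|]. intros t Ht. apply H; [|lra].
  change (Rabs (t - 0) < d). rewrite Rminus_0_r, Rabs_pos_eq; lra.
- intros (d & Hd & H). exists (mkposreal d Hd). intros t Ht Ht0. apply H; split; [assumption|].
  change (Rabs (t - 0) < d) in Ht. rewrite Rminus_0_r, Rabs_pos_eq in Ht; lra.
Qed.

Lemma is_RInt_0_infty_approx (f : R -> R) (l eps a0 b0 : R) :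
  is_RInt_0_infty f l -> 0 < eps -> 0 < a0 ->
  exists a b i, 0 < a < a0 /\ b0 < b /\ is_RInt f a b i /\ Rabs (i - l) < eps.
Proof.
intros H He Ha.
destruct (H _ (locally_ball l (mkposreal eps He))) as [Q S HQ [X HS] K].
apply at_right_0_interval in HQ. destruct HQ as (d & Hd & HQ).
assert (B1 := Rmin_l a0 d). assert (B2 := Rmin_r a0 d).
assert (B3 : 0 < Rmin a0 d) by now apply Rmin_pos.
assert (B4 := Rmax_l b0 X). assert (B5 := Rmax_r b0 X).
destruct (K (Rmin a0 d / 2) (Rmax b0 X + 1)) as (i & Hi & Hb).
- apply HQ; lra.
- apply HS; lra.
- exists (Rmin a0 d / 2), (Rmax b0 X + 1), i. repeat split; try lra; assumption.
Qed.

(** A bounded monotone function has limits at both ends of the half-line; the suprema of H on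
    [1, oo) and of -H on (0, 1] provide d and X. *)
Lemma monotone_bounded_cauchy (H : R -> R) (M : R) :
  (forall s t, 0 < s -> s <= t -> 0 <= H t - H s <= M) -> forall eps, 0 < eps ->
  exists d X, 0 < d /\ 0 < X /\
    (forall s t, 0 < s <= t -> t < d -> H t - H s < eps) /\
    (forall s t, X < s <= t -> H t - H s < eps).
Proof.
intros B eps He.
assert (S1 : exists X, 0 < X /\ forall s t, X < s <= t -> H t - H s < eps).
{ destruct (completeness (fun y => exists t, 1 <= t /\ y = H t)) as [L [L1 L2]].
  - exists (H 1 + M). intros y (t & Ht & ->). specialize (B 1 t); lra.
  - exists (H 1), 1; split; lra.
  - destruct (classic (exists X, 1 <= X /\ L - eps < H X)) as [(X & HX1 & HX2)|N].
    + exists X; split; [lra|]. intros s t Hst.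
      assert (H t <= L) by (apply L1; exists t; split; [lra | reflexivity]).
      assert (W := B X s ltac:(lra) ltac:(lra)). lra.
    + exfalso. assert (L <= L - eps); [|lra].
      apply L2. intros y (t & Ht & ->).
      destruct (Rle_lt_dec (H t) (L - eps)); [assumption|].
      exfalso; apply N; exists t; lra. }
assert (S2 : exists d, 0 < d /\ forall s t, 0 < s <= t -> t < d -> H t - H s < eps).
{ destruct (completeness (fun y => exists t, 0 < t <= 1 /\ y = - H t)) as [L [L1 L2]].
  - exists (M - H 1). intros y (t & Ht & ->). specialize (B t 1); lra.
  - exists (- H 1), 1; split; lra.
  - destruct (classic (exists X, 0 < X <= 1 /\ L - eps < - H X)) as [(X & HX1 & HX2)|N].
    + exists X; split; [lra|]. intros s t Hst Ht.
      assert (- H s <= L) by (apply L1; exists s; split; [lra | reflexivity]).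
      assert (W := B t X ltac:(lra) ltac:(lra)). lra.
    + exfalso. assert (L <= L - eps); [|lra].
      apply L2. intros y (t & Ht & ->).
      destruct (Rle_lt_dec (- H t) (L - eps)); [assumption|].
      exfalso; apply N; exists t; lra. }
destruct S1 as (X & HX & S1), S2 as (d & Hd & S2). now exists d, X.
Qed.

(** The majorant h enters through a primitive H with bounded increments. They make the primitive of
    f Cauchy at 0 and at infinity, and bound the integral without integrating h. *)
Lemma is_RInt_0_infty_dominated (f H h : R -> R) (M : R) :
  (forall t, 0 < t -> continuous f t) ->
  (forall t, 0 < t -> is_derive H t (h t)) ->
  (forall t, 0 < t -> Rabs (f t) <= h t) ->
  (forall s t, 0 < s -> s <= t -> H t - H s <= M) ->
  exists l, is_RInt_0_infty f l /\ Rabs l <= M.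
Proof.
intros Cf DH Hle HM.
assert (Ef : forall s t, 0 < s -> 0 < t -> ex_RInt f s t).
{ intros s t Hs Ht. apply (ex_RInt_continuous (V := R_CompleteNormedModule)).
  intros z Hz. apply Cf. assert (0 < Rmin s t) by now apply Rmin_pos. lra. }
set (F := fun t => RInt f 1 t).
assert (DF : forall t, 0 < t -> is_derive F t (f t)).
{ intros t Ht. apply (is_derive_RInt f F 1 t); [|now apply Cf].
  exists (mkposreal t Ht). intros s Hs. apply (RInt_correct (V := R_CompleteNormedModule)), Ef; [lra|].
  change (Rabs (s - t) < t) in Hs. apply Rabs_def2 in Hs. lra. }
assert (IF : forall s t, 0 < s -> 0 < t -> is_RInt f s t (F t - F s)).
{ intros s t Hs Ht. apply (is_RInt_derive (V := R_CompleteNormedModule) F f).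
  - intros z Hz. apply DF. assert (0 < Rmin s t) by now apply Rmin_pos. lra.
  - intros z Hz. apply Cf. assert (0 < Rmin s t) by now apply Rmin_pos. lra. }
assert (FH : forall s t, 0 < s -> s <= t -> Rabs (F t - F s) <= H t - H s).
{ intros s t Hs Hst. apply (is_derive_abs_le F H f h); auto; intros z Hz;
    [apply DF | apply DH | apply Hle]; lra. }
assert (Hc := monotone_bounded_cauchy H M).
assert (HB : forall s t, 0 < s -> s <= t -> 0 <= H t - H s <= M).
{ intros s t Hs Hst. split; [|now apply HM].
  eapply Rle_trans; [apply Rabs_pos | now apply FH]. }
specialize (Hc HB).
assert (L0 : exists l : R, filterlim F (at_right 0) (locally l)).
{ apply (filterlim_locally_cauchy (U := R_CompleteSpace)). intros eps.
  destruct (Hc eps (cond_pos eps)) as (d & X & Hd & HX & K1 & K2).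
  exists (fun t => 0 < t < d); split.
  - apply at_right_0_interval. now exists d.
  - intros u v Hu Hv. change (Rabs (F v - F u) < eps).
    destruct (Rle_dec u v).
    + eapply Rle_lt_trans; [apply FH; lra | apply K1; lra].
    + rewrite Rabs_minus_sym. eapply Rle_lt_trans; [apply FH; lra | apply K1; lra]. }
assert (L1 : exists l : R, filterlim F (Rbar_locally p_infty) (locally l)).
{ apply (filterlim_locally_cauchy (U := R_CompleteSpace)). intros eps.
  destruct (Hc eps (cond_pos eps)) as (d & X & Hd & HX & K1 & K2).
  exists (fun t => X < t); split.
  - now exists X.
  - intros u v Hu Hv. change (Rabs (F v - F u) < eps).
    destruct (Rle_dec u v).
    + eapply Rle_lt_trans; [apply FH; lra | apply K2; lra].
    + rewrite Rabs_minus_sym. eapply Rle_lt_trans; [apply FH; lra | apply K2; lra]. }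
destruct L0 as [l0 L0], L1 as [l1 L1].
assert (I : is_RInt_0_infty f (l1 - l0)).
{ intros P [e He].
  assert (Pe : 0 < e / 2) by (generalize (cond_pos e); lra).
  assert (A0 := L0 _ (locally_ball l0 (mkposreal _ Pe))).
  assert (A1 := L1 _ (locally_ball l1 (mkposreal _ Pe))).
  apply at_right_0_interval in A0. destruct A0 as (d & Hd & A0).
  destruct A1 as [X A1].
  exists (fun t => 0 < t < d) (fun t => Rmax 0 X < t).
  - apply at_right_0_interval. now exists d.
  - now exists (Rmax 0 X).
  - intros s t Hs Ht. simpl.
    assert (B1 := Rmax_l 0 X). assert (B2 := Rmax_r 0 X).
    exists (F t - F s). split; [apply IF; lra|].
    apply He. specialize (A0 s Hs). specialize (A1 t ltac:(lra)).
    change (Rabs (F s - l0) < e / 2) in A0. change (Rabs (F t - l1) < e / 2) in A1.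
    change (Rabs (F t - F s - (l1 - l0)) < e).
    apply Rabs_def2 in A0. apply Rabs_def2 in A1. apply Rabs_def1; lra. }
exists (l1 - l0); split; [exact I|].
(* The bound M holds on every compact interval and passes to the limit up to eps. *)
apply Rle_plus_epsilon. intros eps He.
destruct (is_RInt_0_infty_approx f _ eps 1 1 I He Rlt_0_1) as (s & t & i & Hs & Ht & Hi & Hl).
assert (E := is_RInt_unique _ _ _ _ Hi).
rewrite (is_RInt_unique _ _ _ _ (IF s t ltac:(lra) ltac:(lra))) in E.
assert (W := FH s t ltac:(lra) ltac:(lra)). assert (W' := HB s t ltac:(lra) ltac:(lra)).
rewrite E in W. replace (l1 - l0) with (i - (i - (l1 - l0))) by ring.
eapply Rle_trans; [apply Rabs_triang|]. rewrite Rabs_Ropp. lra.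
Qed.

Lemma is_RInt_0_infty_ext (f g : R -> R) (l : R) :
  (forall t, 0 < t -> f t = g t) -> is_RInt_0_infty f l -> is_RInt_0_infty g l.
Proof.
intros E. apply is_RInt_gen_ext.
exists (fun t => 0 < t) (fun t => 0 < t).
- apply at_right_0_interval. exists 1; split; [lra|]. tauto.
- now exists 0.
- intros s t Hs Ht u Hu. simpl in Hu. apply E.
  assert (0 < Rmin s t) by now apply Rmin_pos. lra.
Qed.

Lemma is_RInt_0_infty_scale (f : R -> R) (x l : R) :
  0 < x -> is_RInt_0_infty f l -> is_RInt_0_infty (fun t => x * f (x * t)) l.
Proof.
intros Hx H P HP. destruct (H P HP) as [Q S HQ [X HS] K].
apply at_right_0_interval in HQ. destruct HQ as (d & Hd & HQ).
exists (fun t => 0 < t < d / x) (fun t => X / x < t).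
- apply at_right_0_interval. exists (d / x); split; [now apply Rdiv_lt_0_compat | tauto].
- now exists (X / x).
- intros s t Hs Ht. simpl.
  assert (Es : x * s < d).
  { replace d with (x * (d / x)) by (field; lra). apply Rmult_lt_compat_l; lra. }
  assert (Et : X < x * t).
  { replace X with (x * (X / x)) by (field; lra). apply Rmult_lt_compat_l; lra. }
  destruct (K (x * s) (x * t)) as (y & Hy & HPy).
  + apply HQ. split; [apply Rmult_lt_0_compat|]; lra.
  + now apply HS.
  + exists y; split; [|exact HPy].
    assert (W := is_RInt_comp_lin f x 0 s t y). rewrite !Rplus_0_r in W. specialize (W Hy).
    eapply is_RInt_ext; [|exact W]. intros u _. change (x * f (x * u + 0) = x * f (x * u)). now rewrite Rplus_0_r.
Qed.

Lemma is_RInt_0_infty_unique (f : R -> R) (l m : R) :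
  is_RInt_0_infty f l -> is_RInt_0_infty f m -> l = m.
Proof.
intros H1 H2. rewrite <- (is_RInt_gen_unique _ _ H1). now apply is_RInt_gen_unique.
Qed.

Lemma is_RInt_0_infty_lower_bound (f : R -> R) (l p q c : R) :
  is_RInt_0_infty f l -> (forall t, 0 < t -> continuous f t) -> (forall t, 0 < t -> 0 <= f t) ->
  0 < p <= q -> (forall t, p <= t <= q -> c <= f t) -> c * (q - p) <= l.
Proof.
intros I Cf P0 Hpq Hc. apply Rle_plus_epsilon. intros eps He.
destruct (is_RInt_0_infty_approx f l eps p q I He ltac:(lra)) as (s & t & i & Hs & Ht & Hi & Hl).
assert (Ef : forall s t, 0 < s -> s <= t -> ex_RInt f s t).
{ intros u v Hu Hv. apply (ex_RInt_continuous (V := R_CompleteNormedModule)).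
  intros z Hz. apply Cf. rewrite Rmin_left in Hz by lra. lra. }
assert (E : i = RInt f s p + RInt f p q + RInt f q t).
{ rewrite <- (is_RInt_unique _ _ _ _ Hi).
  rewrite <- (RInt_Chasles f s q t) by (apply Ef; lra).
  rewrite <- (RInt_Chasles f s p q) by (apply Ef; lra). reflexivity. }
assert (N1 : 0 <= RInt f s p).
{ apply RInt_ge_0; [lra | apply Ef; lra |]. intros; apply P0; lra. }
assert (N2 : 0 <= RInt f q t).
{ apply RInt_ge_0; [lra | apply Ef; lra |]. intros; apply P0; lra. }
assert (N3 : c * (q - p) <= RInt f p q).
{ rewrite Rmult_comm.
  rewrite <- (RInt_const (V := R_CompleteNormedModule) p q c : RInt (fun _ => c) p q = (q - p) * c).
  apply RInt_le; [lra | apply (ex_RInt_const (V := R_NormedModule)) | apply Ef; lra |].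
  intros; apply Hc; lra. }
apply Rabs_def2 in Hl. lra.
Qed.

Definition is_CInt_0_infty (f : R -> C) (l : C) :=
  is_RInt_0_infty (fun t => fst (f t)) (fst l) /\ is_RInt_0_infty (fun t => snd (f t)) (snd l).

(** Serves as a source of continuity of both components, inherited through the derivative rules. *)
Definition smooth_pos (f : R -> C) := forall t, 0 < t -> exists l, is_derive_RC f t l.

Lemma is_CInt_0_infty_unique (f : R -> C) (l m : C) :
  is_CInt_0_infty f l -> is_CInt_0_infty f m -> l = m.
Proof.
intros [H1 H2] [H3 H4]. apply injective_projections; eapply is_RInt_0_infty_unique; eassumption.
Qed.

Lemma is_CInt_0_infty_CRInt_gen (f : R -> C) (l : C) :
  is_CInt_0_infty f l -> CRInt_gen f (at_right 0) (Rbar_locally p_infty) = l.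
Proof.
intros [H1 H2]. apply injective_projections; simpl; now apply is_RInt_gen_unique.
Qed.

Lemma is_CInt_0_infty_ext (f g : R -> C) (l : C) :
  (forall t, 0 < t -> f t = g t) -> is_CInt_0_infty f l -> is_CInt_0_infty g l.
Proof.
intros E [H1 H2]; split; eapply is_RInt_0_infty_ext; eauto; intros t Ht; simpl; now rewrite E.
Qed.

Lemma is_CInt_0_infty_plus (f g : R -> C) (l m : C) :
  is_CInt_0_infty f l -> is_CInt_0_infty g m ->
  is_CInt_0_infty (fun t => f t + g t)%C (l + m)%C.
Proof.
intros [H1 H2] [H3 H4]; split.
- exact (is_RInt_gen_plus _ _ _ _ H1 H3).
- exact (is_RInt_gen_plus _ _ _ _ H2 H4).
Qed.

Lemma is_CInt_0_infty_scal (f : R -> C) (c l : C) :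
  is_CInt_0_infty f l -> is_CInt_0_infty (fun t => c * f t)%C (c * l)%C.
Proof.
intros [H1 H2]; split; simpl.
- exact (is_RInt_gen_minus _ _ _ _ (is_RInt_gen_scal _ (fst c) _ H1)
    (is_RInt_gen_scal _ (snd c) _ H2)).
- exact (is_RInt_gen_plus _ _ _ _ (is_RInt_gen_scal _ (fst c) _ H2)
    (is_RInt_gen_scal _ (snd c) _ H1)).
Qed.

Lemma is_CInt_0_infty_scale (f : R -> C) (x : R) (l : C) :
  0 < x -> is_CInt_0_infty f l -> is_CInt_0_infty (fun t => RtoC x * f (x * t)%R)%C l.
Proof.
intros Hx [H1 H2]; split; simpl.
- apply is_RInt_0_infty_ext with (2 := is_RInt_0_infty_scale _ x _ Hx H1). intros; simpl; ring.
- apply is_RInt_0_infty_ext with (2 := is_RInt_0_infty_scale _ x _ Hx H2). intros; simpl; ring.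
Qed.

Lemma is_CInt_0_infty_dominated (f : R -> C) (H h : R -> R) (M : R) :
  smooth_pos f -> (forall t, 0 < t -> is_derive H t (h t)) ->
  (forall t, 0 < t -> Cmod (f t) <= h t) ->
  (forall s t, 0 < s -> s <= t -> H t - H s <= M) ->
  exists l, is_CInt_0_infty f l /\ Cmod l <= 2 * M.
Proof.
intros Sf DH Hle HM.
destruct (is_RInt_0_infty_dominated (fun t => fst (f t)) H h M) as (l1 & I1 & B1); auto.
{ intros t Ht. destruct (Sf t Ht) as [l Hl]. exact (is_derive_RC_fst_continuous _ _ _ Hl). }
{ intros t Ht. eapply Rle_trans; [apply Rabs_fst_le_Cmod | auto]. }
destruct (is_RInt_0_infty_dominated (fun t => snd (f t)) H h M) as (l2 & I2 & B2); auto.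
{ intros t Ht. destruct (Sf t Ht) as [l Hl]. exact (is_derive_RC_snd_continuous _ _ _ Hl). }
{ intros t Ht. eapply Rle_trans; [apply Rabs_snd_le_Cmod | auto]. }
exists (l1, l2); split; [now split|].
eapply Rle_trans; [apply Cmod_le_Rabs|]. simpl; lra.
Qed.

Lemma is_CInt_0_infty_norm_le (f : R -> C) (H h : R -> R) (M : R) (l : C) :
  is_CInt_0_infty f l -> smooth_pos f -> (forall t, 0 < t -> is_derive H t (h t)) ->
  (forall t, 0 < t -> Cmod (f t) <= h t) ->
  (forall s t, 0 < s -> s <= t -> H t - H s <= M) -> Cmod l <= 2 * M.
Proof.
intros I Sf DH Hle HM.
destruct (is_CInt_0_infty_dominated f H h M Sf DH Hle HM) as (m & Hm & B).
now rewrite (is_CInt_0_infty_unique f l m I Hm).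
Qed.

Lemma is_CInt_0_infty_derive (G G' : R -> C) (l : C) :
  (forall t, 0 < t -> is_derive_RC G t (G' t)) -> smooth_pos G' ->
  (forall eps, 0 < eps -> exists d X, 0 < d /\
     forall t, 0 < t -> t < d \/ X < t -> Cmod (G t) < eps) ->
  is_CInt_0_infty G' l -> l = 0%C.
Proof.
intros D S B [I1 I2].
assert (Q : forall (p : C -> R) (v : R), (forall u, Rabs (p u) <= Cmod u) ->
  (forall t, 0 < t -> is_derive (fun t => p (G t)) t (p (G' t))) ->
  (forall t, 0 < t -> continuous (fun t => p (G' t)) t) ->
  is_RInt_0_infty (fun t => p (G' t)) v -> v = 0).
{ intros p v p1 Dp Cp I. apply cond_eq. intros eps He. rewrite Rminus_0_r.
  (* Three errors of eps / 4: the values of G at both ends and the truncation of the integral. *)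
  destruct (B (eps / 4)) as (d & X & Hd & K); [lra|].
  destruct (is_RInt_0_infty_approx _ _ (eps / 4) (Rmin d 1) (Rmax 1 X) I)
    as (s & t & i & Hs & Ht & Hi & Hl); [lra | apply Rmin_pos; lra |].
  assert (B1 := Rmin_l d 1). assert (B2 := Rmin_r d 1).
  assert (B3 := Rmax_l 1 X). assert (B4 := Rmax_r 1 X).
  assert (J : is_RInt (fun t => p (G' t)) s t (p (G t) - p (G s))).
  { apply (is_RInt_derive (V := R_CompleteNormedModule) (fun t => p (G t))).
    - intros z Hz. rewrite Rmin_left in Hz by lra. apply Dp; lra.
    - intros z Hz. rewrite Rmin_left in Hz by lra. apply Cp; lra. }
  assert (E := is_RInt_unique _ _ _ _ Hi). rewrite (is_RInt_unique _ _ _ _ J) in E.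
  assert (K1 := K s ltac:(lra) ltac:(lra)). assert (K2 := K t ltac:(lra) ltac:(lra)).
  assert (P1 := p1 (G s)). assert (P2 := p1 (G t)).
  rewrite <- E in Hl. apply Rabs_def2 in Hl.
  apply Rle_lt_trans with (eps * (3 / 4)); [|lra].
  apply Rabs_le_between in P1. apply Rabs_le_between in P2.
  apply Rabs_le_between. lra. }
apply injective_projections.
- apply (Q fst); [apply Rabs_fst_le_Cmod | intros; now apply D | | exact I1].
  intros t Ht. destruct (S t Ht) as [k Hk]. exact (is_derive_RC_fst_continuous _ _ _ Hk).
- apply (Q snd); [apply Rabs_snd_le_Cmod | intros; now apply D | | exact I2].
  intros t Ht. destruct (S t Ht) as [k Hk]. exact (is_derive_RC_snd_continuous _ _ _ Hk).
Qed.

(** An integrable majorant of total mass 1 with an elementary primitive. It behaves like t^{-1/2}/2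
    at 0, the singularity of the kernels below, and like t^{-3/2}/2 at infinity. *)
Definition weight (t : R) : R := / (2 * sqrt t * (1 + sqrt t) ^ 2).
Definition weight_primitive (t : R) : R := sqrt t / (1 + sqrt t).

Lemma weight_derive (t : R) : 0 < t -> is_derive weight_primitive t (weight t).
Proof.
intros Ht. assert (P := sqrt_lt_R0 t Ht). unfold weight_primitive, weight.
auto_derive; [repeat split; lra|]. field. split; lra.
Qed.

Lemma weight_pos (t : R) : 0 < t -> 0 < weight t.
Proof.
intros Ht. assert (P := sqrt_lt_R0 t Ht). unfold weight. apply Rinv_0_lt_compat.
apply Rmult_lt_0_compat; nra.
Qed.

Lemma weight_primitive_bound (s t : R) :
  0 < s -> s <= t -> weight_primitive t - weight_primitive s <= 1.
Proof.
intros Hs Hst. assert (P := sqrt_lt_R0 s Hs). assert (P' := sqrt_lt_R0 t ltac:(lra)).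
unfold weight_primitive.
assert (0 <= sqrt s / (1 + sqrt s)) by (apply Rlt_le, Rdiv_lt_0_compat; lra).
assert (sqrt t / (1 + sqrt t) <= 1).
{ apply Rmult_le_reg_r with (1 + sqrt t); [lra|].
  unfold Rdiv; rewrite Rmult_assoc, Rinv_l; lra. }
lra.
Qed.

Lemma is_CInt_0_infty_weight (f : R -> C) (c : R) :
  0 <= c -> smooth_pos f -> (forall t, 0 < t -> Cmod (f t) <= c * weight t) ->
  exists l, is_CInt_0_infty f l /\ Cmod l <= 2 * c.
Proof.
intros Hc S B. apply (is_CInt_0_infty_dominated f (fun t => c * weight_primitive t)
  (fun t => c * weight t)); auto.
- intros t Ht. apply is_derive_scal. now apply weight_derive.
- intros s t Hs Hst. assert (W := weight_primitive_bound s t Hs Hst). nra.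
Qed.

Lemma is_CInt_0_infty_weight_le (f : R -> C) (c : R) (l : C) : is_CInt_0_infty f l ->
  0 <= c -> smooth_pos f -> (forall t, 0 < t -> Cmod (f t) <= c * weight t) -> Cmod l <= 2 * c.
Proof.
intros I Hc S B. destruct (is_CInt_0_infty_weight f c Hc S B) as (m & Hm & Bm).
now rewrite (is_CInt_0_infty_unique f l m I Hm).
Qed.

Lemma exp_neg_half_ln (t : R) : 0 < t -> exp (- (ln t / 2)) = / sqrt t.
Proof.
intros Ht. rewrite exp_Ropp. f_equal.
rewrite <- (sqrt_pow2 (exp (ln t / 2))) by apply Rlt_le, exp_pos.
f_equal. simpl. rewrite Rmult_1_r, <- exp_plus.
replace (ln t / 2 + ln t / 2) with (ln t) by field. now apply exp_ln.
Qed.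

(** Here e^{-(ln t)/2} is t^{-1/2}, and (1 + sqrt t)^2 <= 2 (1 + t) <= 2 e^t. *)
Lemma weight_dominates (k t y : R) : 0 < t -> y <= exp (k - t) ->
  y * exp (- (ln t / 2)) <= 4 * exp k * weight t.
Proof.
intros Ht Hy. assert (P := sqrt_lt_R0 t Ht).
rewrite exp_neg_half_ln by assumption. unfold weight.
apply Rmult_le_reg_r with (sqrt t * (1 + sqrt t) ^ 2); [apply Rmult_lt_0_compat; nra|].
replace (y * / sqrt t * (sqrt t * (1 + sqrt t) ^ 2)) with (y * (1 + sqrt t) ^ 2) by (field; lra).
replace (4 * exp k * / (2 * sqrt t * (1 + sqrt t) ^ 2) * (sqrt t * (1 + sqrt t) ^ 2))
  with (2 * exp k) by (field; split; lra).
assert (Q : (1 + sqrt t) ^ 2 <= 2 * exp t).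
{ assert (S := sqrt_sqrt t ltac:(lra)). assert (X := exp_ineq1_le t).
  assert (0 <= (1 - sqrt t) ^ 2) by apply pow2_ge_0. nra. }
apply Rle_trans with (exp (k - t) * (2 * exp t)).
- apply Rle_trans with (exp (k - t) * (1 + sqrt t) ^ 2).
  + apply Rmult_le_compat_r; [apply pow2_ge_0 | assumption].
  + apply Rmult_le_compat_l; [apply Rlt_le, exp_pos | assumption].
- right. replace (exp (k - t) * (2 * exp t)) with (2 * (exp (k - t) * exp t)) by ring.
  rewrite <- exp_plus. do 2 f_equal. ring.
Qed.

(** * The Laplace integral of the parabolic cylinder function *)

(* [t^{n+b-1/2} e^{-t^2/2-xt}] with [b = ia]. *)
Definition kernel (a : R) (n : nat) (x t : R) : C :=
  (RtoC (t ^ n) * Cexp ((Ci * RtoC a - / 2) * RtoC (ln t) - RtoC (t * t / 2 + x * t)))%C.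

Lemma kernel_S (a : R) (n : nat) (x t : R) : kernel a (S n) x t = (RtoC t * kernel a n x t)%C.
Proof. unfold kernel. simpl pow. rewrite RtoC_mult. ring. Qed.

Lemma kernel_shift (a : R) (n : nat) (x d t : R) :
  kernel a n (x + d) t = (kernel a n x t * RtoC (exp (- (d * t))))%C.
Proof.
unfold kernel. rewrite <- Cexp_RtoC, <- Cmult_assoc, <- Cexp_add. do 2 f_equal.
apply injective_projections; simpl; field.
Qed.

Lemma Cmod_kernel (a : R) (n : nat) (x t : R) : 0 < t ->
  Cmod (kernel a n x t) = t ^ n * exp (- (t * t / 2 + x * t)) * exp (- (ln t / 2)).
Proof.
intros Ht. unfold kernel. rewrite Cmod_mult, Cmod_R, Cmod_Cexp, Rabs_pos_eq.
2: { apply pow_le; lra. }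
rewrite Rmult_assoc, <- exp_plus. do 2 f_equal. simpl. field.
Qed.

(** From t^n <= e^{nt} and completing the square: (n + 1 - x) t - t^2/2 <= (n + 1 - x)^2/2, the 1
    being the e^{-t} left for [weight_dominates]. It holds for x of either sign. *)
Lemma Cmod_kernel_le (a : R) (n : nat) (x t : R) : 0 < t ->
  Cmod (kernel a n x t) <= 4 * exp ((INR n + 1 - x) ^ 2 / 2) * weight t.
Proof.
intros Ht. rewrite Cmod_kernel by assumption. apply weight_dominates; [assumption|].
assert (P : t ^ n <= exp (INR n * t)).
{ induction n as [|n IH]; [simpl; rewrite Rmult_0_l, exp_0; lra|].
  rewrite S_INR, Rmult_plus_distr_r, Rmult_1_l, exp_plus.
  replace (t ^ S n) with (t ^ n * t) by (simpl; ring).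
  apply Rmult_le_compat; [apply pow_le; lra | lra | exact IH |].
  assert (X := exp_ineq1_le t). lra. }
apply Rle_trans with (exp (INR n * t) * exp (- (t * t / 2 + x * t))).
- apply Rmult_le_compat_r; [apply Rlt_le, exp_pos | exact P].
- rewrite <- exp_plus. apply exp_le_compat.
  assert (0 <= (INR n + 1 - x - t) ^ 2) by apply pow2_ge_0. lra.
Qed.

(** The exponent [S n] keeps the derivative within the family: the factor 1/t lowers it to n. *)
Lemma kernel_derive (a : R) (n : nat) (x t : R) : 0 < t ->
  is_derive_RC (kernel a (S n) x) t
    ((Ci * RtoC a - / 2 + RtoC (INR (S n))) * kernel a n x t
      - kernel a (S (S n)) x t - RtoC x * kernel a (S n) x t)%C.
Proof.
intros Ht. unfold kernel. eapply is_derive_RC_eq.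
- apply is_derive_RC_mult.
  + apply (is_derive_RC_RtoC (fun t => t ^ S n) t (INR (S n) * t ^ n)).
    apply is_derive_Reals, (derivable_pt_lim_pow t (S n)).
  + apply is_derive_RC_Cexp, is_derive_RC_minus.
    * apply is_derive_RC_mult; [apply is_derive_RC_const | apply is_derive_RC_RtoC].
      apply is_derive_Reals, derivable_pt_lim_ln, Ht.
    * apply (is_derive_RC_RtoC (fun t => t * t / 2 + x * t) t (t + x)).
      auto_derive; [trivial | field].
- cbv beta. set (e := Cexp _).
  assert (N : RtoC t <> 0%C) by (intros E; apply RtoC_inj in E; lra).
  change (t ^ S (S n)) with (t * (t * t ^ n)). change (t ^ S n) with (t * t ^ n).
  rewrite RtoC_inv, RtoC_plus, !RtoC_mult by lra. field. exact N.
Qed.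

Lemma kernel_smooth (a : R) (n : nat) (x : R) : smooth_pos (kernel a n x).
Proof.
intros t Ht. eexists. unfold kernel. apply is_derive_RC_mult.
- apply (is_derive_RC_RtoC (fun t => t ^ n) t (INR n * t ^ pred n)).
  apply is_derive_Reals, derivable_pt_lim_pow.
- apply is_derive_RC_Cexp, is_derive_RC_minus.
  + apply is_derive_RC_mult; [apply is_derive_RC_const | apply is_derive_RC_RtoC].
    apply is_derive_Reals, derivable_pt_lim_ln, Ht.
  + apply (is_derive_RC_RtoC (fun t => t * t / 2 + x * t) t (t + x)).
    auto_derive; [trivial | field].
Qed.

Lemma smooth_pos_plus (f g : R -> C) :
  smooth_pos f -> smooth_pos g -> smooth_pos (fun t => f t + g t)%C.
Proof.
intros Hf Hg t Ht. destruct (Hf t Ht), (Hg t Ht). eexists; apply is_derive_RC_plus; eassumption.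
Qed.

Lemma smooth_pos_scal (f : R -> C) (c : C) :
  smooth_pos f -> smooth_pos (fun t => c * f t)%C.
Proof.
intros Hf t Ht. destruct (Hf t Ht).
eexists; apply is_derive_RC_mult; [apply is_derive_RC_const | eassumption].
Qed.

Definition moment (a : R) (n : nat) (x : R) : C :=
  CRInt_gen (kernel a n x) (at_right 0) (Rbar_locally p_infty).

Lemma moment_correct (a : R) (n : nat) (x : R) :
  is_CInt_0_infty (kernel a n x) (moment a n x).
Proof.
destruct (is_CInt_0_infty_weight (kernel a n x) (4 * exp ((INR n + 1 - x) ^ 2 / 2)))
  as (l & I & _).
- assert (P := exp_pos ((INR n + 1 - x) ^ 2 / 2)). lra.
- apply kernel_smooth.
- intros t Ht. now apply Cmod_kernel_le.
- unfold moment. now rewrite (is_CInt_0_infty_CRInt_gen _ _ I).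
Qed.

(** From 1 + y <= e^y taken at y and at -y: the latter gives e^y - 1 <= y e^y, so the remainder is
    at most y (e^y - 1). *)
Lemma exp_taylor_1 (y : R) : Rabs (exp y - 1 - y) <= y ^ 2 * exp (Rabs y).
Proof.
assert (P := exp_ineq1_le y). assert (Q := exp_ineq1_le (- y)).
assert (E : exp y * exp (- y) = 1) by (rewrite <- exp_plus, Rplus_opp_r; apply exp_0).
assert (P0 := exp_pos y).
assert (L : exp y - 1 <= y * exp y) by nra.
rewrite Rabs_pos_eq by lra.
destruct (Rle_dec 0 y).
- rewrite Rabs_pos_eq by assumption. nra.
- assert (1 <= exp (Rabs y)) by (rewrite <- exp_0; apply exp_le_compat, Rabs_pos).
  assert (0 <= y ^ 2) by apply pow2_ge_0. nra.
Qed.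

(** A remainder O(d^2) is what integrating a pointwise Taylor estimate yields; this is how improper
    integrals are differentiated in their parameter. *)
Lemma is_derive_RC_quadratic (f : R -> C) (x M : R) (l : C) :
  (forall d, Rabs d <= 1 -> Cmod (f (x + d)%R - f x - RtoC d * l)%C <= M * d ^ 2) ->
  is_derive_RC f x l.
Proof.
intros H.
assert (M0 : 0 <= M).
{ specialize (H 1 ltac:(rewrite Rabs_R1; lra)).
  eapply Rle_trans in H; [|apply Cmod_ge_0]. lra. }
assert (Q : forall (p : C -> R), (forall u v, p (u - v)%C = p u - p v) ->
   (forall u, Rabs (p u) <= Cmod u) -> (forall (s : R) u, p (RtoC s * u)%C = s * p u) ->
   is_derive (fun s => p (f s)) x (p l)).
{ intros p p1 p2 p3. apply is_derive_Reals. intros eps He.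
  assert (Hd : 0 < Rmin 1 (eps / (M + 1))) by (apply Rmin_pos; [lra | apply Rdiv_lt_0_compat; lra]).
  exists (mkposreal _ Hd). intros d Hd0 Hd1. simpl in Hd1.
  assert (B1 := Rmin_l 1 (eps / (M + 1))). assert (B2 := Rmin_r 1 (eps / (M + 1))).
  specialize (H d ltac:(lra)).
  assert (P := Rabs_pos_lt d Hd0).
  apply Rmult_lt_reg_r with (Rabs d); [assumption|].
  rewrite <- Rabs_mult.
  replace ((_ - _) * d) with (p (f (x + d)%R - f x - RtoC d * l)%C)
    by (rewrite !p1, p3; field; assumption).
  eapply Rle_lt_trans; [apply p2|]. eapply Rle_lt_trans; [exact H|].
  rewrite <- pow2_abs.
  assert (W : Rabs d * (M + 1) < eps).
  { apply Rmult_lt_reg_r with (/ (M + 1)); [apply Rinv_0_lt_compat; lra|].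
    rewrite Rmult_assoc, Rinv_r by lra. unfold Rdiv in B2. lra. }
  nra. }
split; apply Q.
- intros; simpl; ring.
- apply Rabs_fst_le_Cmod.
- intros; simpl; ring.
- intros; simpl; ring.
- apply Rabs_snd_le_Cmod.
- intros; simpl; ring.
Qed.

Lemma moment_derive (a : R) (n : nat) (x : R) :
  is_derive_RC (moment a n) x (- moment a (S n) x)%C.
Proof.
(* For |d| <= 1 the Taylor remainder of e^{-dt} is at most d^2 t^2 e^t. The factor t^2 raises n to n
   + 2 and e^t shifts x to x - 1. *)
set (c := 4 * exp ((INR (S (S n)) + 1 - (x - 1)) ^ 2 / 2)).
assert (Hc : 0 < c) by (assert (P := exp_pos ((INR (S (S n)) + 1 - (x - 1)) ^ 2 / 2)); unfold c; lra).
apply is_derive_RC_quadratic with (M := 2 * c). intros d Hd.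
assert (I := is_CInt_0_infty_plus _ _ _ _
  (is_CInt_0_infty_plus _ _ _ _ (moment_correct a n (x + d))
     (is_CInt_0_infty_scal _ (- (1))%C _ (moment_correct a n x)))
  (is_CInt_0_infty_scal _ (RtoC d) _ (moment_correct a (S n) x))).
replace (moment a n (x + d) - moment a n x - RtoC d * - moment a (S n) x)%C
  with (moment a n (x + d) + - (1) * moment a n x + RtoC d * moment a (S n) x)%C by ring.
replace (2 * c * d ^ 2) with (2 * (c * d ^ 2)) by ring.
assert (P2 : 0 <= d ^ 2) by apply pow2_ge_0.
apply is_CInt_0_infty_weight_le with (1 := I).
- nra.
- apply (smooth_pos_plus (fun t => kernel a n (x + d) t + - (1) * kernel a n x t)%C
    (fun t => RtoC d * kernel a (S n) x t)%C).
  + apply (smooth_pos_plus (kernel a n (x + d)) (fun t => - (1) * kernel a n x t)%C);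
      [apply kernel_smooth | apply smooth_pos_scal, kernel_smooth].
  + apply smooth_pos_scal, kernel_smooth.
- intros t Ht.
  replace (_ + _)%C with (RtoC (exp (- (d * t)) - 1 - - (d * t)) * kernel a n x t)%C.
  2: { rewrite kernel_shift, kernel_S.
       rewrite !RtoC_minus, RtoC_opp, RtoC_mult. ring. }
  assert (B := Cmod_kernel_le a (S (S n)) (x - 1) t Ht). fold c in B.
  rewrite Cmod_mult, Cmod_R.
  assert (T := exp_taylor_1 (- (d * t))).
  rewrite Rabs_Ropp, Rabs_mult, (Rabs_pos_eq t) in T by lra.
  assert (K0 := Cmod_ge_0 (kernel a n x t)).
  apply Rle_trans with (d ^ 2 * (t ^ 2 * exp t * Cmod (kernel a n x t))).
  + replace (d ^ 2 * (t ^ 2 * exp t * Cmod (kernel a n x t)))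
      with (((- (d * t)) ^ 2 * exp t) * Cmod (kernel a n x t)) by ring.
    apply Rmult_le_compat_r; [assumption|]. eapply Rle_trans; [exact T|].
    apply Rmult_le_compat_l; [apply pow2_ge_0|]. apply exp_le_compat. nra.
  + replace (c * d ^ 2 * weight t) with (d ^ 2 * (c * weight t)) by ring.
    apply Rmult_le_compat_l; [assumption|]. eapply Rle_trans; [|exact B].
    right. rewrite !Cmod_kernel by assumption.
    replace (- (t * t / 2 + (x - 1) * t)) with (t + - (t * t / 2 + x * t)) by ring.
    rewrite exp_plus. simpl. ring.
Qed.

Lemma sqrt_lt_sqr (t r : R) : 0 < t -> 0 < r -> t < r ^ 2 -> sqrt t < r.
Proof.
intros Ht Hr H. rewrite <- (sqrt_pow2 r) by lra. apply sqrt_lt_1; [lra | apply pow2_ge_0 | lra].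
Qed.

(** Since [weight t] <= 1/(2 sqrt t), [kernel a 1 x t] is at most c0 (sqrt t)/2, useful near 0, and
    at most c1/(2 sqrt t), useful far out. The thresholds are read off these two bounds. *)
Lemma kernel_vanishes (a x eps : R) : 0 < eps -> exists d X, 0 < d /\
  forall t, 0 < t -> t < d \/ X < t -> Cmod (kernel a 1 x t) < eps.
Proof.
intros He.
set (c0 := 4 * exp ((INR 0 + 1 - x) ^ 2 / 2)). set (c1 := 4 * exp ((INR 1 + 1 - x) ^ 2 / 2)).
assert (H0 : 0 < c0) by (assert (P := exp_pos ((INR 0 + 1 - x) ^ 2 / 2)); unfold c0; lra).
assert (H1 : 0 < c1) by (assert (P := exp_pos ((INR 1 + 1 - x) ^ 2 / 2)); unfold c1; lra).
assert (D0 : 0 < eps / c0) by now apply Rdiv_lt_0_compat.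
assert (D1 : 0 < c1 / eps) by now apply Rdiv_lt_0_compat.
exists ((eps / c0) ^ 2), ((c1 / eps) ^ 2). split; [now apply pow_lt|].
intros t Ht Hd. assert (P := sqrt_lt_R0 t Ht). assert (S := sqrt_sqrt t ltac:(lra)).
assert (Wt : weight t <= / (2 * sqrt t)).
{ apply Rinv_le_contravar; [lra|]. nra. }
destruct Hd as [Hd|Hd].
- assert (Q := sqrt_lt_sqr t _ Ht D0 Hd).
  rewrite kernel_S, Cmod_mult, Cmod_R, Rabs_pos_eq by lra.
  assert (B := Cmod_kernel_le a 0 x t Ht). fold c0 in B.
  apply Rle_lt_trans with (t * (c0 * / (2 * sqrt t))).
  + apply Rmult_le_compat_l; [lra|]. eapply Rle_trans; [exact B|].
    apply Rmult_le_compat_l; lra.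
  + rewrite <- S at 1. replace (sqrt t * sqrt t * (c0 * / (2 * sqrt t))) with (c0 * sqrt t / 2)
      by (field; lra).
    apply Rmult_lt_compat_l with (r := c0) in Q; [|assumption].
    replace (c0 * (eps / c0)) with eps in Q by (field; lra). lra.
- assert (Q : c1 / eps < sqrt t).
  { rewrite <- (sqrt_pow2 (c1 / eps)) by lra. apply sqrt_lt_1; [apply pow2_ge_0 | lra | exact Hd]. }
  assert (B := Cmod_kernel_le a 1 x t Ht). fold c1 in B.
  apply Rle_lt_trans with (c1 * / (2 * sqrt t)).
  + eapply Rle_trans; [exact B|]. apply Rmult_le_compat_l; lra.
  + apply Rmult_lt_compat_l with (r := eps) in Q; [|assumption].
    replace (eps * (c1 / eps)) with c1 in Q by (field; lra).
    apply Rmult_lt_reg_r with (2 * sqrt t); [lra|].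
    rewrite Rmult_assoc, Rinv_l by lra. nra.
Qed.

(** The integral over the half-line of the derivative of [kernel a 1 x] vanishes. This relation
    turns into the differential equation of [laplace]. *)
Lemma moment_recurrence (a x : R) :
  (moment a 2 x = (Ci * RtoC a + / 2) * moment a 0 x - RtoC x * moment a 1 x)%C.
Proof.
set (G' := fun t => ((Ci * RtoC a - / 2 + RtoC (INR 1)) * kernel a 0 x t
      - kernel a 2 x t - RtoC x * kernel a 1 x t)%C).
assert (I : is_CInt_0_infty G'
   ((Ci * RtoC a - / 2 + RtoC (INR 1)) * moment a 0 x + - (1) * moment a 2 x
     + - RtoC x * moment a 1 x)%C).
{ apply is_CInt_0_infty_ext with
    (fun t => (Ci * RtoC a - / 2 + RtoC (INR 1)) * kernel a 0 x t + - (1) * kernel a 2 x t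
       + - RtoC x * kernel a 1 x t)%C.
  { intros t _. unfold G'. ring. }
  apply (is_CInt_0_infty_plus (fun t => (Ci * RtoC a - / 2 + RtoC (INR 1)) * kernel a 0 x t
     + - (1) * kernel a 2 x t)%C (fun t => - RtoC x * kernel a 1 x t)%C).
  - apply (is_CInt_0_infty_plus (fun t => (Ci * RtoC a - / 2 + RtoC (INR 1)) * kernel a 0 x t)%C
     (fun t => - (1) * kernel a 2 x t)%C); apply is_CInt_0_infty_scal, moment_correct.
  - apply is_CInt_0_infty_scal, moment_correct. }
assert (SG : smooth_pos G').
{ intros t Ht. destruct (kernel_smooth a 0 x t Ht), (kernel_smooth a 1 x t Ht),
    (kernel_smooth a 2 x t Ht).
  eexists. unfold G'. apply is_derive_RC_minus; [apply is_derive_RC_minus|].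
  - apply is_derive_RC_mult; [apply is_derive_RC_const | eassumption].
  - eassumption.
  - apply is_derive_RC_mult; [apply is_derive_RC_const | eassumption]. }
assert (Z := is_CInt_0_infty_derive (kernel a 1 x) G' _ (kernel_derive a 0 x) SG
  (kernel_vanishes a x) I).
simpl INR in Z.
replace (moment a 2 x) with (moment a 2 x + 0)%C by ring. rewrite <- Z.
assert (E2 : (- / 2 + 1)%C = (/ 2)%C) by field.
replace (Ci * RtoC a - / 2 + 1)%C with (Ci * RtoC a + / 2)%C; [ring|].
rewrite <- E2 at 1. ring.
Qed.

(* Up to the factor [Gamma (1/2 + ia)] this is [U (ia, x)] (DLMF 12.5.1). *)
Definition laplace (a x : R) : C := (RtoC (exp (- (x * x / 4))) * moment a 0 x)%C.

Definition laplace' (a x : R) : C :=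
  (RtoC (exp (- (x * x / 4))) * (- RtoC (x / 2) * moment a 0 x - moment a 1 x))%C.

Lemma gauss_derive (x : R) :
  is_derive_RC (fun x => RtoC (exp (- (x * x / 4)))) x (RtoC (- (x / 2) * exp (- (x * x / 4)))).
Proof.
apply (is_derive_RC_RtoC (fun x => exp (- (x * x / 4)))).
auto_derive; [trivial | unfold Rdiv; field].
Qed.

Lemma laplace_derive (a x : R) : is_derive_RC (laplace a) x (laplace' a x).
Proof.
unfold laplace, laplace'. eapply is_derive_RC_eq.
- apply is_derive_RC_mult; [apply gauss_derive | apply moment_derive].
- cbv beta. rewrite RtoC_mult, RtoC_opp. ring.
Qed.

Lemma laplace_ode (a x : R) : is_derive_RC (laplace' a) x
  ((RtoC x * RtoC x / 4 + Ci * RtoC a) * laplace a x)%C.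
Proof.
unfold laplace', laplace. eapply is_derive_RC_eq.
- apply is_derive_RC_mult; [apply gauss_derive|].
  apply is_derive_RC_minus; [|apply moment_derive].
  apply is_derive_RC_mult; [|apply moment_derive].
  apply is_derive_RC_opp. apply (is_derive_RC_RtoC (fun x => x / 2) x (/ 2)).
  auto_derive; [trivial | field].
- cbv beta. rewrite moment_recurrence, RtoC_mult, RtoC_opp, RtoC_div, RtoC_inv by lra.
  field.
Qed.

Lemma Cmod_recessive (a x : R) : 1 <= x -> Cmod (RtoC x * recessive a x) <= x * exp (- (x * x / 4)).
Proof.
intros Hx. rewrite Cmod_mult, Cmod_R, Rabs_pos_eq by lra.
apply Rmult_le_compat_l; [lra|]. unfold recessive. rewrite Cmod_Cexp. apply exp_le_compat.
assert (L : 0 <= ln x) by (rewrite <- ln_1; apply ln_le; lra).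
simpl. field_simplify; lra.
Qed.

(** By [wronskian_limit] this limit is the Wronskian of U(ia, .) and [laplace a]; that it vanishes
    makes the two proportional. *)
Lemma laplace_recessive (a : R) :
  tends_to (fun x => laplace a x * (RtoC x * recessive a x))%C 0.
Proof.
set (c := 4 * exp ((INR 0 + 1 - 0) ^ 2 / 2)).
assert (Hc : 0 < c) by (assert (P := exp_pos ((INR 0 + 1 - 0) ^ 2 / 2)); unfold c; lra).
apply tends_to_close with (1 := tends_to_const 0) (r := fun x => (2 * c) * exp (2 - x)) (X := 1).
{ apply tends_to_0_exp; lra. }
intros x Hx. replace (_ - 0)%C with (laplace a x * (RtoC x * recessive a x))%C by ring.
(* Uniform in x: for x > 0 the kernel is dominated by the one at x = 0. *)
assert (M : Cmod (moment a 0 x) <= 2 * c).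
{ apply is_CInt_0_infty_weight_le with (1 := moment_correct a 0 x);
    [lra | apply kernel_smooth |].
  intros t Ht. eapply Rle_trans; [|apply (Cmod_kernel_le a 0 0 t Ht)].
  rewrite !Cmod_kernel by assumption.
  apply Rmult_le_compat_r; [apply Rlt_le, exp_pos|].
  apply Rmult_le_compat_l; [simpl; lra|]. apply exp_le_compat. nra. }
assert (R1 := Cmod_recessive a x ltac:(lra)).
unfold laplace. rewrite !Cmod_mult, (Cmod_R (exp _)), Rabs_pos_eq by apply Rlt_le, exp_pos.
rewrite <- Cmod_mult.
apply Rle_trans with (exp (- (x * x / 4)) * (2 * c) * (x * exp (- (x * x / 4)))).
- apply Rmult_le_compat; [| apply Cmod_ge_0 | | exact R1].
  + apply Rmult_le_pos; [apply Rlt_le, exp_pos | apply Cmod_ge_0].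
  + apply Rmult_le_compat_l; [apply Rlt_le, exp_pos | exact M].
- replace (exp (- (x * x / 4)) * (2 * c) * (x * exp (- (x * x / 4))))
    with ((2 * c) * (x * (exp (- (x * x / 4)) * exp (- (x * x / 4))))) by ring.
  rewrite <- exp_plus. apply Rmult_le_compat_l; [lra|].
  apply Rle_trans with (exp x * exp (- (x * x / 4) + - (x * x / 4))).
  + apply Rmult_le_compat_r; [apply Rlt_le, exp_pos|].
    assert (X := exp_ineq1_le x). lra.
  + rewrite <- exp_plus. apply exp_le_compat.
    assert (0 <= (x - 2) ^ 2) by apply pow2_ge_0. nra.
Qed.

(** * The Gamma function as leading coefficient of the Laplace integral *)

Definition gamma_kernel (a x t : R) : C :=
  Cexp ((Ci * RtoC a - / 2) * RtoC (ln t) - RtoC (x * t))%C.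

Lemma gamma_kernel_smooth (a x : R) : smooth_pos (gamma_kernel a x).
Proof.
intros t Ht. eexists. apply is_derive_RC_Cexp, is_derive_RC_minus.
- apply is_derive_RC_mult; [apply is_derive_RC_const | apply is_derive_RC_RtoC].
  apply is_derive_Reals, derivable_pt_lim_ln, Ht.
- apply (is_derive_RC_RtoC (fun t => x * t) t x). auto_derive; [trivial | ring].
Qed.

Lemma Cmod_gamma_kernel (a x t : R) :
  Cmod (gamma_kernel a x t) = exp (- (x * t)) * exp (- (ln t / 2)).
Proof.
unfold gamma_kernel. rewrite Cmod_Cexp, <- exp_plus. f_equal. simpl. field.
Qed.

Lemma gamma_correct (a : R) :
  is_CInt_0_infty (gamma_kernel a 1) (Cgamma (/ 2 + Ci * RtoC a)).
Proof.
destruct (is_CInt_0_infty_weight (gamma_kernel a 1) (4 * exp 0)) as (l & I & _).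
- rewrite exp_0; lra.
- apply gamma_kernel_smooth.
- intros t Ht. rewrite Cmod_gamma_kernel. apply weight_dominates; [assumption|].
  right. f_equal. ring.
- assert (I' : is_CInt_0_infty
     (fun t => Cexp ((/ 2 + Ci * RtoC a - 1) * RtoC (ln t)) * RtoC (exp (- t)))%C l).
  { apply is_CInt_0_infty_ext with (2 := I). intros t _. unfold gamma_kernel.
    rewrite <- Cexp_RtoC, <- Cexp_add. f_equal.
    apply injective_projections; simpl; field. }
  unfold Cgamma. now rewrite (is_CInt_0_infty_CRInt_gen _ _ I').
Qed.

(** The substitution t -> x t in Euler's integral. The integrand becomes that of [moment a 0 x]
    without its Gaussian factor, times x^{ia+1/2}. *)
Lemma gamma_scaled (a x : R) : 0 < x ->
  is_CInt_0_infty (fun t => Cexp ((Ci * RtoC a + / 2) * RtoC (ln x)) * gamma_kernel a x t)%C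
    (Cgamma (/ 2 + Ci * RtoC a)).
Proof.
intros Hx.
apply is_CInt_0_infty_ext with (2 := is_CInt_0_infty_scale _ x _ Hx (gamma_correct a)).
intros t Ht. unfold gamma_kernel.
replace (RtoC x) with (Cexp (RtoC (ln x))) by (now rewrite Cexp_RtoC, exp_ln).
rewrite <- !Cexp_add, ln_mult by assumption. f_equal.
apply injective_projections; simpl; field.
Qed.

Lemma one_minus_exp_bound (y : R) : 0 <= y -> Rabs (exp (- y) - 1) <= y.
Proof.
intros Hy. assert (H := exp_ineq1_le (- y)).
assert (exp (- y) <= 1) by (rewrite <- exp_0; apply exp_le_compat; lra).
rewrite Rabs_left1; lra.
Qed.

Lemma sqr_le_exp (u : R) : 0 <= u -> u ^ 2 <= 16 * exp (u / 2).
Proof.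
intros Hu. assert (H := exp_ineq1_le (u / 4)).
replace (exp (u / 2)) with (exp (u / 4) * exp (u / 4)).
- nra.
- rewrite <- exp_plus. f_equal. field.
Qed.

(** Watson's lemma: the quotient is x^{ia+1/2} [moment a 0 x], and dropping e^{-t^2/2} costs at most
    t^2/2 relative to an integrand concentrated at t of order 1/x. *)
Lemma laplace_gamma (a : R) :
  tends_to (fun x => laplace a x / recessive a x)%C (Cgamma (/ 2 + Ci * RtoC a)).
Proof.
apply tends_to_close with (1 := tends_to_const _) (r := fun x => 64 / x) (X := 2).
{ apply tends_to_0_inv; lra. }
intros x Hx.
set (c := Cexp ((Ci * RtoC a + / 2) * RtoC (ln x))%C).
replace (laplace a x / recessive a x)%C with (c * moment a 0 x)%C.
2: { assert (N := recessive_neq_0 a x).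
     assert (E : (c * recessive a x)%C = RtoC (exp (- (x * x / 4)))).
     { unfold c, recessive. rewrite <- Cexp_RtoC, <- Cexp_add. f_equal.
       apply injective_projections; simpl; field. }
     unfold laplace. rewrite <- E. field. exact N. }
assert (Hc : Cmod c = exp (ln x / 2)).
{ unfold c. rewrite Cmod_Cexp. f_equal. simpl. field. }
assert (I := is_CInt_0_infty_plus _ _ _ _ (is_CInt_0_infty_scal _ c _ (moment_correct a 0 x))
  (is_CInt_0_infty_scal _ (- (1))%C _ (gamma_scaled a x ltac:(lra)))).
fold c in I. cbv beta in I.
replace (c * moment a 0 x - Cgamma (/ 2 + Ci * RtoC a))%C
  with (c * moment a 0 x + - (1) * Cgamma (/ 2 + Ci * RtoC a))%C by ring.
replace (64 / x) with (2 * (32 / x)) by (field; lra).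
apply is_CInt_0_infty_weight_le with (1 := I).
- apply Rlt_le, Rdiv_lt_0_compat; lra.
- apply (smooth_pos_plus (fun t => c * kernel a 0 x t)%C (fun t => - (1) * (c * gamma_kernel a x t))%C).
  + apply smooth_pos_scal, kernel_smooth.
  + apply smooth_pos_scal, smooth_pos_scal, gamma_kernel_smooth.
- intros t Ht.
  replace (_ + _)%C with (c * gamma_kernel a x t * RtoC (exp (- (t * t / 2)) - 1))%C.
  2: { replace (kernel a 0 x t) with (gamma_kernel a x t * RtoC (exp (- (t * t / 2))))%C.
       - rewrite RtoC_minus. ring.
       - unfold gamma_kernel, kernel. simpl pow. rewrite <- Cexp_RtoC, <- Cexp_add, Cmult_1_l.
         f_equal. apply injective_projections; simpl; field. }
  rewrite !Cmod_mult, Cmod_R, Hc, Cmod_gamma_kernel.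
  assert (T := one_minus_exp_bound (t * t / 2) ltac:(nra)).
  (* Scaled so that y <= e^{-t}: with sqrt x <= x one gets y <= ((x t)^2/16) e^{-xt} <= e^{-xt/2},
     and x > 2 finishes. *)
  set (y := x * (exp (ln x / 2) * exp (- (x * t)) * Rabs (exp (- (t * t / 2)) - 1)) / 8).
  replace (exp (ln x / 2) * (exp (- (x * t)) * exp (- (ln t / 2))) * Rabs (exp (- (t * t / 2)) - 1))
    with (8 / x * (y * exp (- (ln t / 2)))) by (unfold y; field; lra).
  replace (32 / x * weight t) with (8 / x * (4 * exp 0 * weight t))
    by (rewrite exp_0; field; lra).
  apply Rmult_le_compat_l; [apply Rlt_le, Rdiv_lt_0_compat; lra|].
  apply weight_dominates; [assumption|]. unfold y.
  assert (Ex : exp (ln x / 2) <= x).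
  { rewrite <- (exp_ln x) at 2 by lra. apply exp_le_compat.
    assert (0 <= ln x) by (rewrite <- ln_1; apply ln_le; lra). lra. }
  assert (S := sqr_le_exp (x * t) ltac:(nra)).
  assert (P1 := exp_pos (- (x * t))). assert (P2 := exp_pos (ln x / 2)).
  apply Rle_trans with (x * (x * exp (- (x * t)) * (t * t / 2)) / 8).
  + unfold Rdiv. apply Rmult_le_compat_r; [lra|]. apply Rmult_le_compat_l; [lra|].
    apply Rmult_le_compat; [nra | apply Rabs_pos | | exact T].
    apply Rmult_le_compat_r; lra.
  + apply Rle_trans with (exp (x * t / 2) * exp (- (x * t))).
    * replace (x * (x * exp (- (x * t)) * (t * t / 2)) / 8)
        with ((x * t) ^ 2 / 16 * exp (- (x * t))) by field.
      apply Rmult_le_compat_r; [lra|]. lra.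
    * rewrite <- exp_plus. apply exp_le_compat. nra.
Qed.

(* [(t/x)^{ia-1/2} e^{-(t-x)^2/2}]: the integrand of [laplace a (-x)] divided by its
   expected growth, which concentrates at [t = x]. *)
Definition laplace_peak (a x t : R) : C :=
  Cexp ((Ci * RtoC a - / 2) * RtoC (ln t - ln x) - RtoC ((t - x) ^ 2 / 2))%C.

(** The right-hand value is the quantity whose limit, by [wronskian_limit], is the Wronskian of
    U(ia, x) and [laplace a (- x)]. *)
Lemma laplace_peak_correct (a x : R) : 0 < x ->
  is_CInt_0_infty (laplace_peak a x) (laplace a (- x) * (RtoC x * recessive a x))%C.
Proof.
intros Hx.
replace (laplace a (- x) * (RtoC x * recessive a x))%C
  with (RtoC (exp (- (x * x / 4))) * (RtoC x * recessive a x) * moment a 0 (- x))%C.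
2: { unfold laplace. replace (- x * - x) with (x * x) by ring. ring. }
apply is_CInt_0_infty_ext with (2 := is_CInt_0_infty_scal _ _ _ (moment_correct a 0 (- x))).
intros t Ht. unfold laplace_peak, kernel, recessive. simpl pow. rewrite Cmult_1_l.
replace (RtoC x) with (Cexp (RtoC (ln x))) by (now rewrite Cexp_RtoC, exp_ln).
rewrite <- Cexp_RtoC, <- !Cexp_add. f_equal.
apply injective_projections; simpl; field.
Qed.

Lemma laplace_peak_smooth (a x : R) : smooth_pos (laplace_peak a x).
Proof.
intros t Ht. eexists. apply is_derive_RC_Cexp, is_derive_RC_minus.
- apply is_derive_RC_mult; [apply is_derive_RC_const|].
  apply (is_derive_RC_RtoC (fun t => ln t - ln x) t (/ t)).
  auto_derive; [assumption | field; lra].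
- apply (is_derive_RC_RtoC (fun t => (t - x) ^ 2 / 2) t (t - x)).
  auto_derive; [trivial | field].
Qed.

Lemma Cmod_cis_minus_1 (y : R) : Cmod (Cexp (0, y) - 1) <= 2 * Rabs y.
Proof.
assert (P : forall y, 0 <= y -> Cmod (Cexp (0, y) - 1) <= 2 * y).
{ intros z Hz.
  assert (E : forall s, (RtoC s * Ci)%C = (0, s)) by (intros; apply injective_projections; simpl; ring).
  assert (W := is_derive_RC_bound (fun s => Cexp (RtoC s * Ci)) (fun s => Ci * Cexp (RtoC s * Ci))%C
    (fun s => s) (fun _ => 1) 0 z Hz).
  cbv beta in W. rewrite !E in W.
  replace (Cexp (0, 0)) with (RtoC 1) in W by (symmetry; apply Cexp_0).
  rewrite Rminus_0_r in W. apply W.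
  - intros t _. eapply is_derive_RC_eq.
    + apply is_derive_RC_Cexp, is_derive_RC_mult; [apply is_derive_RC_id | apply is_derive_RC_const].
    + cbv beta; ring.
  - intros t _. apply (is_derive_id (K := R_AbsRing)).
  - intros t _. rewrite E, Cmod_mult, Cmod_Cexp. simpl. rewrite exp_0, Rmult_1_r.
    unfold Cmod; simpl. replace (0 * (0 * 1) + 1 * (1 * 1)) with 1 by ring. rewrite sqrt_1; lra. }
destruct (Rle_dec 0 y) as [H|H].
- rewrite Rabs_pos_eq by assumption. now apply P.
- rewrite Rabs_left by lra.
  replace (Cexp (0, y) - 1)%C with (- (Cexp (0, y) * (Cexp (0%R, (- y)%R) - 1)))%C.
  + rewrite Cmod_opp, Cmod_mult, Cmod_Cexp. simpl. rewrite exp_0, Rmult_1_l.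
    apply P; lra.
  + replace (RtoC 1) with (Cexp (0, y) * Cexp (0%R, (- y)%R))%C at 2.
    * ring.
    * rewrite <- Cexp_add. rewrite <- Cexp_0. f_equal. apply injective_projections; simpl; ring.
Qed.

(** For r >= 1/2 this is |e^{iy} - 1| <= 2|y| with |ln r| <= 2|r - 1|. For r < 1/2 the trivial bound
    2 is below 4|r - 1|, whence the summand 4. *)
Lemma Cmod_power_minus_1 (a r : R) : 0 < r ->
  Cmod (Cexp (0, a * ln r) - 1) <= (4 * Rabs a + 4) * Rabs (r - 1).
Proof.
intros Hr. assert (Pa := Rabs_pos a). assert (Pr := Rabs_pos (r - 1)).
destruct (Rle_dec (1 / 2) r) as [H|H].
- eapply Rle_trans; [apply Cmod_cis_minus_1|]. rewrite Rabs_mult.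
  assert (L : Rabs (ln r) <= 2 * Rabs (r - 1)).
  { assert (L1 := exp_ineq1_le (ln r)). rewrite exp_ln in L1 by assumption.
    assert (L2 := exp_ineq1_le (- ln r)). rewrite exp_Ropp, exp_ln in L2 by assumption.
    assert (L3 : / r - 1 <= 2 * Rabs (r - 1)).
    { apply Rmult_le_reg_r with r; [assumption|].
      replace ((/ r - 1) * r) with (1 - r) by (field; lra).
      assert (Q := Rle_abs (- (r - 1))). rewrite Rabs_Ropp in Q. nra. }
    assert (Q := Rle_abs (r - 1)).
    apply Rabs_le_between. lra. }
  nra.
- apply Rle_trans with 2.
  + eapply Rle_trans; [apply Cmod_triangle|]. rewrite Cmod_opp, Cmod_1, Cmod_Cexp.
    simpl. rewrite exp_0; lra.
  + rewrite (Rabs_left (r - 1)) by lra. nra.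
Qed.

(** Trades the Gaussian for a majorant whose primitive is the arctangent, via (1 + s^2/4)^2 <=
    e^{s^2/2}. *)
Lemma gauss_le_cauchy (s : R) : Rabs s * exp (- (s ^ 2 / 2)) <= 4 * / (1 + s ^ 2).
Proof.
assert (P := Rabs_pos s). rewrite <- (pow2_abs s). set (r := Rabs s) in *.
assert (E := exp_ineq1_le (r ^ 2 / 4)).
assert (Q : (1 + r ^ 2 / 4) ^ 2 <= exp (r ^ 2 / 2)).
{ replace (exp (r ^ 2 / 2)) with (exp (r ^ 2 / 4) ^ 2).
  - apply pow_incr. nra.
  - replace (exp (r ^ 2 / 4) ^ 2) with (exp (r ^ 2 / 4) * exp (r ^ 2 / 4)) by ring.
    rewrite <- exp_plus. f_equal. field. }
rewrite exp_Ropp.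
assert (X := exp_pos (r ^ 2 / 2)).
apply Rmult_le_reg_r with (exp (r ^ 2 / 2) * (1 + r ^ 2)); [nra|].
replace (r * / exp (r ^ 2 / 2) * (exp (r ^ 2 / 2) * (1 + r ^ 2))) with (r * (1 + r ^ 2))
  by (field; lra).
replace (4 * / (1 + r ^ 2) * (exp (r ^ 2 / 2) * (1 + r ^ 2))) with (4 * exp (r ^ 2 / 2))
  by (field; nra).
assert (0 <= (r ^ 2 / 2 - r) ^ 2) by apply pow2_ge_0.
assert (0 <= (r - 1) ^ 2) by apply pow2_ge_0. nra.
Qed.

Lemma exp_half_ln (x : R) : 0 < x -> exp (ln x / 2) = sqrt x.
Proof.
intros Hx. assert (P := sqrt_lt_R0 x Hx).
rewrite <- (Rinv_inv (sqrt x)), <- exp_neg_half_ln, <- exp_Ropp by assumption.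
f_equal; ring.
Qed.

Lemma laplace_peak_factor (a x t : R) : 0 < x -> 0 < t ->
  laplace_peak a x t = (Cexp (0%R, (a * ln (t / x))%R) * laplace_peak 0 x t)%C.
Proof.
intros Hx Ht. unfold laplace_peak. rewrite <- Cexp_add, ln_div by assumption. f_equal.
apply injective_projections; simpl; field.
Qed.

Lemma Cmod_laplace_peak_0 (x t : R) : 0 < x -> 0 < t ->
  Cmod (laplace_peak 0 x t) = sqrt x * / sqrt t * exp (- ((t - x) ^ 2 / 2)).
Proof.
intros Hx Ht. unfold laplace_peak.
rewrite Cmod_Cexp, <- exp_half_ln, <- exp_neg_half_ln, <- !exp_plus by assumption.
f_equal. simpl. field.
Qed.

(** The parameter enters the integrand only through (t/x)^{ia}, which is close to 1 at the peak t =
    x. The error is O(x^{-1/2}), so the limit for a is the one for 0. *)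
Lemma laplace_peak_difference (a x : R) : 0 < x ->
  Cmod (laplace a (- x) * (RtoC x * recessive a x)
        - laplace 0 (- x) * (RtoC x * recessive 0 x))%C
    <= 2 * ((4 * Rabs a + 4) / sqrt x * (32 + 4 * PI)).
Proof.
intros Hx. assert (Px := sqrt_lt_R0 x Hx). assert (Sx := sqrt_sqrt x ltac:(lra)).
set (c := 4 * Rabs a + 4).
assert (Hc : 0 < c) by (assert (Q := Rabs_pos a); unfold c; lra).
assert (Hcx : 0 < c / sqrt x) by now apply Rdiv_lt_0_compat.
assert (I := is_CInt_0_infty_plus _ _ _ _ (laplace_peak_correct a x Hx)
  (is_CInt_0_infty_scal _ (- (1))%C _ (laplace_peak_correct 0 x Hx))).
match goal with |- Cmod ?z <= _ =>
  replace z with (laplace a (- x) * (RtoC x * recessive a x) +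
    - (1) * (laplace 0 (- x) * (RtoC x * recessive 0 x)))%C by ring end.
apply is_CInt_0_infty_norm_le with (1 := I)
  (H := fun t => c / sqrt x * (32 * weight_primitive t + 4 * atan (t - x)))
  (h := fun t => c / sqrt x * (32 * weight t + 4 * / (1 + (t - x) ^ 2))).
- apply (smooth_pos_plus (laplace_peak a x) (fun t => - (1) * laplace_peak 0 x t)%C).
  + apply laplace_peak_smooth.
  + apply smooth_pos_scal, laplace_peak_smooth.
- intros t Ht. apply is_derive_scal, (is_derive_plus (V := R_NormedModule)); apply is_derive_scal.
  + now apply weight_derive.
  + auto_derive; [trivial | field].
    assert (0 <= (t - x) ^ 2) by apply pow2_ge_0. lra.
- intros t Ht. assert (Pt := sqrt_lt_R0 t Ht). assert (St := sqrt_sqrt t ltac:(lra)).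
  rewrite (laplace_peak_factor a x t Hx Ht).
  replace (_ + _)%C with ((Cexp (0%R, (a * ln (t / x))%R) - 1) * laplace_peak 0 x t)%C by ring.
  rewrite Cmod_mult, Cmod_laplace_peak_0 by assumption.
  assert (T := Cmod_power_minus_1 a (t / x) (Rdiv_lt_0_compat _ _ Ht Hx)). fold c in T.
  replace (t / x - 1) with ((t - x) / x) in T by (field; lra).
  unfold Rdiv in T at 2. rewrite Rabs_mult, (Rabs_pos_eq (/ x)) in T
    by (apply Rlt_le, Rinv_0_lt_compat; lra).
  set (s := t - x) in *.
  apply Rle_trans with (c * (Rabs s * / x) * (sqrt x * / sqrt t * exp (- (s ^ 2 / 2)))).
  + apply Rmult_le_compat_r; [|exact T]. apply Rmult_le_pos; [|apply Rlt_le, exp_pos].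
    apply Rlt_le, Rmult_lt_0_compat; [lra | now apply Rinv_0_lt_compat].
  + replace (c * (Rabs s * / x) * (sqrt x * / sqrt t * exp (- (s ^ 2 / 2))))
      with (c / sqrt x * (Rabs s * exp (- (s ^ 2 / 2)) * / sqrt t)).
    2: { replace (/ x) with (/ sqrt x * / sqrt x) by (rewrite <- Rinv_mult, Sx; reflexivity).
         field. lra. }
    apply Rmult_le_compat_l; [lra|].
    assert (G := gauss_le_cauchy s). assert (W := weight_pos t Ht).
    assert (Ps : 0 < / (1 + s ^ 2)).
    { apply Rinv_0_lt_compat. assert (0 <= s ^ 2) by apply pow2_ge_0. lra. }
    assert (P0 : 0 <= Rabs s * exp (- (s ^ 2 / 2))).
    { apply Rmult_le_pos; [apply Rabs_pos | apply Rlt_le, exp_pos]. }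
    assert (Pi : 0 < / sqrt t) by now apply Rinv_0_lt_compat.
    (* For t <= 1 the singular 1/sqrt t is at most 8 [weight t] and the Gaussian factor at most 4,
       which gives 32. For t > 1 it is below 1 and the arctangent majorant takes over, of mass 4
       pi. *)
    destruct (Rle_dec t 1) as [H1|H1].
    * assert (Ps4 : / (1 + s ^ 2) <= 1).
      { rewrite <- Rinv_1 at 2. apply Rinv_le_contravar; [lra|].
        assert (0 <= s ^ 2) by apply pow2_ge_0. lra. }
      assert (W8 : / sqrt t <= 8 * weight t).
      { unfold weight. apply Rmult_le_reg_r with (2 * sqrt t * (1 + sqrt t) ^ 2); [nra|].
        replace (/ sqrt t * (2 * sqrt t * (1 + sqrt t) ^ 2)) with (2 * (1 + sqrt t) ^ 2)
          by (field; lra).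
        rewrite Rmult_assoc, Rinv_l by nra.
        assert (sqrt t <= 1) by nra. nra. }
      apply Rle_trans with (4 * (8 * weight t)); [|lra].
      apply Rmult_le_compat; lra.
    * assert (Q : / sqrt t <= 1).
      { rewrite <- Rinv_1. apply Rinv_le_contravar; [lra|]. nra. }
      nra.
- intros s t Hs Hst.
  assert (W := weight_primitive_bound s t Hs Hst).
  assert (B1 := atan_bound (t - x)). assert (B2 := atan_bound (s - x)).
  rewrite <- Rmult_minus_distr_l. apply Rmult_le_compat_l; lra.
Qed.

(** For a = 0 the integrand is real and positive. On [x - 1, x] it is at least e^{-1/2}, since there
    (x/t)^{1/2} >= 1 and (t - x)^2 <= 1. *)
Lemma laplace_peak_0_real (x : R) : 2 < x ->
  snd (laplace 0 (- x) * (RtoC x * recessive 0 x))%C = 0 /\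
  exp (- (1 / 2)) <= fst (laplace 0 (- x) * (RtoC x * recessive 0 x))%C.
Proof.
intros Hx.
assert (E : forall t, laplace_peak 0 x t = RtoC (exp (- ((ln t - ln x) / 2) - (t - x) ^ 2 / 2))).
{ intros t. rewrite <- Cexp_RtoC. unfold laplace_peak. f_equal.
  apply injective_projections; simpl; field. }
destruct (laplace_peak_correct 0 x ltac:(lra)) as [I1 I2].
split.
- apply (is_RInt_0_infty_unique (fun _ => 0)).
  + apply is_RInt_0_infty_ext with (2 := I2). intros t _. now rewrite E.
  + set (l := snd _) in I2.
    (* The integral of 0 is obtained as 0 times the integral at hand. *)
    apply (eq_ind (0 * l) (fun z : R => is_RInt_0_infty (fun _ => 0) z)); [|apply Rmult_0_l].
    apply is_RInt_0_infty_ext with (2 := is_RInt_gen_scal _ 0 _ I2).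
    intros t _. apply Rmult_0_l.
- replace (exp (- (1 / 2))) with (exp (- (1 / 2)) * (x - (x - 1))) by ring.
  apply is_RInt_0_infty_lower_bound with (1 := I1).
  + intros t Ht. destruct (laplace_peak_smooth 0 x t Ht) as [l Hl].
    exact (is_derive_RC_fst_continuous _ _ _ Hl).
  + intros t _. rewrite E. apply Rlt_le, exp_pos.
  + lra.
  + intros t Ht. rewrite E. apply exp_le_compat.
    assert (ln t <= ln x) by (apply ln_le; lra). nra.
Qed.

Lemma tends_to_real_lower_bound (f : R -> C) (l : C) (c X : R) :
  tends_to f l -> (forall x, X < x -> snd (f x) = 0 /\ c <= fst (f x)) ->
  exists w, c <= w /\ l = RtoC w.
Proof.
intros H B. exists (fst l).
assert (Q : forall eps, 0 < eps -> Rabs (snd l) < eps /\ c <= fst l + eps).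
{ intros eps He. destruct (H eps He) as [Y HY].
  assert (M1 := Rmax_l X Y). assert (M2 := Rmax_r X Y).
  set (x := Rmax X Y + 1). specialize (HY x ltac:(unfold x; lra)).
  destruct (B x ltac:(unfold x; lra)) as [B1 B2].
  assert (H1 := Rabs_fst_le_Cmod (f x - l)%C). assert (H2 := Rabs_snd_le_Cmod (f x - l)%C).
  simpl in H1, H2. rewrite B1 in H2.
  replace (0 + - snd l) with (- snd l) in H2 by ring. rewrite Rabs_Ropp in H2.
  assert (H3 := Rle_abs (fst (f x) + - fst l)). split; lra. }
split.
- apply Rle_plus_epsilon. intros eps He. now apply Q.
- apply injective_projections; [reflexivity|]. simpl. apply cond_eq. intros eps He.
  rewrite Rminus_0_r. now apply Q.
Qed.

Lemma is_derive_RC_reflect (f : R -> C) (x : R) (l : C) :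
  is_derive_RC f (- x) l -> is_derive_RC (fun t => f (- t)%R) x (- l)%C.
Proof.
assert (Q : forall (p : R -> R) (k : R), is_derive p (- x) k -> is_derive (fun t => p (- t)) x (- k)).
{ intros p k H. replace (- k) with (scal (-1) k) by (unfold scal; simpl; unfold mult; simpl; ring).
  apply (is_derive_comp p (fun t => - t)); [exact H|]. auto_derive; [trivial | ring]. }
intros [H1 H2]; split.
- exact (Q _ _ H1).
- exact (Q _ _ H2).
Qed.

(** Proportionality follows from the zero Wronskian with u. Division by u is avoided by means of
    v(x) = U(-ia, ix), whose Wronskian k with u is not 0: both V k = m u and V' k = m u' are
    polynomial identities. Comparing leading terms gives m = Gamma(1/2 + ia) k. *)
Lemma laplace_PCF (U : C -> C -> C) (a : R) (U' : C -> C) :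
  is_PCF_U U -> PCF_derivative U (Ci * RtoC a) U' ->
  laplace a 0 = (Cgamma (/ 2 + Ci * RtoC a) * U (Ci * RtoC a) 0)%C /\
  laplace' a 0 = (Cgamma (/ 2 + Ci * RtoC a) * U' 0)%C.
Proof.
intros HU DU.
destruct (HU (Ci * RtoC (- a))%C) as [(V' & DV) _].
assert (K := PCF_wronskian U a 1 U' V' HU (or_introl eq_refl) DU DV).
set (k := Cexp _) in K. assert (Nk : k <> 0%C) by apply Cexp_neq_0.
set (q := fun x : R => (RtoC x * RtoC x / 4 + Ci * RtoC a)%C).
set (u := fun x : R => U (Ci * RtoC a)%C (RtoC x * 1)%C).
set (u' := fun x : R => (1 * U' (RtoC x * 1))%C).
set (v := fun x : R => U (Ci * RtoC (- a))%C (RtoC x * (0%R, 1%R))%C).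
set (v' := fun x : R => ((0%R, 1%R) * V' (RtoC x * (0%R, 1%R)))%C).
assert (Du : forall x, is_derive_RC u x (u' x)) by (intros; apply (PCF_ray_derive U _ 1 U' x DU)).
assert (Du' : forall x, is_derive_RC u' x (q x * u x)%C).
{ intros x. eapply is_derive_RC_eq; [apply (PCF_ray_derive U _ 1 U' x DU) | unfold q, u; field]. }
assert (Dv : forall x, is_derive_RC v x (v' x))
  by (intros; apply (PCF_ray_derive U _ (0%R, 1%R) V' x DV)).
assert (Dv' : forall x, is_derive_RC v' x (q x * v x)%C).
{ intros x. eapply is_derive_RC_eq; [apply (PCF_ray_derive U _ (0%R, 1%R) V' x DV)|].
  unfold q, v. f_equal. apply injective_projections; simpl; field. }
assert (R0 : wronskian u u' (laplace a) (laplace' a) 0 = 0%C).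
{ apply (tends_to_unique (fun x => laplace a x * (RtoC x * recessive a x))%C).
  - apply (wronskian_limit a q); auto; [apply laplace_derive | apply laplace_ode |].
    now apply PCF_recessive.
  - apply laplace_recessive. }
assert (Wl : forall x, wronskian (laplace a) (laplace' a) v v' x
   = wronskian (laplace a) (laplace' a) v v' 0).
{ intros x. apply (wronskian_const q); auto; [apply laplace_derive | apply laplace_ode]. }
assert (Wk : forall x, wronskian u u' v v' x = k).
{ intros x. rewrite (wronskian_const q u u' v v' Du Du' Dv Dv' x 0).
  rewrite <- K. unfold wronskian, u, u', v, v'. rewrite !Cmult_0_l, Cmult_1_l. reflexivity. }
assert (W0 : forall x, wronskian u u' (laplace a) (laplace' a) x = 0%C).
{ intros x. rewrite <- R0. apply (wronskian_const q); auto; [apply laplace_derive | apply laplace_ode]. }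
set (m := wronskian (laplace a) (laplace' a) v v' 0) in *.
assert (P1 : forall x, (laplace a x * k = u x * m)%C).
{ intros x. rewrite <- (Wk x), <- (Wl x).
  transitivity (u x * wronskian (laplace a) (laplace' a) v v' x
     + v x * wronskian u u' (laplace a) (laplace' a) x)%C.
  - unfold wronskian. ring.
  - rewrite W0. ring. }
assert (P2 : forall x, (laplace' a x * k = u' x * m)%C).
{ intros x. rewrite <- (Wk x), <- (Wl x).
  transitivity (u' x * wronskian (laplace a) (laplace' a) v v' x
     + v' x * wronskian u u' (laplace a) (laplace' a) x)%C.
  - unfold wronskian. ring.
  - rewrite W0. ring. }
assert (G : (Cgamma (/ 2 + Ci * RtoC a) * k = m)%C).
{ apply (tends_to_unique (fun x => laplace a x / recessive a x * k)%C).
  - apply tends_to_mult; [apply laplace_gamma | apply tends_to_const].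
  - assert (L := tends_to_mult _ _ _ _ (PCF_recessive U a HU) (tends_to_const m)).
    rewrite Cmult_1_l in L. apply tends_to_ext with (1 := L) (X := 0). intros x _.
    transitivity (laplace a x * k / recessive a x)%C.
    + field. apply recessive_neq_0.
    + rewrite P1. unfold u. field. apply recessive_neq_0. }
split.
- replace (laplace a 0) with (laplace a 0 * k / k)%C by (field; exact Nk).
  rewrite P1, <- G. unfold u. rewrite Cmult_0_l. field. exact Nk.
- replace (laplace' a 0) with (laplace' a 0 * k / k)%C by (field; exact Nk).
  rewrite P2, <- G. unfold u'. rewrite Cmult_0_l. field. exact Nk.
Qed.

(** The order of quantifiers matters: [PCF_values] uses the same w at a and at -a. Its value is
    sqrt(pi/2). *)
Lemma PCF_gamma (U : C -> C -> C) : is_PCF_U U -> exists w : R, 0 < w /\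
  forall a U', PCF_derivative U (Ci * RtoC a) U' ->
    (Cgamma (/ 2 + Ci * RtoC a) * (U (Ci * RtoC a) 0 * U' 0) = RtoC (- w))%C.
Proof.
intros HU.
assert (L : forall a U', PCF_derivative U (Ci * RtoC a) U' ->
  tends_to (fun x => laplace a (- x) * (RtoC x * recessive a x))%C
    (- (2) * (Cgamma (/ 2 + Ci * RtoC a) * (U (Ci * RtoC a) 0 * U' 0)))%C).
{ intros a U' DU.
  set (q := fun x : R => (RtoC x * RtoC x / 4 + Ci * RtoC a)%C).
  set (u := fun x : R => U (Ci * RtoC a)%C (RtoC x * 1)%C).
  set (u' := fun x : R => (1 * U' (RtoC x * 1))%C).
  destruct (laplace_PCF U a U' HU DU) as [E1 E2].
  replace (- (2) * (Cgamma (/ 2 + Ci * RtoC a) * (U (Ci * RtoC a) 0 * U' 0)))%C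
    with (wronskian u u' (fun x => laplace a (- x)) (fun x => - laplace' a (- x)%R)%C 0).
  - apply (wronskian_limit a q).
    + intros x; apply (PCF_ray_derive U _ 1 U' x DU).
    + intros x. eapply is_derive_RC_eq;
        [apply (PCF_ray_derive U _ 1 U' x DU) | unfold q, u; field].
    + intros x. apply is_derive_RC_reflect, laplace_derive.
    + intros x. eapply is_derive_RC_eq.
      * apply is_derive_RC_opp, (is_derive_RC_reflect (laplace' a)), laplace_ode.
      * unfold q. rewrite RtoC_opp. field.
    + now apply PCF_recessive.
  - unfold wronskian, u, u'. rewrite Ropp_0, E1, E2, Cmult_0_l. ring. }
destruct (HU (Ci * RtoC 0)%C) as [(V' & DV) _].
assert (L0 := L 0 V' DV).
destruct (tends_to_real_lower_bound _ _ _ 2 L0 laplace_peak_0_real) as (w & Hw & Ew).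
assert (Pw := exp_pos (- (1 / 2))).
exists (w / 2); split; [lra|]. intros a U' DU.
assert (La := L a U' DU).
assert (La0 : tends_to (fun x => laplace a (- x) * (RtoC x * recessive a x))%C (RtoC w)).
{ rewrite Ew in L0.
  set (c := 2 * ((4 * Rabs a + 4) * (32 + 4 * PI))).
  assert (Hc : 0 < c).
  { assert (P1 := Rabs_pos a). assert (P2 := PI_RGT_0). unfold c.
    apply Rmult_lt_0_compat; [lra|]. apply Rmult_lt_0_compat; lra. }
  apply tends_to_close with (1 := L0) (r := fun x => c / sqrt x) (X := 0).
  - intros eps He. destruct (tends_to_0_inv c Hc eps He) as [X HX].
    exists (Rmax 0 X ^ 2). intros x Hx.
    assert (M1 := Rmax_l 0 X). assert (M2 := Rmax_r 0 X).
    apply HX. apply Rle_lt_trans with (1 := M2).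
    rewrite <- (sqrt_pow2 (Rmax 0 X)) by lra.
    assert (P0 : 0 <= Rmax 0 X ^ 2) by apply pow2_ge_0.
    apply sqrt_lt_1; lra.
  - intros x Hx. assert (Px := sqrt_lt_R0 x Hx).
    replace (c / sqrt x) with (2 * ((4 * Rabs a + 4) / sqrt x * (32 + 4 * PI)))
      by (unfold c; field; lra).
    now apply laplace_peak_difference. }
assert (F := tends_to_unique _ _ _ La La0).
replace (RtoC (- (w / 2))) with (- RtoC w / 2)%C
  by (apply injective_projections; simpl; field).
rewrite <- F. field.
Qed.

(** Changing a to -a conjugates the integrand of Euler's integral; in polar form the conjugate only
    flips the sign of phi. *)
Lemma Cgamma_conj (a phi r : R) :
  Cgamma (/ 2 + Ci * RtoC a) = (RtoC r * Cexp (0, phi))%C ->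
  Cgamma (/ 2 + Ci * RtoC (- a)) = (RtoC r * Cexp (0%R, (- phi)%R))%C.
Proof.
intros H. apply (is_CInt_0_infty_unique (gamma_kernel (- a) 1)); [apply gamma_correct|].
destruct (gamma_correct a) as [I1 I2]. rewrite H in I1, I2.
assert (E : forall t, gamma_kernel (- a) 1 t
   = (fst (gamma_kernel a 1 t), - snd (gamma_kernel a 1 t))).
{ intros t. unfold gamma_kernel.
  replace ((Ci * RtoC (- a) - / 2) * RtoC (ln t) - RtoC (1 * t))%C
    with (fst ((Ci * RtoC a - / 2) * RtoC (ln t) - RtoC (1 * t))%C,
          - snd ((Ci * RtoC a - / 2) * RtoC (ln t) - RtoC (1 * t))%C)
    by (apply injective_projections; simpl; field).
  set (z := (_ - _)%C). unfold Cexp; simpl. rewrite cos_neg, sin_neg.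
  f_equal; ring. }
split.
- replace (fst _) with (fst (RtoC r * Cexp (0, phi))%C).
  + apply is_RInt_0_infty_ext with (2 := I1). intros t _. now rewrite E.
  + simpl. rewrite cos_neg, sin_neg. ring.
- replace (snd _) with (- snd (RtoC r * Cexp (0, phi))%C).
  + apply is_RInt_0_infty_ext with (2 := is_RInt_gen_opp _ _ I2). intros t _. now rewrite E.
  + simpl. rewrite cos_neg, sin_neg. ring.
Qed.

(** The two module structures on C have the same norm, so the estimate carries over as it stands and
    only linearity is proved anew. The product rule [is_derive_mult] is stated for the second
    one. *)
Lemma is_C_derive_AbsRing (f : C -> C) (z l : C) :
  is_C_derive f z l <->
  is_derive (K := C_AbsRing) (V := AbsRing_NormedModule C_AbsRing) f z l.
Proof.
split; intros [_ H]; (split; [|exact H]).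
- apply (is_linear_scal_l (K := C_AbsRing) (V := AbsRing_NormedModule C_AbsRing)).
- apply (is_linear_scal_l (K := C_AbsRing) (V := C_NormedModule)).
Qed.

Lemma is_C_derive_mult (f g : C -> C) (z l m : C) :
  is_C_derive f z l -> is_C_derive g z m ->
  is_C_derive (fun w => f w * g w)%C z (l * g z + f z * m)%C.
Proof.
intros Hf Hg. apply is_C_derive_AbsRing.
apply (is_derive_mult (K := C_AbsRing) f g z l m);
  [now apply is_C_derive_AbsRing | now apply is_C_derive_AbsRing | exact Cmult_comm].
Qed.

Lemma is_C_derive_scale (f : C -> C) (z c e l : C) :
  is_C_derive f (z * e)%C l -> is_C_derive (fun w => c * f (w * e))%C z (c * e * l)%C.
Proof.
intros D. apply C_derive_eps. intros eps He.
assert (Pc := Cmod_ge_0 c). assert (Pe := Cmod_ge_0 e).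
assert (Pce : 0 <= Cmod c * Cmod e) by now apply Rmult_le_pos.
destruct (proj1 (C_derive_eps f (z * e)%C l) D (eps / (Cmod c * Cmod e + 1))) as (d & Hd & K).
{ apply Rdiv_lt_0_compat; lra. }
exists (d / (Cmod e + 1)); split; [apply Rdiv_lt_0_compat; lra|].
intros h Hh. assert (Ph := Cmod_ge_0 h).
assert (Hhe : Cmod (h * e)%C < d).
{ rewrite Cmod_mult.
  apply Rmult_lt_compat_r with (r := Cmod e + 1) in Hh; [|lra].
  replace (d / (Cmod e + 1) * (Cmod e + 1)) with d in Hh by (field; lra). nra. }
specialize (K _ Hhe).
replace (c * f ((z + h) * e) - c * f (z * e) - h * (c * e * l))%C
  with (c * (f (z * e + h * e) - f (z * e) - h * e * l))%C
  by (replace ((z + h) * e)%C with (z * e + h * e)%C by ring; ring).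
rewrite Cmod_mult. rewrite Cmod_mult in K.
apply Rle_trans with (Cmod c * (eps / (Cmod c * Cmod e + 1) * (Cmod h * Cmod e))).
- now apply Rmult_le_compat_l.
- replace (Cmod c * (eps / (Cmod c * Cmod e + 1) * (Cmod h * Cmod e)))
    with (eps * Cmod h * (Cmod c * Cmod e / (Cmod c * Cmod e + 1))) by (field; lra).
  rewrite <- (Rmult_1_r (eps * Cmod h)) at 2.
  apply Rmult_le_compat_l; [nra|].
  apply Rmult_le_reg_r with (Cmod c * Cmod e + 1); [lra|].
  unfold Rdiv; rewrite Rmult_assoc, Rinv_l; lra.
Qed.

Lemma tends_to_rescale (f : R -> C) (l : C) (c : R) :
  0 < c -> tends_to f l -> tends_to (fun x => f (c * x)) l.
Proof.
intros Hc H eps He. destruct (H eps He) as [X HX]. exists (X / c). intros x Hx.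
apply HX. replace X with (c * (X / c)) by (field; lra). now apply Rmult_lt_compat_l.
Qed.

(** * The functions W_0, W_3 and W *)

Definition cis (theta : R) : C := Cexp (0, theta).

Lemma cis_add (s t : R) : cis (s + t) = (cis s * cis t)%C.
Proof.
unfold cis. rewrite <- Cexp_add. f_equal. apply injective_projections; simpl; ring.
Qed.

Lemma cis_opp (t : R) : (cis t * cis (- t) = 1)%C.
Proof. rewrite <- cis_add, Rplus_opp_r. apply Cexp_0. Qed.

Lemma cis_PI2 : cis (PI / 2) = Ci.
Proof.
unfold cis. apply injective_projections; simpl; rewrite exp_0, ?cos_PI2, ?sin_PI2; ring.
Qed.

Lemma Wj0_eq (U : C -> C -> C) (a : R) (z : C) :
  Wj U 0 a z = U (Ci * RtoC a)%C (z * cis (- (PI / 4)))%C.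
Proof.
unfold Wj, cis. change (pow_n (K := R_Ring) (-1) 0) with 1. change (pow_n (K := C_Ring) (- Ci)%C 0) with (RtoC 1).
f_equal; ring.
Qed.

Lemma Wj3_eq (U : C -> C -> C) (a : R) (z : C) :
  Wj U 3 a z = U (Ci * RtoC (- a))%C (z * cis (PI / 4))%C.
Proof.
unfold Wj.
change (pow_n (K := R_Ring) (-1) 3) with ((-1) * ((-1) * ((-1) * 1))).
change (pow_n (K := C_Ring) (- Ci)%C 3) with ((- Ci) * ((- Ci) * ((- Ci) * 1)))%C.
(* Because (-i)^3 = i, the rotation is i e^{-pi i/4} = e^{pi i/4}. *)
replace (PI / 4) with (PI / 2 + - (PI / 4)) at 2 by field.
rewrite cis_add, cis_PI2. unfold cis.
f_equal; apply injective_projections; simpl; ring.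
Qed.

(** The first quantity is the Wronskian of W_0 and W_3. The second is the mixed term, and the last
    two are the pure terms, of the Wronskian of W(x) and W(-x) at 0. The equation for r comes from
    (u u')(v v') = (u v')(u' v). *)
Lemma PCF_values (U : C -> C -> C) (a phi : R) (U' V' : C -> C) :
  is_PCF_U U ->
  PCF_derivative U (Ci * RtoC a) U' -> PCF_derivative U (Ci * RtoC (- a)) V' ->
  Cgamma (/ 2 + Ci * RtoC a) = (RtoC (Cmod (Cgamma (/ 2 + Ci * RtoC a))) * cis phi)%C ->
  let p := exp (PI * a / 2) in
  let u := U (Ci * RtoC a)%C 0 in let u' := U' 0 in
  let v := U (Ci * RtoC (- a))%C 0 in let v' := V' 0 in
  (cis (PI / 4) * (u * v') - cis (- (PI / 4)) * (u' * v) = - Ci / RtoC p)%C /\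
  (cis (PI / 4) * (u * v') + cis (- (PI / 4)) * (u' * v) = - RtoC p)%C /\
  exists r : R, 0 < r /\ (2 * r * p) ^ 2 = 1 + exp (2 * PI * a) /\
    (cis phi * (u * u') = RtoC (- r))%C /\ (cis (- phi) * (v * v') = RtoC (- r))%C.
Proof.
intros HU DU DV HG p u u' v v'.
assert (Pp : 0 < p) by apply exp_pos.
assert (Np : RtoC p <> 0%C) by (intros E; apply RtoC_inj in E; lra).
set (e := cis (- (PI / 4))). set (e' := cis (PI / 4)).
assert (Eee : (e * e' = 1)%C) by (unfold e, e'; rewrite Cmult_comm; apply cis_opp).
assert (Ee' : (e' * e' = Ci)%C).
{ unfold e'. rewrite <- cis_add, <- cis_PI2. f_equal. field. }
assert (Ci2 : (Ci * Ci = - (1))%C) by (apply injective_projections; simpl; ring).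
assert (Ee : (e * e = - Ci)%C).
{ replace (e * e)%C with (- ((e * e') * (e * e')) * Ci)%C; [rewrite Eee; ring|].
  replace (- (e * e' * (e * e')) * Ci)%C with (- (e * e) * (e' * e') * Ci)%C by ring.
  rewrite Ee'. replace (- (e * e) * Ci * Ci)%C with (- (e * e) * (Ci * Ci))%C by ring.
  rewrite Ci2. ring. }
assert (K1 := PCF_wronskian U a 1 U' V' HU (or_introl eq_refl) DU DV).
assert (K2 := PCF_wronskian U a (-1) U' V' HU (or_intror eq_refl) DU DV).
fold u u' v v' in K1, K2.
replace (Cexp _) with (/ RtoC p * e)%C in K1.
2: { rewrite <- RtoC_inv by lra. unfold p, e, cis. rewrite <- exp_Ropp, <- Cexp_RtoC, <- Cexp_add.
     f_equal. apply injective_projections; simpl; field. }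
replace (Cexp _) with (RtoC p * e')%C in K2.
2: { unfold p, e', cis. rewrite <- Cexp_RtoC, <- Cexp_add.
     f_equal. apply injective_projections; simpl; field. }
replace (0, 1) with Ci in K1 by reflexivity.
replace (0, -1) with (- Ci)%C in K2 by (apply injective_projections; simpl; ring).
(* The Wronskians for sigma = 1 and sigma = -1 are two linear equations for the products u v' and u'
   v. *)
assert (A1 : (u' * v = - (/ RtoC p * e + RtoC p * e') / 2)%C).
{ rewrite <- K1, <- K2. field. }
assert (A2 : (u * v' = - Ci * (/ RtoC p * e - RtoC p * e') / 2)%C).
{ rewrite <- K1, <- K2.
  replace (- Ci * (u * (Ci * v') - u' * v - (u * (- Ci * v') - u' * v)) / 2)%C
    with (- (Ci * Ci) * (u * v'))%C by field.
  rewrite Ci2. ring. }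
split; [|split].
- rewrite A1, A2.
  transitivity ((- Ci * (/ RtoC p * (e * e') - RtoC p * (e' * e'))
     + (/ RtoC p * (e * e) + RtoC p * (e * e'))) / 2)%C; [field; exact Np|].
  rewrite Eee, Ee, Ee'.
  transitivity ((- (2) * Ci / RtoC p + RtoC p * (1 + Ci * Ci)) / 2)%C; [field; exact Np|].
  rewrite Ci2. field. exact Np.
- rewrite A1, A2.
  transitivity ((- Ci * (/ RtoC p * (e * e') - RtoC p * (e' * e'))
     - (/ RtoC p * (e * e) + RtoC p * (e * e'))) / 2)%C; [field; exact Np|].
  rewrite Eee, Ee, Ee'.
  transitivity (RtoC p * (Ci * Ci - 1) / 2)%C; [field; exact Np|].
  rewrite Ci2. field.
- destruct (PCF_gamma U HU) as (w & Hw & G).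
  assert (G1 := G a U' DU). assert (G2 := G (- a) V' DV).
  fold u u' in G1. fold v v' in G2.
  set (g := Cmod (Cgamma (/ 2 + Ci * RtoC a))) in *.
  rewrite (Cgamma_conj a phi g HG) in G2. rewrite HG in G1. fold (cis (- phi)) in G2.
  (* If Gamma(1/2 + ia) vanished, [G1] would read 0 = -w. *)
  assert (Hg : 0 < g).
  { destruct (Cmod_ge_0 (Cgamma (/ 2 + Ci * RtoC a))) as [H|H]; [exact H|].
    exfalso. unfold g in G1. rewrite <- H in G1.
    assert (E : RtoC (- w) = RtoC 0) by (rewrite <- G1; ring).
    apply RtoC_inj in E. lra. }
  assert (Ng : RtoC g <> 0%C) by (intros E; apply RtoC_inj in E; lra).
  exists (w / g).
  assert (F1 : (cis phi * (u * u') = RtoC (- (w / g)))%C).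
  { replace (- (w / g)) with (- w / g) by (field; lra). rewrite RtoC_div, <- G1 by lra.
    field. exact Ng. }
  assert (F2 : (cis (- phi) * (v * v') = RtoC (- (w / g)))%C).
  { replace (- (w / g)) with (- w / g) by (field; lra). rewrite RtoC_div, <- G2 by lra.
    field. exact Ng. }
  split; [now apply Rdiv_lt_0_compat|]. split; [|now split].
  apply RtoC_inj.
  replace (exp (2 * PI * a)) with (p * p * (p * p)).
  2: { unfold p. rewrite <- !exp_plus. f_equal. field. }
  transitivity (4 * (RtoC p * RtoC p) * (RtoC (- (w / g)) * RtoC (- (w / g))))%C.
  + rewrite <- !RtoC_mult. f_equal. field. lra.
  + rewrite <- F1 at 1. rewrite <- F2.
    transitivity (4 * (RtoC p * RtoC p) * (cis phi * cis (- phi)) * ((u' * v) * (u * v')))%C; [ring|].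
    rewrite cis_opp, A1, A2.
    transitivity ((Ci * (e * e) - Ci * (e' * e') * (RtoC p * RtoC p * (RtoC p * RtoC p))))%C;
      [field; exact Np|].
    rewrite Ee, Ee', RtoC_plus, !RtoC_mult.
    transitivity (- (Ci * Ci) * (1 + RtoC p * RtoC p * (RtoC p * RtoC p)))%C; [ring|].
    rewrite Ci2. ring.
Qed.

(** As r > 0, the square root in [kW] is 2 r p, so [kW a] = 2 r p - p^2, and (2 r p)^2 - p^4 = 1. *)
Lemma kW_eq (a r : R) : let p := exp (PI * a / 2) in
  0 < r -> (2 * r * p) ^ 2 = 1 + exp (2 * PI * a) ->
  0 < kW a /\ kW a * (p * p + 2 * r * p) = 1.
Proof.
intros p Hr H. assert (Pp : 0 < p) by apply exp_pos.
assert (E : exp (PI * a) = p * p) by (unfold p; rewrite <- exp_plus; f_equal; field).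
assert (E2 : exp (2 * PI * a) = p * p * (p * p)).
{ unfold p. rewrite <- !exp_plus. f_equal. field. }
unfold kW. rewrite <- H, sqrt_pow2 by nra. rewrite E. rewrite E2 in H.
assert (Q : 0 < 2 * r * p) by nra.
split; [|nra].
assert (p * p < 2 * r * p); [|lra].
apply Rsqr_incrst_0; [unfold Rsqr; nra | nra | lra].
Qed.

(** Multiplication by e^{-i theta} sends the direction e^{i theta} to horizontal rays and the
    positive axis to a diagonal, x going to y - iy or y + iy with y = x cos(pi/4). Both limits of
    [PCF_U_primitive] thus apply to one function. *)
Lemma PCF_rotated_primitive (U : C -> C -> C) (a theta : R) : is_PCF_U U ->
  theta = PI / 4 \/ theta = - (PI / 4) ->
  exists (P : C -> C) (L : C),
    (forall z, is_C_derive P z (U (Ci * RtoC a) (z * cis (- theta)))%C) /\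
    (forall z, tends_to (fun s => P (z + RtoC s * Cexp (0, theta))%C) L) /\
    tends_to (fun x => P (RtoC x)) L.
Proof.
intros HU Ht. destruct (PCF_U_primitive U a HU) as (P & L & DP & L1 & L2).
assert (Ec : (cis theta * cis (- theta) = 1)%C) by apply cis_opp.
exists (fun z => cis theta * P (z * cis (- theta)))%C, (cis theta * L)%C.
split; [|split].
- intros z.
  replace (U (Ci * RtoC a) (z * cis (- theta)))%C
    with (cis theta * cis (- theta) * U (Ci * RtoC a) (z * cis (- theta)))%C
    by (rewrite Ec; ring).
  apply is_C_derive_scale, DP.
- intros z. apply tends_to_mult; [apply tends_to_const|].
  apply tends_to_ext with (1 := L1 (z * cis (- theta))%C) (X := 0). intros s _. f_equal.
  fold (cis theta).
  replace ((z + RtoC s * cis theta) * cis (- theta))%C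
    with (z * cis (- theta) + RtoC s * (cis theta * cis (- theta)))%C by ring.
  rewrite Ec. ring.
- apply tends_to_mult; [apply tends_to_const|].
  assert (Pc : 0 < cos (PI / 4)).
  { rewrite cos_PI4. apply Rdiv_lt_0_compat; [lra | apply Rlt_sqrt2_0]. }
  assert (Es : sin (PI / 4) = cos (PI / 4)) by now rewrite sin_PI4, cos_PI4.
  destruct Ht; subst theta.
  + apply tends_to_ext with (1 := tends_to_rescale _ _ _ Pc (L2 (-1) (or_intror eq_refl)))
      (X := 0). intros x _. f_equal. unfold cis.
    apply injective_projections; simpl; rewrite exp_0, ?cos_neg, ?sin_neg, ?Es; ring.
  + apply tends_to_ext with (1 := tends_to_rescale _ _ _ Pc (L2 1 (or_introl eq_refl)))
      (X := 0). intros x _. f_equal. unfold cis. rewrite Ropp_involutive.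
    apply injective_projections; simpl; rewrite exp_0, ?Es; ring.
Qed.

Lemma PCF_rotated_derive (U : C -> C -> C) (b e : C) (U' : C -> C) (z : C) :
  PCF_derivative U b U' ->
  is_C_derive (fun w => U b (w * e))%C z (e * U' (z * e))%C.
Proof.
intros D. assert (E : forall w, U b (w * e)%C = (1 * U b (w * e))%C) by (intros; ring).
apply (is_derive_ext (K := C_AbsRing) (V := C_NormedModule) (fun w => (1 * U b (w * e))%C)).
- intros w. symmetry. apply E.
- replace (e * U' (z * e))%C with (1 * e * U' (z * e))%C by ring.
  apply is_C_derive_scale, D.
Qed.

Lemma W03_0_eq (U : C -> C -> C) (a : R) (z : C) :
  W03 U 0 a z =
   (Ci * RtoC (exp (PI * a / 2)) *
     (Wj U 3 a z * CInt_from_inf (PI / 4) (fun t => Wj U 0 a t) z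
      - Wj U 0 a z * CInt_from_inf (- (PI / 4)) (fun t => Wj U 3 a t) z))%C.
Proof.
assert (E : forall j, (fun t : C => (pow_n (K := C_Ring) t 0 * Wj U j a t)%C) = (fun t => Wj U j a t)).
{ intros j. apply functional_extensionality. intros t. exact (Cmult_1_l _). }
unfold W03. now rewrite !E.
Qed.

(* Pluecker's relation between the three solutions. *)
Lemma solution_decomposition (q f f' g g' y y' : R -> C) :
  (forall x, is_derive_RC f x (f' x)) -> (forall x, is_derive_RC f' x (q x * f x)%C) ->
  (forall x, is_derive_RC g x (g' x)) -> (forall x, is_derive_RC g' x (q x * g x)%C) ->
  (forall x, is_derive_RC y x (y' x)) -> (forall x, is_derive_RC y' x (q x * y x)%C) ->
  forall x, (y x * wronskian f f' g g' 0 =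
    wronskian y y' g g' 0 * f x + wronskian f f' y y' 0 * g x)%C.
Proof.
intros F F' G G' Y Y' x.
rewrite (wronskian_const q f f' g g' F F' G G' 0 x), (wronskian_const q y y' g g' Y Y' G G' 0 x),
  (wronskian_const q f f' y y' F F' Y Y' 0 x).
unfold wronskian. ring.
Qed.

(** * The connection coefficients and the identity for the Nield-Kuznetsov function *)

Local Open Scope C_scope.

Theorem theorem2p1 (U : C -> C -> C) (phi2 : R -> R) (a : R) :
  is_PCF_U U -> is_phi2 phi2 ->
  (* W_0^{(0,3)}(a, .) is entire, hence the analytic continuation of NhatW(a, .) *)
  (forall z : C, ex_derive (W03 U 0 a) z) /\
  (forall x : R, NhatW U phi2 a x = W03 U 0 a (RtoC x)) /\
  (forall z : C, W03 U 0 a z =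
     Ci * RtoC (exp (PI * a / 2)) *
     (Wj U 3 a z * CInt_from_inf (PI / 4) (fun t => Wj U 0 a t) z
      - Wj U 0 a z * CInt_from_inf (- (PI / 4)) (fun t => Wj U 3 a t) z)).
Proof.
intros HU (_ & _ & Hphi).
destruct (HU (Ci * RtoC a)) as [(U' & DU) _].
destruct (HU (Ci * RtoC (- a))) as [(V' & DV) _].
set (p := exp (PI * a / 2)).
set (e := cis (- (PI / 4))). set (e' := cis (PI / 4)).
destruct (PCF_rotated_primitive U a (PI / 4) HU (or_introl eq_refl)) as (PA & LA & DA & LA1 & LA2).
destruct (PCF_rotated_primitive U (- a) (- (PI / 4)) HU (or_intror eq_refl))
  as (PB & LB & DB & LB1 & LB2).
rewrite Ropp_involutive in DB.
assert (DW0 : forall z, is_C_derive (Wj U 0 a) z (e * U' (z * e))).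
{ intros z. apply (is_derive_ext (K := C_AbsRing) (V := C_NormedModule)
    (fun w => U (Ci * RtoC a) (w * e))).
  - intros w. symmetry. apply Wj0_eq.
  - now apply PCF_rotated_derive. }
assert (DW3 : forall z, is_C_derive (Wj U 3 a) z (e' * V' (z * e'))).
{ intros z. apply (is_derive_ext (K := C_AbsRing) (V := C_NormedModule)
    (fun w => U (Ci * RtoC (- a)) (w * e'))).
  - intros w. symmetry. apply Wj3_eq.
  - now apply PCF_rotated_derive. }
assert (DPA : forall z, is_C_derive PA z (Wj U 0 a z)) by (intros; rewrite Wj0_eq; apply DA).
assert (DPB : forall z, is_C_derive PB z (Wj U 3 a z)) by (intros; rewrite Wj3_eq; apply DB).
(* Once the contour integrals are increments of entire primitives, the function is visibly
   entire. *)
assert (HW03 : forall z, W03 U 0 a z =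
  Ci * RtoC p * (Wj U 3 a z * (PA z - LA) - Wj U 0 a z * (PB z - LB))).
{ intros z. rewrite W03_0_eq.
  assert (I1 : CInt_from_inf (PI / 4) (fun t => Wj U 0 a t) z = PA z - LA)
    by exact (CInt_from_inf_primitive (PI / 4) PA (Wj U 0 a) _ z LA DPA DW0 (LA1 z)).
  assert (I2 : CInt_from_inf (- (PI / 4)) (fun t => Wj U 3 a t) z = PB z - LB)
    by exact (CInt_from_inf_primitive (- (PI / 4)) PB (Wj U 3 a) _ z LB DPB DW3 (LB1 z)).
  rewrite I1, I2.
  reflexivity. }
split; [|split]; [| |intros z; apply W03_0_eq].
{ intros z. eexists.
  apply (is_derive_ext (K := C_AbsRing) (V := C_NormedModule)
    (fun z => Ci * RtoC p * (Wj U 3 a z * (PA z - LA) - Wj U 0 a z * (PB z - LB)))).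
  { intros w. symmetry. apply HW03. }
  assert (Dc : forall c : C, is_C_derive (fun _ : C => c) z (RtoC 0))
    by (intros; apply (is_derive_const (K := C_AbsRing) (V := C_NormedModule))).
  assert (Dm : forall (f g : C -> C) (l m : C), is_C_derive f z l -> is_C_derive g z m ->
    is_C_derive (fun w => f w - g w)%C z (l - m)%C).
  { intros f g l m. apply (is_derive_minus (K := C_AbsRing) (V := C_NormedModule)). }
  apply is_C_derive_mult; [apply Dc|].
  apply Dm; (apply is_C_derive_mult; [|apply Dm; [|apply Dc]]).
  - apply DW3. - apply DPA. - apply DW0. - apply DPB. }
intros x0.
assert (HG := PCF_values U a (phi2 a) U' V' HU DU DV (Hphi a)).
cbv zeta in HG. fold p e e' in HG.
set (u := U (Ci * RtoC a) 0) in *. set (u' := U' 0) in *.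
set (v := U (Ci * RtoC (- a)) 0) in *. set (v' := V' 0) in *.
destruct HG as (G1 & G2 & r & Hr & Hrp & G3 & G4).
destruct (kW_eq a r Hr Hrp) as [Pk Ek]. fold p in Ek.
set (rho := (phi2 a / 2 + PI / 8)%R).
set (c := RtoC (sqrt (kW a / 2) * exp (PI * a / 4))).
set (ep := cis rho). set (em := cis (- rho)).
assert (Epm : ep * em = 1) by apply cis_opp.
(* Squaring e^{i rho} doubles the half phase, and the pi/8 in rho cancels the rotation e^{-pi i/4}.
   What remains is the phase of Gamma(1/2 + ia). *)
assert (Ep : ep * ep * e = cis (phi2 a)).
{ unfold ep, e, rho. rewrite <- !cis_add. f_equal. field. }
assert (Em : em * em * e' = cis (- phi2 a)).
{ unfold em, e', rho. rewrite <- !cis_add. f_equal. field. }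
assert (Cc : c * c = RtoC (kW a / 2 * p)).
{ unfold c. rewrite <- RtoC_mult. f_equal.
  replace p with (exp (PI * a / 4) * exp (PI * a / 4))%R
    by (unfold p; rewrite <- exp_plus; f_equal; field).
  rewrite <- (sqrt_sqrt (kW a / 2)) at 3 by lra. ring. }
assert (Np : RtoC p <> 0).
{ intros E. apply RtoC_inj in E. generalize (exp_pos (PI * a / 2)). fold p. lra. }
set (A0 := fun x : R => Wj U 0 a (RtoC x)). set (B0 := fun x : R => Wj U 3 a (RtoC x)).
set (A1 := fun x : R => e * U' (RtoC x * e)). set (B1 := fun x : R => e' * V' (RtoC x * e')).
assert (Ee : e * e = - Ci).
{ unfold e. rewrite <- cis_add. replace (- (PI / 4) + - (PI / 4))%R with (- (PI / 2))%R by field.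
  unfold cis. apply injective_projections; simpl;
    rewrite exp_0, ?cos_neg, ?sin_neg, ?cos_PI2, ?sin_PI2; ring. }
assert (Ee' : e' * e' = Ci).
{ unfold e'. rewrite <- cis_add, <- cis_PI2. f_equal. field. }
assert (Ci2 : Ci * Ci = - (1)) by (apply injective_projections; simpl; ring).
set (q := fun x : R => RtoC a - RtoC x * RtoC x / 4).
assert (DA0 : forall x, is_derive_RC A0 x (A1 x)).
{ intros x. apply is_derive_RC_ext with (fun t => U (Ci * RtoC a) (RtoC t * e)).
  - intros t. unfold A0. now rewrite Wj0_eq.
  - apply (PCF_ray_derive U _ e U' x DU). }
assert (DA1 : forall x, is_derive_RC A1 x (q x * A0 x)).
{ intros x. eapply is_derive_RC_eq; [apply (PCF_ray_derive U _ e U' x DU)|].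
  unfold q, A0. rewrite Wj0_eq. fold e. f_equal.
  transitivity (RtoC x * RtoC x * ((e * e) * (e * e)) / 4 + (e * e) * Ci * RtoC a); [field|].
  rewrite Ee. transitivity (RtoC x * RtoC x * (Ci * Ci) / 4 - (Ci * Ci) * RtoC a); [field|].
  rewrite Ci2. field. }
assert (DB0 : forall x, is_derive_RC B0 x (B1 x)).
{ intros x. apply is_derive_RC_ext with (fun t => U (Ci * RtoC (- a)) (RtoC t * e')).
  - intros t. unfold B0. now rewrite Wj3_eq.
  - apply (PCF_ray_derive U _ e' V' x DV). }
assert (DB1 : forall x, is_derive_RC B1 x (q x * B0 x)).
{ intros x. eapply is_derive_RC_eq; [apply (PCF_ray_derive U _ e' V' x DV)|].
  unfold q, B0. rewrite Wj3_eq. fold e'. f_equal.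
  transitivity (RtoC x * RtoC x * ((e' * e') * (e' * e')) / 4 + (e' * e') * Ci * RtoC (- a)); [field|].
  rewrite Ee', RtoC_opp.
  transitivity (RtoC x * RtoC x * (Ci * Ci) / 4 - (Ci * Ci) * RtoC a); [field|].
  rewrite Ci2. field. }
assert (HW : forall x, W U phi2 a (RtoC x) = c * (ep * A0 x + em * B0 x)).
{ intros x. reflexivity. }
assert (HW' : (fun t : R => W U phi2 a (RtoC t)) = (fun t => c * (ep * A0 t + em * B0 t)))
  by (apply functional_extensionality; exact HW).
(* This is W(-x); it solves the same equation because [q] is even. *)
set (y := fun x : R => c * (ep * A0 (- x)%R + em * B0 (- x)%R)).
set (y' := fun x : R => c * (ep * - A1 (- x)%R + em * - B1 (- x)%R)).
assert (Dlin : forall (f g f' g' : R -> C) t, is_derive_RC f t (f' t) -> is_derive_RC g t (g' t) ->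
   forall k l m, is_derive_RC (fun t => k * (l * f t + m * g t)) t (k * (l * f' t + m * g' t))).
{ intros f g f' g' t Df Dg k l m. eapply is_derive_RC_eq.
  - apply is_derive_RC_mult; [apply is_derive_RC_const|].
    apply is_derive_RC_plus; (apply is_derive_RC_mult; [apply is_derive_RC_const | eassumption]).
  - cbv beta; ring. }
assert (Dy : forall x, is_derive_RC y x (y' x)).
{ intros x. apply (Dlin (fun t => A0 (- t)%R) (fun t => B0 (- t)%R)
    (fun t => - A1 (- t)%R) (fun t => - B1 (- t)%R));
    apply is_derive_RC_reflect; [apply DA0 | apply DB0]. }
assert (Dy' : forall x, is_derive_RC y' x (q x * y x)).
{ intros x. eapply is_derive_RC_eq.
  - apply (Dlin (fun t => - A1 (- t)%R) (fun t => - B1 (- t)%R)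
      (fun t => - - (q (- t)%R * A0 (- t)%R)) (fun t => - - (q (- t)%R * B0 (- t)%R)));
      apply is_derive_RC_opp;
      [apply (is_derive_RC_reflect A1), DA1 | apply (is_derive_RC_reflect B1), DB1].
  - unfold y, q. rewrite RtoC_opp. field. }
assert (Z : forall w : C, RtoC 0 * w = 0) by (intros; ring).
assert (VA0 : A0 0%R = u) by (unfold A0; rewrite Wj0_eq, Z; reflexivity).
assert (VB0 : B0 0%R = v) by (unfold B0; rewrite Wj3_eq, Z; reflexivity).
assert (VA1 : A1 0%R = e * u') by (unfold A1; rewrite Z; reflexivity).
assert (VB1 : B1 0%R = e' * v') by (unfold B1; rewrite Z; reflexivity).
(* Up to the factor 1/k, the coordinates of W(-x) in the basis W_0, W_3. *)
set (m1 := wronskian y y' B0 B1 0). set (m2 := wronskian A0 A1 y y' 0).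
assert (K0 : wronskian A0 A1 B0 B1 0 = - Ci / RtoC p).
{ unfold wronskian. rewrite VA0, VB0, VA1, VB1, <- G1. ring. }
set (k := wronskian A0 A1 B0 B1 0) in *.
assert (Nk : k <> 0).
{ intros E. rewrite K0 in E. assert (E' : Ci = 0).
  { replace Ci with (- (- Ci / RtoC p) * RtoC p) by (field; exact Np). rewrite E. ring. }
  apply (f_equal snd) in E'. simpl in E'. lra. }
assert (Hy : forall x, y x = / k * (m1 * A0 x + m2 * B0 x)).
{ intros x. replace (y x) with (/ k * (y x * k)) by (field; exact Nk). f_equal.
  exact (solution_decomposition q A0 A1 B0 B1 y y' DA0 DA1 DB0 DB1 Dy Dy' x). }
assert (HWm : forall x, W U phi2 a (RtoC (- x)) = / k * (m1 * A0 x + m2 * B0 x)).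
{ intros x. rewrite HW. exact (Hy x). }
assert (HWm' : (fun t : R => W U phi2 a (RtoC (- t))) = (fun t => / k * (m1 * A0 t + m2 * B0 t)))
  by (apply functional_extensionality; exact HWm).
(* The left side is minus the Wronskian of W(x) and W(-x). At 0 it is 2 c^2 times a combination of
   the products in [PCF_values], namely -kW (p^2 + 2 r p), which [kW_eq] evaluates to -1. *)
assert (M : c * (em * m1 - ep * m2) = - (1)).
{ unfold m1, m2, wronskian, y, y'. rewrite Ropp_0, VA0, VB0, VA1, VB1.
  transitivity (2 * (c * c) * ((ep * em) * (e' * (u * v') + e * (u' * v))
     + ep * ep * e * (u * u') + em * em * e' * (v * v'))); [ring|].
  rewrite Epm, Ep, Em, G2, G3, G4, Cc.
  transitivity (RtoC (- (kW a * (p * p + 2 * r * p)))).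
  - apply injective_projections; simpl; field.
  - rewrite Ek. apply RtoC_opp. }
assert (DPline : forall (P f : C -> C), (forall z, is_C_derive P z (f z)) -> forall t,
  is_derive_RC (fun t => P (RtoC t)) t (f (RtoC t))).
{ intros P f D t. apply is_derive_RC_ext with (fun t => P (0 + RtoC t * 1)).
  - intros s. f_equal. ring.
  - eapply is_derive_RC_eq; [apply is_derive_RC_line, D|].
    replace (0 + RtoC t * 1) with (RtoC t) by ring. ring. }
assert (Int : forall k l m, CRInt_gen (fun t => k * (l * A0 t + m * B0 t)) (at_point x0)
   (Rbar_locally p_infty) = k * (l * LA + m * LB) - k * (l * PA (RtoC x0) + m * PB (RtoC x0))).
{ intros k1 l m.
  apply (tends_to_RInt_gen (fun t => k1 * (l * PA (RtoC t) + m * PB (RtoC t)))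
    (fun t => k1 * (l * A0 t + m * B0 t)) (fun t => k1 * (l * A1 t + m * B1 t))).
  - intros t. apply (Dlin (fun t => PA (RtoC t)) (fun t => PB (RtoC t)) A0 B0);
      [apply (DPline PA (Wj U 0 a)), DPA | apply (DPline PB (Wj U 3 a)), DPB].
  - intros t. now apply Dlin.
  - apply tends_to_mult; [apply tends_to_const|].
    apply tends_to_plus; (apply tends_to_mult; [apply tends_to_const | assumption]). }
unfold NhatW. rewrite HW', HWm', !Int, HW, HWm, HW03.
fold (A0 x0) (B0 x0).
(* By antisymmetry the terms pairing W_0, or W_3, with its own integral cancel. *)
transitivity (/ k * (c * (em * m1 - ep * m2)) *
   (B0 x0 * (LA - PA (RtoC x0)) - A0 x0 * (LB - PB (RtoC x0)))); [ring|].
rewrite M, K0.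
replace (/ (- Ci / RtoC p) * - (1)) with (- (Ci * RtoC p)); [unfold A0, B0; ring|].
assert (NCi : Ci <> 0) by (intros E; apply (f_equal snd) in E; simpl in E; lra).
transitivity (- (Ci * Ci) * RtoC p / Ci); [field; exact NCi|].
rewrite Ci2. field. split; assumption.
Qed.
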